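(* Let $\varphi:[0,\infty)\to(0,\infty)$ be a convex function with $x=o(\varphi(x))$ as $x\to\infty$. Then there exists a continuous weight $h:[0,+\infty)\to\mathbb R$ such that the function $\psi(t)=h(e^t)$, $t\ge 0$, increases to $+\infty$ and satisfies $\psi(t)=o(\varphi(t))$ as $t\to\infty$, and such that the Fock type space $\mathcal F_h$ has a Riesz basis of normalized reproducing kernels (i.e. $\{\Bbbk_\lambda\}_{\lambda\in\Lambda}$ is a Riesz basis in $\mathcal F_h$ for some $\Lambda\subset\mathbb C$) and $\mathcal F_h$ is not, up to norm equivalence, a de Branges space.
   Context: A continuous function (weight) $h$ on $[0,+\infty)$ is extended to $\mathbb C$ by $h(z)=h(|z|)$. The Fock type space is the Hilbert space of entire functions $$\mathcal F_h=\Bigl\{f \text{ entire}:\ \|f\|^2=\int_{\mathbb C}|f(z)|^2e^{-h(z)}\,dm(z)<\infty\Bigr\},$$ where $dm$ is area Lebesgue measure. Point evaluations are bounded on $\mathcal F_h$; ${\bf k}_\lambda\in\mathcal F_h$ denotes the reproducing kernel at $\lambda\in\mathbb C$, i.e. $f(\lambda)=\langle f,{\bf k}_\lambda\rangle$ for all $f\in\mathcal F_h$, and $\Bbbk_\lambda={\bf k}_\lambda/\|{\bf k}_\lambda\|$ is the normalized reproducing kernel. For $\Lambda\subset\mathbb C$ (a sequence of distinct points), $\{\Bbbk_\lambda\}_{\lambda\in\Lambda}$ is a Riesz basis in $\mathcal F_h$ if it is complete (its linear span is dense) and for some $c,C>0$ one has $c\sum|a_\lambda|^2\le\|\sum a_\lambda\Bbbk_\lambda\|^2\le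 C\sum|a_\lambda|^2$ for all finite sequences $\{a_\lambda\}$ of complex numbers. De Branges spaces: an entire function $\mathcal E$ is of Hermite--Biehler class if $|\mathcal E(z)|>|\mathcal E(\bar z)|$ for $\operatorname{Im} z>0$. The de Branges space $\mathcal H(\mathcal E)$ is the Hilbert space of entire functions $F$ such that $F/\mathcal E$ and $F^*/\mathcal E$ belong to the Hardy space $H^2$ of the upper half-plane, where $F^*(z)=\overline{F(\bar z)}$, with norm $\|F\|^2_{\mathcal H(\mathcal E)}=\int_{\mathbb R}|F(x)|^2/|\mathcal E(x)|^2\,dx$. ''$\mathcal F_h$ is, up to norm equivalence, a de Branges space'' means that there is a Hermite--Biehler class function $\mathcal E$ such that $\mathcal F_h=\mathcal H(\mathcal E)$ as sets with equivalent norms. *)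

(* Defs.v *)
From HB Require Import structures.
From mathcomp Require Import all_boot all_order all_algebra.
From mathcomp Require Import all_classical all_reals all_analysis.
From mathcomp Require Import complex.
Set Implicit Arguments.
Unset Strict Implicit.
Unset Printing Implicit Defensive.
Import Order.TTheory GRing.Theory Num.Theory.
Import numFieldNormedType.Exports.
Local Open Scope classical_set_scope.
Local Open Scope ring_scope.
Local Open Scope complex_scope.

(* Without this instance [f =o_+oo g] does not typecheck. *)
Canonical pinfty_filter_on (R : realType) : filter_on R :=
  FilterType (pinfty_nbhs R) _.

(* R-valued modulus; `|z| lives in R[i]. *)
Notation cmod := ComplexField.Normc.normc.

(* The annotation [^o] makes R[i] a normed module over itself, so that
   [derivable] is complex differentiability. *)
Definition holomorphic_on (R : realType) (D : set R[i]) (f : R[i] -> R[i]) :=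
  forall z, D z -> derivable (f : R[i]^o -> R[i]^o) z 1.

Definition entire (R : realType) (f : R[i] -> R[i]) :=
  holomorphic_on setT f.

Definition cintegral (R : realType) d (T : measurableType d)
    (mu : {measure set T -> \bar R}) (f : T -> R[i]) : R[i] :=
  (\int[mu]_x complex.Re (f x)) +i* (\int[mu]_x complex.Im (f x)).

Definition area_measure (R : realType) :=
  (@lebesgue_measure R \x @lebesgue_measure R)%E.

(* Only the values of h on [0, +oo[ matter. *)
Definition fock_sqnorm (R : realType) (h : R -> R) (f : R[i] -> R[i]) : \bar R :=
  (\int[@area_measure R]_p
     (cmod (f (p.1 +i* p.2)) ^+ 2 * expR (- h (cmod (p.1 +i* p.2))))%:E)%E.

Definition fock_space (R : realType) (h : R -> R) : set (R[i] -> R[i]) :=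
  [set f | entire f /\ (fock_sqnorm h f < +oo)%E].

Definition fock_norm (R : realType) (h : R -> R) (f : R[i] -> R[i]) : R :=
  Num.sqrt (fine (fock_sqnorm h f)).

Definition fock_inner (R : realType) (h : R -> R) (f g : R[i] -> R[i]) : R[i] :=
  cintegral (@area_measure R)
    (fun p => f (p.1 +i* p.2) * conjc (g (p.1 +i* p.2)) *
              (expR (- h (cmod (p.1 +i* p.2))))%:C).

Definition reproducing_kernel (R : realType) (h : R -> R) (l : R[i])
    (k : R[i] -> R[i]) :=
  fock_space h k /\ forall f, fock_space h f -> f l = fock_inner h f k.

(* For k_l / ||k_l|| to make sense k_l must be nonzero: this excludes the
   degenerate weights with F_h = {0}, for which the quotient would be 0 / 0 = 0
   and the empty family a Riesz basis. *)
Definition normalized_kernel (R : realType) (h : R -> R) (l : R[i])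
    (e : R[i] -> R[i]) :=
  exists k, [/\ reproducing_kernel h l k, fock_norm h k != 0 &
    e = fun z => k z / (fock_norm h k)%:C].

Definition lincomb (R : realType) (e : R[i] -> R[i] -> R[i])
    (s : seq R[i]) (a : R[i] -> R[i]) : R[i] -> R[i] :=
  fun z => \sum_(l <- s) a l * e l z.

Definition riesz_basis (R : realType) (h : R -> R) (L : set R[i])
    (e : R[i] -> R[i] -> R[i]) :=
  (forall f, fock_space h f -> forall eps : R, 0 < eps ->
     exists s a, [/\ uniq s, [set` s] `<=` L &
       fock_norm h (fun z => f z - lincomb e s a z) < eps]) /\
  (exists c C : R, [/\ 0 < c, 0 < C & forall s a, uniq s -> [set` s] `<=` L ->
     c * \sum_(l <- s) cmod (a l) ^+ 2 <= fock_norm h (lincomb e s a) ^+ 2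
       <= C * \sum_(l <- s) cmod (a l) ^+ 2]).

(* The normalized kernels are required at every point of the plane, not only
   at the points of L, so that L = set0 is not a loophole when F_h = {0}. *)
Definition has_riesz_basis_of_kernels (R : realType) (h : R -> R) :=
  exists (e : R[i] -> R[i] -> R[i]) (L : set R[i]),
    [/\ forall l, normalized_kernel h l (e l), countable L & riesz_basis h L e].

Definition upper_half_plane (R : realType) : set R[i] := [set z | 0 < complex.Im z].

Definition hermite_biehler (R : realType) (E : R[i] -> R[i]) :=
  entire E /\ forall z, upper_half_plane z -> cmod (E (conjc z)) < cmod (E z).

Definition hardy2 (R : realType) (g : R[i] -> R[i]) :=
  holomorphic_on (@upper_half_plane R) g /\
  exists M : R, forall y : R, 0 < y ->
    (\int[@lebesgue_measure R]_x (cmod (g (x +i* y)) ^+ 2)%:E <= M%:E)%E.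

Definition de_branges_space (R : realType) (E : R[i] -> R[i]) :
    set (R[i] -> R[i]) :=
  [set F | [/\ entire F, hardy2 (fun z => F z / E z) &
               hardy2 (fun z => conjc (F (conjc z)) / E z)]].

(* At real zeros of E, a null set, the quotient is 0 by convention. *)
Definition de_branges_norm (R : realType) (E F : R[i] -> R[i]) : R :=
  Num.sqrt (fine (\int[@lebesgue_measure R]_x
    (cmod (F x%:C) ^+ 2 / cmod (E x%:C) ^+ 2)%:E)%E).

Definition fock_is_de_branges (R : realType) (h : R -> R) :=
  exists E : R[i] -> R[i],
    [/\ hermite_biehler E, fock_space h = de_branges_space E &
      exists c C : R, [/\ 0 < c, 0 < C & forall f, fock_space h f ->
        c * fock_norm h f <= de_branges_norm E f <= C * fock_norm h f]].

(* Main.v *)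
Require Import Defs.
From HB Require Import structures.
From mathcomp Require Import all_boot all_order all_algebra.
From mathcomp Require Import all_classical all_reals all_analysis.
From mathcomp Require Import measurable_realfun complex ring lra zify.
Import Order.TTheory GRing.Theory Num.Theory.
Import numFieldNormedType.Exports.
Local Open Scope classical_set_scope.
Local Open Scope ring_scope.
Local Open Scope complex_scope.
Set Implicit Arguments.
Unset Strict Implicit.
Unset Printing Implicit Defensive.

(* Normalized reproducing kernels at 2^j equidistributed points of the circles
   |z| = 2^(K j), j = 0, 1, ..., are the Riesz basis, for a rapidly increasing
   sequence K. The weight e^(-h) is a sum over k of tents supported in the discs
   |z| <= 2^k, whose coefficients are chosen so that for 2^j <= n + 1 < 2^(j+1)
   the squared norm of z^n comes essentially from the tent with k = K j, and is
   thus comparable with q_j 4^(n K j). Hence the Gram matrix is almost block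
   diagonal, and each block is a discrete Fourier transform up to bounded
   diagonal factors. By choosing K sparse one makes h (e^t) as small as desired
   subject to superlinearity.

   For the second claim let m = 2^j - 1 and w = i 2^(K j). The functions
   F = z^m (z^m - w^m) and G = F (z + w) / (z - w) have equal modulus on the real
   line, hence equal norms in any de Branges space; but
   G = z^m (z^m + 2 z^(m-1) w + ... + 2 z w^(m-1) + w^m), so that
   the quotient of the squared Fock norms of G and F is at least of order m. *)

(** Membership in [fock_space] means complex differentiability and a finite integral, whereas every
    estimate concerns Taylor coefficients. The bridge is Cauchy's theory on squares, whose sides are
    segments, so that neither curves nor trigonometric functions occur, followed by Parseval's
    formula for radial weights, where averages over roots of unity of order 2^j replace integration
    over the angle. From then on the space is a weighted l^2 space of coefficients, with the moments
    of the weight as weights. Blocks of length 2^j make the number of nodes on a circle equal to the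
    number of monomials attached to it, and roots of unity of order 2^j come from iterated square
    roots. Tents, unlike indicators of discs, make h continuous and strictly increasing, and their
    moments are still explicit. The coefficient of the k-th tent is 2 to the power of about -k
    2^(level k), so h(e^t) is at most of order 2^(level) t, where the level tends to infinity as
    slowly as desired. Hence h(e^t) is barely more than linear, and x = o(phi(x)) leaves just enough
    room for it. *)

Lemma le_of_eq d (T : porderType d) (x y : T) : x = y -> (x <= y)%O.
Proof. by move->. Qed.

(** Multiplying out the difference quotient admits [h = 0], where the inequality is trivial, so
    later estimates meet neither punctured neighbourhoods nor divisions. *)
Lemma is_deriveP (K : numFieldType) (f : K^o -> K^o) (x d : K^o) :
  is_derive x 1 f d <-> (forall e : K, 0 < e -> exists2 r : K, 0 < r &
    forall h, `|h| < r -> `|f (x + h) - f x - d * h| <= e * `|h|).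
Proof.
have quot h : h != 0 -> `|d - h^-1 *: ((f \o shift x) (h *: 1) - f x)| * `|h| =
    `|f (x + h) - f x - d * h|.
  move=> h0; rewrite -normrM -[RHS]normrN; congr `|_|.
  rewrite /= /GRing.scale /= mulr1 mulrBl (mulrC h^-1) mulfVK// [h + x]addrC; ring.
have cvgP : (h^-1 *: ((f \o shift x) (h *: 1) - f x) @[h --> (0:K)^'] --> d) <->
  (forall e : K, 0 < e -> exists2 r : K, 0 < r &
    forall h, `|h| < r -> `|f (x + h) - f x - d * h| <= e * `|h|).
  split=> [/cvgrPdist_le H e e0|H].
    have := H e e0; rewrite /dnbhs near_withinE => /nbhs_norm0P[r /= r0 rH].
    exists r => // h hr; have [->|h0] := eqVneq h 0.
      by rewrite addr0 subrr mulr0 subr0 normr0 mulr0.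
    by rewrite -quot// ler_pM2r ?normr_gt0//; exact: rH.
  apply/cvgrPdist_le => e e0; have [r r0 rH] := H e e0.
  near=> h; have h0 : h != 0 by near: h; exact: nbhs_dnbhs_neq.
  rewrite -(@ler_pM2r _ `|h|) ?normr_gt0// quot//; apply: rH.
  by near: h; exact: dnbhs0_lt.
rewrite -cvgP; split=> [fd|H].
  have [df] := fd => <-; exact: df.
apply: DeriveDef; first by apply/cvg_ex; exists d.
exact: cvg_lim.
Unshelve. all: by end_near. Qed.

(** * Modulus and line integrals *)

Section cmodulus.
Variable R : realType.
Implicit Types z w : R[i].

Lemma cmod_ge0 z : 0 <= cmod z.
Proof. by case: z => a b; exact: sqrtr_ge0. Qed.

Lemma cmod0 : cmod (0 : R[i]) = 0.
Proof. exact: ComplexField.Normc.normc0. Qed.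

Lemma cmod1 : cmod (1 : R[i]) = 1.
Proof. exact: ComplexField.Normc.normc1. Qed.

Lemma cmodM z w : cmod (z * w) = cmod z * cmod w.
Proof. exact: ComplexField.Normc.normcM. Qed.

Lemma cmodV z : cmod z^-1 = (cmod z)^-1.
Proof. exact: ComplexField.Normc.normcV. Qed.

Lemma cmodN z : cmod (- z) = cmod z.
Proof. exact: normcN. Qed.

Lemma cmodD z w : cmod (z + w) <= cmod z + cmod w.
Proof. exact: le_normcD. Qed.

Lemma cmodB z w : cmod (z - w) <= cmod z + cmod w.
Proof. by rewrite -(cmodN w) cmodD. Qed.

Lemma cmod_eq0 z : (cmod z == 0) = (z == 0).
Proof.
apply/eqP/eqP => [/ComplexField.Normc.eq0_normc//|->]; exact: cmod0.
Qed.

Lemma cmod_gt0 z : (0 < cmod z) = (z != 0).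
Proof. by rewrite lt_def cmod_ge0 andbT cmod_eq0. Qed.

Lemma cmodX z n : cmod (z ^+ n) = cmod z ^+ n.
Proof.
elim: n => [|n IH]; first by rewrite !expr0 cmod1.
by rewrite !exprS cmodM IH.
Qed.

Lemma normcmod z : `|z| = (cmod z)%:C.
Proof. by rewrite normc_def; case: z. Qed.

Lemma sqr_cmod z : cmod z ^+ 2 = complex.Re z ^+ 2 + complex.Im z ^+ 2.
Proof. by case: z => a b /=; rewrite sqr_sqrtr// addr_ge0 ?sqr_ge0. Qed.

Lemma cmodR (x : R) : cmod x%:C = `|x|.
Proof. by rewrite /= expr0n/= addr0 sqrtr_sqr. Qed.

Lemma cmodi : cmod ('i : R[i]) = 1.
Proof. by rewrite /= expr0n/= add0r expr1n sqrtr1. Qed.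

Lemma cmodJ z : cmod (conjc z) = cmod z.
Proof. by case: z => a b /=; rewrite sqrrN. Qed.

Lemma cmod_Re z : `|complex.Re z| <= cmod z.
Proof.
by rewrite -(@ler_pXn2r _ 2)// ?nnegrE ?cmod_ge0// sqr_cmod real_normK ?num_real// lerDl sqr_ge0.
Qed.

Lemma cmod_Im z : `|complex.Im z| <= cmod z.
Proof.
by rewrite -(@ler_pXn2r _ 2)// ?nnegrE ?cmod_ge0// sqr_cmod real_normK ?num_real// lerDr sqr_ge0.
Qed.

Lemma cmod_le_ReIm z : cmod z <= `|complex.Re z| + `|complex.Im z|.
Proof.
case: z => a b; rewrite (_ : a +i* b = a%:C + 'i * b%:C); last first.
  by rewrite [LHS]complexE.
by rewrite (le_trans (cmodD _ _))// cmodM cmodi mul1r !cmodR /= !(mul0r, mul1r, mulr0, add0r,subr0,addr0).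
Qed.

Lemma cmod_sum (I : Type) (s : seq I) (P : pred I) (F : I -> R[i]) :
  cmod (\sum_(i <- s | P i) F i) <= \sum_(i <- s | P i) cmod (F i).
Proof.
elim/big_rec2: _ => [|i y1 y2 _ IH]; first by rewrite cmod0.
by rewrite (le_trans (cmodD _ _))// lerD2l.
Qed.

Lemma cmod_nat n : cmod (n%:R : R[i]) = n%:R.
Proof. by rewrite -(rmorph_nat (@real_complex R)) cmodR ger0_norm. Qed.

(** Complex differentiability with real [e], [r] and the real modulus, so that all estimates take
    place in a totally ordered field. *)
Definition cderiv (f : R[i] -> R[i]) z (d : R[i]) :=
  forall e : R, 0 < e -> exists2 r : R, 0 < r &
    forall h, cmod h < r -> cmod (f (z + h) - f z - d * h) <= e * cmod h.

Lemma is_derive_cderiv (f : R[i] -> R[i]) z d :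
  is_derive (z : R[i]^o) 1 (f : R[i]^o -> R[i]^o) d <-> cderiv f z d.
Proof.
rewrite is_deriveP; split=> H e e0.
  have [|r r0 rH] := H e%:C; first by rewrite ltcR.
  have rE : r = (complex.Re r)%:C by case: r r0 {rH} => a b; rewrite ltcE => /andP[/eqP/= -> _].
  move: r0 rH; rewrite rE ltcR => r0 rH; exists (complex.Re r) => // h hr.
  by have := rH h; rewrite !normcmod !ltcR -rmorphM lecR; exact.
have eE : e = (complex.Re e)%:C by case: e e0 => a b; rewrite ltcE => /andP[/eqP/= -> _].
move: e0; rewrite eE ltcR => e0; have [r r0 rH] := H _ e0.
exists r%:C; first by rewrite ltcR.
by move=> h; rewrite !normcmod !ltcR -rmorphM lecR; exact: rH.
Qed.

Definition ccont (f : R[i] -> R[i]) := forall z (e : R), 0 < e ->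
  exists2 r : R, 0 < r & forall h, cmod h < r -> cmod (f (z + h) - f z) < e.

End cmodulus.

Arguments ComplexField.Normc.normc : simpl never.

(** * Integrals of continuous functions by antiderivatives *)

Section primitives.
Variable R : realType.
Implicit Types (u v U V : R -> R).

Definition antiderivative U u := forall x : R, is_derive x (1 : R) (U : R -> R) (u x).

Lemma is_derive_eps U (x d : R) :
  (forall e : R, 0 < e -> exists2 r : R, 0 < r &
    forall h, `|h| < r -> `|U (x + h) - U x - d * h| <= e * `|h|) ->
  is_derive x (1 : R) U d.
Proof. by move=> H; exact: (@is_deriveP R U x d).2. Qed.

Lemma continuous_eps u : (forall (x e : R), 0 < e -> exists2 r : R, 0 < r &
    forall h, `|h| < r -> `|u (x + h) - u x| < e) -> continuous u.
Proof.
move=> H x; apply/cvgrPdist_lt => e e0; have [r r0 rH] := H x e e0.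
near=> y; rewrite distrC (_ : y = x + (y - x)); last by ring.
by apply: rH; rewrite distrC; near: y; exact: cvgr_dist_lt.
Unshelve. all: by end_near. Qed.

Lemma antiderivative_continuous U u : antiderivative U u -> continuous U.
Proof.
move=> H x; apply/differentiable_continuous/derivable1_diffP.
by have [] := H x.
Qed.

Lemma antiderivative_bound U u (a b M : R) : a <= b -> antiderivative U u ->
  (forall x, a <= x <= b -> `|u x| <= M) -> `|U b - U a| <= M * (b - a).
Proof.
move=> ab H uM; have [|c + ->] := MVT_segment ab (fun x _ => H x).
  exact/continuous_subspaceT/(antiderivative_continuous H).
by rewrite in_itv /= => /uM cM; rewrite normrM (ger0_norm (_ : 0 <= b - a)) ?subr_ge0// ler_wpM2r ?subr_ge0//.
Qed.

Lemma antiderivativeD U V u v : antiderivative U u -> antiderivative V v ->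
  antiderivative (fun x => U x + V x) (fun x => u x + v x).
Proof. by move=> HU HV x; exact: is_deriveD. Qed.

Lemma antiderivativeZ U u c : antiderivative U u ->
  antiderivative (fun x => c * U x) (fun x => c * u x).
Proof. by move=> HU x; exact: is_deriveZ. Qed.

Lemma antiderivative_diff U V u a b : antiderivative U u -> antiderivative V u ->
  U b - U a = V b - V a.
Proof.
wlog ab : a b / a <= b => [H HU HV|HU HV].
  have [/H|/ltW/H] := leP a b; first exact.
  by move=> /(_ HU HV) E; rewrite -[LHS]opprB E opprB.
have HD := antiderivativeD HU (antiderivativeZ (-1) HV).
have := @antiderivative_bound _ _ a b 0 ab HD.
rewrite mul0r normr_le0 => E; apply/eqP; rewrite -subr_eq0.
have /eqP <- : U b + -1 * V b - (U a + -1 * V a) == 0.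
  by apply: E => x _; rewrite mulN1r subrr normr0.
by apply/eqP; ring.
Qed.

(** The fundamental theorem of calculus concerns integrals from a base point [- N]. Subtracting the
    integral up to 0 makes [F N x] independent of [N] once [- N] lies to the left of both [x] and 0,
    so [N] may vary with [x]. *)
Lemma continuous_has_antiderivative u : continuous u ->
  exists U, antiderivative U u.
Proof.
move=> cu.
pose mu := @lebesgue_measure R.
have iu a b : mu.-integrable `[a, b] (EFin \o u).
  apply: continuous_compact_integrable; first exact: segment_compact.
  exact: continuous_subspaceT.
pose F (N x : R) := \int[mu]_(t in `[- N, x]) u t - \int[mu]_(t in `[- N, 0]) u t.
have dF (N x : R) : - N < x -> is_derive x (1 : R) (F N) (u x).
  move=> Nx; have [|] := @continuous_FTC1_closed _ u (- N) x (x + 1) _ (iu _ _) Nx (cu x).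
    by rewrite ltrDl.
  move=> /derivableP + d2; rewrite -derive1E d2 => D; rewrite -[u x]subr0.
  exact: (is_deriveB D (is_derive_cst _ _ _)).
have chasles (a b c : R) : a <= b -> b <= c -> \int[mu]_(t in `[a, c]) u t =
    \int[mu]_(t in `[a, b]) u t + \int[mu]_(t in `[b, c]) u t.
  move=> ab bc; have := @Rintegral_itvB R u (BLeft a) (BRight c) b (iu a c).
  rewrite !bnd_simp => /(_ ab bc) /eqP; rewrite subr_eq => /eqP ->.
  rewrite addrC; congr (_ + _); rewrite Rintegral_itv_obnd_cbnd//.
  apply: (integrableS _ _ _ (iu b c)) => //; exact: subset_itv_oc_cc.
have FE (N M x : R) : 0 <= M -> M <= N -> - M <= x -> F N x = F M x.
  move=> M0 MN Mx; rewrite /F (chasles (- N) (- M) x) ?lerN2//.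
  by rewrite (chasles (- N) (- M) 0) ?lerN2 ?oppr_le0//; ring.
exists (fun x => F (`|x| + 1) x) => x.
have xN := ler_norm (- x); rewrite normrN in xN.
have E : {near x, F (`|x| + 2) =1 (fun x => F (`|x| + 1) x)}.
  near=> y; apply: FE; first by rewrite addr_ge0.
    rewrite -[2](addrK 1) addrAC (_ : 2 - 1 = 1 :> R); last by ring.
    rewrite addrA lerD2r; have yx : `|x - y| < 1.
      by near: y; apply: cvgr_dist_lt.
    have := ler_normB x (x - y); rewrite opprB addrCA subrr addr0 => /le_trans; apply.
    by rewrite lerD2l ltW.
  by have := ler_norm (- y); rewrite normrN; lra.
apply: (near_eq_is_derive E); apply: dF; lra.
Unshelve. all: by end_near. Qed.

(** All antiderivatives give the same difference. Fixing one of them makes the splitting of an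
    interval an identity, free of conditions on order or continuity; the default [u] is met only if
    there is no antiderivative. *)
Definition integ u (a b : R) :=
  let U := xget u [set U | antiderivative U u] in U b - U a.

Lemma integE U u a b : antiderivative U u -> integ u a b = U b - U a.
Proof.
move=> HU; rewrite /integ; case: xgetP => [V _ /= HV|/(_ U)/(_ HU)//].
exact: antiderivative_diff.
Qed.

Lemma integD u v a b : continuous u -> continuous v ->
  integ (fun x => u x + v x) a b = integ u a b + integ v a b.
Proof.
move=> /continuous_has_antiderivative[U HU] /continuous_has_antiderivative[V HV].
by rewrite (integE _ _ (antiderivativeD HU HV)) (integE _ _ HU) (integE _ _ HV); ring.
Qed.

Lemma integZ u c a b : continuous u ->
  integ (fun x => c * u x) a b = c * integ u a b.
Proof.
move=> /continuous_has_antiderivative[U HU].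
by rewrite (integE _ _ (antiderivativeZ c HU)) (integE _ _ HU); ring.
Qed.

Lemma integ_split u a b c : integ u a c = integ u a b + integ u b c.
Proof. by rewrite /integ; ring. Qed.

Lemma integ_bound u (a b M : R) : a <= b -> continuous u ->
  (forall x, a <= x <= b -> `|u x| <= M) -> `|integ u a b| <= M * (b - a).
Proof.
move=> ab /continuous_has_antiderivative[U HU] uM; rewrite (integE _ _ HU).
exact: antiderivative_bound.
Qed.

Lemma integ_ge u (a b m : R) : a <= b -> continuous u ->
  (forall x, a <= x <= b -> m <= u x) -> m * (b - a) <= integ u a b.
Proof.
move=> ab /continuous_has_antiderivative[U HU] uM; rewrite (integE _ _ HU).
have [|c + ->] := MVT_segment ab (fun x _ => HU x).
  exact/continuous_subspaceT/(antiderivative_continuous HU).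
by rewrite in_itv /= => /uM cM; rewrite ler_wpM2r ?subr_ge0.
Qed.

Lemma integ_le u (a b m : R) : a <= b -> continuous u ->
  (forall x, a <= x <= b -> u x <= m) -> integ u a b <= m * (b - a).
Proof.
move=> ab /continuous_has_antiderivative[U HU] uM; rewrite (integE _ _ HU).
have [|c + ->] := MVT_segment ab (fun x _ => HU x).
  exact/continuous_subspaceT/(antiderivative_continuous HU).
by rewrite in_itv /= => /uM cM; rewrite ler_wpM2r ?subr_ge0.
Qed.

End primitives.

Section line_integrals.
Variable R : realType.
Implicit Types (f g : R -> R[i]) (G : R[i] -> R[i]).
Local Notation re := complex.Re.
Local Notation im := complex.Im.

Definition lcont f := continuous (fun t => re (f t)) /\ continuous (fun t => im (f t)).

Definition cinteg f a b : R[i] :=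
  integ (fun t => re (f t)) a b +i* integ (fun t => im (f t)) a b.

Lemma complex_ext (z w : R[i]) : re z = re w -> im z = im w -> z = w.
Proof. by case: z w => [a b] [c d] /= -> ->. Qed.

Lemma ReD (z w : R[i]) : re (z + w) = re z + re w.
Proof. by case: z w => [a b] [c d]. Qed.
Lemma ImD (z w : R[i]) : im (z + w) = im z + im w.
Proof. by case: z w => [a b] [c d]. Qed.
Lemma ReN (z : R[i]) : re (- z) = - re z.
Proof. by case: z. Qed.
Lemma ImN (z : R[i]) : im (- z) = - im z.
Proof. by case: z. Qed.
Lemma ReM (z w : R[i]) : re (z * w) = re z * re w - im z * im w.
Proof. by case: z w => [a b] [c d]. Qed.
Lemma ImM (z w : R[i]) : im (z * w) = re z * im w + im z * re w.
Proof. by case: z w => [a b] [c d]. Qed.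
Definition ReImE := (ReD, ImD, ReN, ImN, ReM, ImM).

Lemma lcontD f g : lcont f -> lcont g -> lcont (fun t => f t + g t).
Proof.
move=> [f1 f2] [g1 g2]; split => t; under eq_fun do rewrite !ReImE.
  by apply: cvgD; [exact: f1|exact: g1].
by apply: cvgD; [exact: f2|exact: g2].
Qed.

Lemma lcontM f g : lcont f -> lcont g -> lcont (fun t => f t * g t).
Proof.
move=> [f1 f2] [g1 g2]; split => t; under eq_fun do rewrite !ReImE.
  by apply: cvgB; apply: cvgM; [exact: f1|exact: g1|exact: f2|exact: g2].
by apply: cvgD; apply: cvgM; [exact: f1|exact: g2|exact: f2|exact: g1].
Qed.

Lemma lcont_cst (c : R[i]) : lcont (fun=> c).
Proof. by split => t; exact: cvg_cst. Qed.

Lemma cintegD f g a b : lcont f -> lcont g ->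
  cinteg (fun t => f t + g t) a b = cinteg f a b + cinteg g a b.
Proof.
move=> [f1 f2] [g1 g2]; rewrite /cinteg; apply: complex_ext; rewrite ReImE /=;
by under eq_fun do rewrite ReImE; rewrite integD.
Qed.

Lemma cintegZ f c a b : lcont f ->
  cinteg (fun t => c * f t) a b = c * cinteg f a b.
Proof.
move=> [f1 f2]; rewrite /cinteg; apply: complex_ext; rewrite ReImE /=;
  under eq_fun do rewrite ReImE.
  under eq_fun do rewrite -mulNr.
  by rewrite integD ?integZ ?mulNr// => x; apply: cvgM;
     [exact: cvg_cst|exact: f1|exact: cvg_cst|exact: f2].
by rewrite integD ?integZ// => x; apply: cvgM;
     [exact: cvg_cst|exact: f2|exact: cvg_cst|exact: f1].
Qed.

Lemma cinteg_split f a b c : cinteg f a c = cinteg f a b + cinteg f b c.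
Proof.
by apply: complex_ext; rewrite ReImE /=; exact: integ_split.
Qed.

Lemma cinteg_bound f (a b M : R) : a <= b -> lcont f ->
  (forall x, a <= x <= b -> cmod (f x) <= M) ->
  cmod (cinteg f a b) <= 2 * M * (b - a).
Proof.
move=> ab [f1 f2] fM; rewrite (le_trans (cmod_le_ReIm _))//= -mulrA mulr_natl mulr2n.
by apply: lerD; apply: integ_bound => // x /fM; apply: le_trans;
  [exact: cmod_Re|exact: cmod_Im].
Qed.

Lemma cintegE f (F : R -> R[i]) a b :
  antiderivative (fun t => re (F t)) (fun t => re (f t)) ->
  antiderivative (fun t => im (F t)) (fun t => im (f t)) ->
  cinteg f a b = F b - F a.
Proof.
by move=> H1 H2; apply: complex_ext; rewrite !ReImE /=; [rewrite (integE _ _ H1)|rewrite (integE _ _ H2)].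
Qed.

Lemma add_hline (t c h : R) : (t +i* c) + h%:C = (t + h) +i* c.
Proof. by apply: complex_ext; rewrite ReImE //= addr0. Qed.

Lemma add_vline (t c h : R) : (c +i* t) + 'i * h%:C = c +i* (t + h).
Proof.
by apply: complex_ext; rewrite !ReImE /= !(mul0r,mulr0,mul1r,subr0,addr0,add0r).
Qed.

Lemma is_derive_hline G g c : (forall t : R, cderiv G (t +i* c) (g t)) ->
  antiderivative (fun t => re (G (t +i* c))) (fun t => re (g t)) /\
  antiderivative (fun t => im (G (t +i* c))) (fun t => im (g t)).
Proof.
move=> H; split=> t; apply: is_derive_eps => e e0; have [r r0 rH] := H t e e0;
exists r => // h hr; have := rH h%:C; rewrite cmodR add_hline => /(_ hr); apply: le_trans.
  by apply: le_trans (cmod_Re _); rewrite !ReImE /= mulr0 subr0.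
by apply: le_trans (cmod_Im _); rewrite !ReImE /= mulr0 add0r.
Qed.

Lemma is_derive_vline G g c : (forall t : R, cderiv G (c +i* t) (g t)) ->
  antiderivative (fun t => re (G (c +i* t))) (fun t => re ('i * g t)) /\
  antiderivative (fun t => im (G (c +i* t))) (fun t => im ('i * g t)).
Proof.
move=> H; split=> t; apply: is_derive_eps => e e0; have [r r0 rH] := H t e e0;
exists r => // h hr; have := rH ('i * h%:C); rewrite cmodM cmodi mul1r cmodR add_vline => /(_ hr); apply: le_trans.
  apply: le_trans (cmod_Re _); rewrite !ReImE /=; apply: le_of_eq; congr `|_|; ring.
apply: le_trans (cmod_Im _); rewrite !ReImE /=; apply: le_of_eq; congr `|_|; ring.
Qed.

Lemma ccont_hline G c : ccont G -> lcont (fun t => G (t +i* c)).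
Proof.
move=> H; split; apply: continuous_eps => t e e0; have [r r0 rH] := H (t +i* c) e e0;
exists r => // h hr; have := rH h%:C; rewrite cmodR add_hline => /(_ hr); apply: le_lt_trans.
  by apply: le_trans (cmod_Re _); rewrite !ReImE.
by apply: le_trans (cmod_Im _); rewrite !ReImE.
Qed.

Lemma ccont_vline G c : ccont G -> lcont (fun t => G (c +i* t)).
Proof.
move=> H; split; apply: continuous_eps => t e e0; have [r r0 rH] := H (c +i* t) e e0;
exists r => // h hr; have := rH ('i * h%:C); rewrite cmodM cmodi mul1r cmodR add_vline => /(_ hr); apply: le_lt_trans.
  by apply: le_trans (cmod_Re _); rewrite !ReImE.
by apply: le_trans (cmod_Im _); rewrite !ReImE.
Qed.

Lemma cinteg_affine (p q : R[i]) (a b : R) :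
  cinteg (fun t => p + q * t%:C) a b = (p + q * ((a + b) / 2)%:C) * (b - a)%:C.
Proof.
have pol (u v : R) : antiderivative (fun t => u * t + v / 2 * t ^+ 2) (fun t => u + v * t).
  by move=> t; apply: is_derive_eq; rewrite /GRing.scale /=; field.
rewrite (@cintegE _ (fun t => p * t%:C + q * (t ^+ 2 / 2)%:C)); last 2 first.
- move=> t; rewrite (_ : (fun t0 => re _) = (fun x => re p * x + re q / 2 * x ^+ 2)).
    rewrite (_ : re (p + q * t%:C) = re p + re q * t); first exact: pol.
    by rewrite !ReImE /=; ring.
  by apply/funext => s; rewrite !ReImE /=; field.
- move=> t; rewrite (_ : (fun t0 => im _) = (fun x => im p * x + im q / 2 * x ^+ 2)).
    rewrite (_ : im (p + q * t%:C) = im p + im q * t); first exact: pol.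
    by rewrite !ReImE /=; ring.
  by apply/funext => s; rewrite !ReImE /=; field.
by apply: complex_ext; rewrite !ReImE /=; field.
Qed.

End line_integrals.

(** * Goursat and Cauchy on squares *)

Section goursat.
Variable R : realType.
Implicit Types (f g : R[i] -> R[i]) (a b c d x y : R).
Local Notation re := complex.Re.
Local Notation im := complex.Im.

(** The contour integral along the boundary of the rectangle with sides [[a, b]] and [[c, d]],
    counterclockwise; ['i] is the derivative of the parametrization of the vertical sides. *)
Definition rectint f a b c d : R[i] :=
  cinteg (fun t => f (t +i* c)) a b + 'i * cinteg (fun t => f (b +i* t)) c d
  - cinteg (fun t => f (t +i* d)) a b - 'i * cinteg (fun t => f (a +i* t)) c d.

Arguments rectint : simpl never.

Lemma rectint_hsplit f a m b c d :
  rectint f a b c d = rectint f a m c d + rectint f m b c d.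
Proof.
by rewrite /rectint (cinteg_split (fun t => f (t +i* c)) a m b)
  (cinteg_split (fun t => f (t +i* d)) a m b); ring.
Qed.

Lemma rectint_vsplit f a b c m d :
  rectint f a b c d = rectint f a b c m + rectint f a b m d.
Proof.
by rewrite /rectint (cinteg_split (fun t => f (b +i* t)) c m d)
  (cinteg_split (fun t => f (a +i* t)) c m d); ring.
Qed.

Lemma rectint_bound f a b c d M : ccont f -> a <= b -> c <= d ->
  (forall x y, a <= x <= b -> c <= y <= d -> cmod (f (x +i* y)) <= M) ->
  cmod (rectint f a b c d) <= 4 * M * (b - a + (d - c)).
Proof.
move=> cf ab cd fM; rewrite /rectint.
have B1 : cmod (cinteg (fun t => f (t +i* c)) a b) <= 2 * M * (b - a).
  by apply: cinteg_bound => //; [exact: ccont_hline|move=> x xab; apply: fM; rewrite ?lexx].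
have B2 : cmod (cinteg (fun t => f (t +i* d)) a b) <= 2 * M * (b - a).
  by apply: cinteg_bound => //; [exact: ccont_hline|move=> x xab; apply: fM; rewrite ?lexx ?cd].
have B3 : cmod ('i * cinteg (fun t => f (b +i* t)) c d) <= 2 * M * (d - c).
  by rewrite cmodM cmodi mul1r; apply: cinteg_bound => //; [exact: ccont_vline|move=> x xab; apply: fM; rewrite ?lexx ?ab].
have B4 : cmod ('i * cinteg (fun t => f (a +i* t)) c d) <= 2 * M * (d - c).
  by rewrite cmodM cmodi mul1r; apply: cinteg_bound => //; [exact: ccont_vline|move=> x xab; apply: fM; rewrite ?lexx ?ab].
apply: le_trans (cmodB _ _) _; apply: le_trans (lerD (cmodB _ _) B4) _.
by apply: le_trans (lerD (lerD (cmodD _ _) (lexx _)) (lexx _)) _; lra.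
Qed.

Lemma rectintD f g a b c d : ccont f -> ccont g ->
  rectint (fun z => f z + g z) a b c d = rectint f a b c d + rectint g a b c d.
Proof.
move=> cf cg; rewrite /rectint !cintegD; try exact: ccont_hline; try exact: ccont_vline.
ring.
Qed.

Lemma add_complex x y : x +i* y = x%:C + 'i * y%:C.
Proof. by rewrite [LHS]complexE. Qed.

Lemma rectint_affine (p q : R[i]) a b c d :
  rectint (fun z => p + q * z) a b c d = 0.
Proof.
rewrite /rectint.
have E e : cinteg (fun t => p + q * (t +i* e)) a b =
    (p + q * 'i * e%:C + q * ((a + b) / 2)%:C) * (b - a)%:C.
  rewrite -cinteg_affine; congr cinteg; apply/funext => t.
  by rewrite add_complex; ring.
have F e : cinteg (fun t => p + q * (e +i* t)) c d =
    (p + q * e%:C + q * 'i * ((c + d) / 2)%:C) * (d - c)%:C.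
  rewrite -cinteg_affine; congr cinteg; apply/funext => t.
  by rewrite add_complex; ring.
rewrite !E !F !rmorphB /=; move: (_ / _)%:C (_ / _)%:C a%:C b%:C c%:C d%:C.
by move=> *; ring.
Qed.

Lemma ccont_affine (p q : R[i]) : ccont (fun z => p + q * z).
Proof.
move=> z e e0; exists (e / (cmod q + 1)).
  by rewrite divr_gt0// ltr_wpDl ?cmod_ge0.
move=> h hr; rewrite (_ : _ - _ = q * h); last by ring.
rewrite cmodM; have q1 : 0 < cmod q + 1 by rewrite ltr_wpDl ?cmod_ge0.
rewrite ltr_pdivlMr// mulrC in hr; apply: le_lt_trans hr.
by rewrite ler_wpM2r ?cmod_ge0// lerDl.
Qed.

Lemma ccontD f g : ccont f -> ccont g -> ccont (fun z => f z + g z).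
Proof.
move=> cf cg z e e0; have e2 : 0 < e / 2 by rewrite divr_gt0.
have [r r0 rf] := cf z _ e2; have [s s0 sg] := cg z _ e2.
exists (Num.min r s); first by rewrite lt_min r0.
move=> h; rewrite lt_min => /andP[/rf hf /sg hg].
rewrite (_ : _ - _ = (f (z + h) - f z) + (g (z + h) - g z)); last by ring.
by apply: le_lt_trans (cmodD _ _) _; lra.
Qed.

Definition cdiffble f z := exists D, cderiv f z D.

(* The integral of the affine part vanishes, so only the remainder o(|z - z0|) contributes. *)
Lemma rectint_local f x0 y0 e : ccont f -> cdiffble f (x0 +i* y0) -> 0 < e ->
  exists2 r, 0 < r & forall a b c d, a <= x0 <= b -> c <= y0 <= d ->
    (b - a + (d - c)) < r ->
    cmod (rectint f a b c d) <= e * (b - a + (d - c)) ^+ 2.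
Proof.
move=> cf [D fD] e0; set z0 := x0 +i* y0.
have [r r0 rH] := fD (e / 4) (divr_gt0 e0 (ltr0n _ 4)).
exists r => // a b c d xab ycd sr.
pose g z := f z + ((D * z0 - f z0) + (- D) * z).
have cg : ccont g by apply: ccontD => //; exact: ccont_affine.
have -> : rectint f a b c d = rectint g a b c d.
  by rewrite rectintD//; [rewrite rectint_affine addr0|exact: ccont_affine].
have ab : a <= b by case/andP: xab; exact: le_trans.
have cd : c <= d by case/andP: ycd; exact: le_trans.
apply: le_trans (rectint_bound (M := e / 4 * (b - a + (d - c))) cg ab cd _) _; last first.
  by apply: le_of_eq; field.
move=> x y xx yy.
have hE : x +i* y - z0 = (x - x0) +i* (y - y0) by [].
have hle : cmod (x +i* y - z0) <= b - a + (d - c).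
  rewrite hE (le_trans (cmod_le_ReIm _))//= lerD// ler_norml; apply/andP; lra.
have := rH (x +i* y - z0) (le_lt_trans hle sr).
rewrite [z0 + _]addrC subrK => H; rewrite /g.
rewrite (_ : _ + _ = f (x +i* y) - f z0 - D * (x +i* y - z0)); last by ring.
by apply: le_trans H _; rewrite ler_wpM2l// divr_ge0// ltW.
Qed.

Lemma nested_segments (l r : nat -> R) : (forall n, l n <= l n.+1) ->
  (forall n, r n.+1 <= r n) -> (forall n, l n <= r n) ->
  exists x, forall n, l n <= x <= r n.
Proof.
move=> /nondecreasing_seqP lh /nonincreasing_seqP rh lr.
have lrmn m n : l m <= r n.
  apply: le_trans (lh _ _ (leq_maxl m n)) _; apply: le_trans (lr _) _.
  by apply: rh; exact: leq_maxr.
exists (sup (range l)) => n; apply/andP; split.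
  by apply: ub_le_sup; [exists (r 0%N) => _ [m _ <-]|exists n].
by apply: ge_sup; [exists (l 0%N), 0%N|move=> _ [m _ <-]].
Qed.

(** Goursat's bisection: one of the four quarters carries at least a quarter of the integral. Along
    the nested rectangles this contradicts [rectint_local], whose bound is quadratic in the size
    with an arbitrarily small constant. *)
Lemma goursat f a b c d : a <= b -> c <= d -> ccont f ->
  (forall x y, a <= x <= b -> c <= y <= d -> cdiffble f (x +i* y)) ->
  rectint f a b c d = 0.
Proof.
move=> ab cd cf df; apply/eqP; rewrite -cmod_eq0; apply/negPn/negP => K0.
pose K := cmod (rectint f a b c d); have {}K0 : 0 < K by rewrite lt_def K0 cmod_ge0.
pose A := b - a; pose B := d - c.
have A0 : 0 <= A by rewrite subr_ge0. have B0 : 0 <= B by rewrite subr_ge0.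
(* [p] is the lower left corner of a rectangle of the n-th generation that still carries its share
   [K / 4 ^+ n]. *)
pose P n (p : R * R) := K / 4 ^+ n <=
  cmod (rectint f p.1 (p.1 + A / 2 ^+ n) p.2 (p.2 + B / 2 ^+ n)).
have step n p : P n p -> exists q, [/\ P n.+1 q,
    p.1 <= q.1, q.1 + A / 2 ^+ n.+1 <= p.1 + A / 2 ^+ n,
    p.2 <= q.2 & q.2 + B / 2 ^+ n.+1 <= p.2 + B / 2 ^+ n].
  case: p => x y; rewrite /P /= => H.
  pose A' := A / 2 ^+ n.+1; pose B' := B / 2 ^+ n.+1.
  have AE : A / 2 ^+ n = A' + A'.
    by rewrite /A' exprS; field; rewrite expf_neq0.
  have BE : B / 2 ^+ n = B' + B'.
    by rewrite /B' exprS; field; rewrite expf_neq0.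
  have A'0 : 0 <= A' by rewrite divr_ge0// exprn_ge0.
  have B'0 : 0 <= B' by rewrite divr_ge0// exprn_ge0.
  have KE : K / 4 ^+ n = 4 * (K / 4 ^+ n.+1).
    by rewrite [in RHS]exprS; field; rewrite expf_neq0.
  rewrite AE BE !addrA (rectint_hsplit f x (x + A')) (rectint_vsplit f _ _ _ (y + B'))
    (rectint_vsplit f (x + A') _ _ (y + B')) KE in H.
  apply: contrapT => N.
  have Q q : x <= q.1 -> q.1 + A' <= x + A / 2 ^+ n -> y <= q.2 ->
      q.2 + B' <= y + B / 2 ^+ n ->
      cmod (rectint f q.1 (q.1 + A') q.2 (q.2 + B')) < K / 4 ^+ n.+1.
    move=> *; rewrite ltNge; apply/negP => ?; apply: N; exists q; split => //.
  rewrite AE BE in Q.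
  have H1 : cmod (rectint f x (x + A') y (y + B')) < K / 4 ^+ n.+1.
    by apply: (Q (x, y)) => /=; lra.
  have H2 : cmod (rectint f (x + A') (x + A' + A') y (y + B')) < K / 4 ^+ n.+1.
    by apply: (Q (x + A', y)) => /=; lra.
  have H3 : cmod (rectint f x (x + A') (y + B') (y + B' + B')) < K / 4 ^+ n.+1.
    by apply: (Q (x, y + B')) => /=; lra.
  have H4 : cmod (rectint f (x + A') (x + A' + A') (y + B') (y + B' + B')) < K / 4 ^+ n.+1.
    by apply: (Q (x + A', y + B')) => /=; lra.
  move: H; rewrite leNgt => /negP; apply.
  apply: le_lt_trans (cmodD _ _) _; apply: le_lt_trans (lerD (cmodD _ _) (cmodD _ _)) _.
  lra.
(* Dependent choice on pairs: [(0, 0)] is a default for the pairs that violate [P], which the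
   sequence [u] never meets. *)
have [F FP] := choice (fun np : nat * (R * R) =>
  match pselect (P np.1 np.2) with
  | left H => let: ex_intro q Hq := step _ _ H in ex_intro (fun q => P np.1 np.2 -> [/\ P np.1.+1 q,
    np.2.1 <= q.1, q.1 + A / 2 ^+ np.1.+1 <= np.2.1 + A / 2 ^+ np.1,
    np.2.2 <= q.2 & q.2 + B / 2 ^+ np.1.+1 <= np.2.2 + B / 2 ^+ np.1]) q (fun _ => Hq)
  | right H => ex_intro _ (0, 0) (fun H' => False_ind _ (H H'))
  end).
pose u := fix u n := if n is k.+1 then F (k, u k) else (a, c).
have uP n : P n (u n).
  elim: n => [|n IH]; last by have [] := FP (n, u n) IH.
  by rewrite /P /= !expr0 !divr1 /A /B !(addrC _ (_ - _)) !subrK.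
pose l1 := fun n => (u n).1; pose r1 := fun n => (u n).1 + A / 2 ^+ n.
pose l2 := fun n => (u n).2; pose r2 := fun n => (u n).2 + B / 2 ^+ n.
have lr1 n : l1 n <= r1 n by rewrite /l1 /r1 lerDl divr_ge0// exprn_ge0.
have lr2 n : l2 n <= r2 n by rewrite /l2 /r2 lerDl divr_ge0// exprn_ge0.
have [x0 x0P] : exists x, forall n, l1 n <= x <= r1 n.
  by apply: nested_segments => // n; have [] := FP (n, u n) (uP n).
have [y0 y0P] : exists x, forall n, l2 n <= x <= r2 n.
  by apply: nested_segments => // n; have [] := FP (n, u n) (uP n).
have x0ab : a <= x0 <= b by have := x0P 0%N; rewrite /l1 /r1 /= expr0 divr1 /A addrC subrK.
have y0cd : c <= y0 <= d by have := y0P 0%N; rewrite /l2 /r2 /= expr0 divr1 /B addrC subrK.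
have AB0 : 0 <= A + B by rewrite addr_ge0.
(* With this [e] one has [e * (A + B) ^+ 2 < K], also when the rectangle degenerates to a point. *)
pose e := K / (2 * (A + B) ^+ 2 + 2).
have e0 : 0 < e by rewrite divr_gt0// ltr_wpDl// mulr_ge0// sqr_ge0.
have [r r0 rH] := rectint_local cf (df _ _ x0ab y0cd) e0.
have [n nr] : exists n, (A + B) / 2 ^+ n < r.
  exists (Num.bound ((A + B) / r)); rewrite ltr_pdivrMr ?exprn_gt0//.
  by rewrite mulrC -ltr_pdivrMr//; exact: upper_nthrootP.
have := rH _ _ _ _ (x0P n) (y0P n).
have -> : r1 n - l1 n + (r2 n - l2 n) = (A + B) / 2 ^+ n.
  by rewrite /r1 /l1 /r2 /l2; field; rewrite expf_neq0.
move=> /(_ nr) H; have := le_trans (uP n) H; apply/negP; rewrite -ltNge.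
rewrite expr_div_n -exprM mulnC exprM (_ : 2 ^+ 2 = 4 :> R); last by rewrite -natrX.
rewrite mulrA ltr_pM2r ?invr_gt0 ?exprn_gt0// /e mulrAC ltr_pdivrMr; last first.
  by rewrite ltr_wpDl// mulr_ge0// sqr_ge0.
rewrite ltr_pM2l//; have := sqr_ge0 (A + B); lra.
Qed.

Lemma ccont_bounded_near f z : ccont f -> exists M : R, exists2 r : R, 0 < r &
  forall w, cmod (w - z) < r -> cmod (f w) <= M.
Proof.
move=> cf; have [r r0 rH] := cf z 1 ltr01; exists (cmod (f z) + 1); exists r => // w /rH.
rewrite addrCA subrr addr0 => H; rewrite -(subrK (f z) (f w)) addrC.
by rewrite (le_trans (cmodD _ _))// lerD2l ltW.
Qed.

(** Around a small square of half-side [eta] about the exceptional point there remain four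
    rectangles, to which [goursat] applies; the square contributes at most [16 * M * eta], as [f] is
    bounded there. This serves the difference quotient in Cauchy's formula, of which only continuity
    is known at the point itself. *)
Lemma goursat_except f a b c d u v : a < u < b -> c < v < d -> ccont f ->
  (forall z, z != u +i* v -> cdiffble f z) -> rectint f a b c d = 0.
Proof.
move=> /andP[au ub] /andP[cv vd] cf df; apply/eqP; rewrite -cmod_eq0 eq_le cmod_ge0 andbT.
have [M [r r0 rM]] := ccont_bounded_near (u +i* v) cf.
have M0 : 0 <= M by apply: le_trans (rM (u +i* v) _); rewrite ?cmod_ge0// subrr cmod0.
have key eta : 0 < eta -> eta < r / 2 -> a < u - eta -> u + eta < b -> c < v - eta ->
    v + eta < d -> cmod (rectint f a b c d) <= 16 * M * eta.
  move=> e0 er h1 h2 h3 h4.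
  rewrite (rectint_hsplit f a (u - eta)) (rectint_hsplit f (u - eta) (u + eta)).
  rewrite (rectint_vsplit f (u - eta) (u + eta) c (v - eta)).
  rewrite (rectint_vsplit f (u - eta) (u + eta) (v - eta) (v + eta)).
  have G a' b' c' d' : a' <= b' -> c' <= d' ->
      (forall x y, a' <= x <= b' -> c' <= y <= d' -> (x != u) || (y != v)) ->
      rectint f a' b' c' d' = 0.
    move=> ab' cd' H; apply: goursat => // x y hx hy; apply: df.
    by rewrite eq_complex /= negb_and H.
  rewrite !(G a) ?(G (u + eta) b) ?(G _ _ c (v - eta)) ?(G _ _ (v + eta) d) ?add0r ?addr0; try lra.
  - apply: le_trans (rectint_bound (M := M) cf _ _ _) _; try lra.
    move=> x y hx hy; apply: rM; apply: le_lt_trans (cmod_le_ReIm _) _ => /=.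
    have : `|x - u| <= eta by rewrite ler_norml; lra.
    have : `|y - v| <= eta by rewrite ler_norml; lra.
    lra.
  - by move=> x y hx hy; apply/orP; right; apply/eqP => E; lra.
  - by move=> x y hx hy; apply/orP; right; apply/eqP => E; lra.
  - by move=> x y hx hy; apply/orP; left; apply/eqP => E; lra.
  - by move=> x y hx hy; apply/orP; left; apply/eqP => E; lra.
apply/ler_addgt0Pr => e e0; rewrite add0r; pose m := Num.min (r / 2) (Num.min (Num.min (u - a) (b - u)) (Num.min (v - c) (d - v))).
have m0 : 0 < m by rewrite !lt_min !subr_gt0 au ub cv vd divr_gt0.
pose eta := Num.min (m / 2) (e / (16 * M + 1)).
have M1 : 0 < 16 * M + 1 by lra.
have eta0 : 0 < eta by rewrite lt_min !divr_gt0.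
have : eta < m by rewrite gt_min; apply/orP; left; lra.
rewrite !lt_min => /and3P[h1 /andP[h2 h3] /andP[h4 h5]].
apply: le_trans (key eta eta0 h1 _ _ _ _) _; try lra.
have : eta <= e / (16 * M + 1) by rewrite ge_min lexx orbT.
by rewrite ler_pdivlMr// => H; nra.
Qed.

End goursat.

(** * Cauchy's formula and Taylor expansion on squares *)

Section cauchy.
Variable R : realType.
Implicit Types (f g : R[i] -> R[i]) (z w : R[i]) (S : R).
Local Notation re := complex.Re.
Local Notation im := complex.Im.

Lemma cderivD f g z d e : cderiv f z d -> cderiv g z e ->
  cderiv (fun x => f x + g x) z (d + e).
Proof. by move=> /is_derive_cderiv Hf /is_derive_cderiv Hg; apply/is_derive_cderiv; exact: is_deriveD. Qed.

Lemma cderiv_cst c z : cderiv (fun=> c) z 0.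
Proof. by apply/is_derive_cderiv; exact: is_derive_cst. Qed.

Lemma cderiv_id z : cderiv id z 1.
Proof. by apply/is_derive_cderiv; exact: is_derive_id. Qed.

Lemma cderivM f g z d e : cderiv f z d -> cderiv g z e ->
  cderiv (fun x => f x * g x) z (f z * e + g z * d).
Proof. by move=> /is_derive_cderiv Hf /is_derive_cderiv Hg; apply/is_derive_cderiv; exact: (is_deriveM Hf Hg). Qed.

Lemma cderivV f z d : f z != 0 -> cderiv f z d ->
  cderiv (fun x => (f x)^-1) z (- d / f z ^+ 2).
Proof.
move=> fz /is_derive_cderiv[df dv]; apply/is_derive_cderiv.
apply: DeriveDef; first exact: (derivableV fz df).
by rewrite (deriveV fz df) dv /GRing.scale /= !mulNr [_ * d]mulrC.
Qed.

Lemma cderiv_near f g z d : (exists2 r : R, 0 < r & forall h, cmod h < r -> f (z + h) = g (z + h)) ->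
  cderiv f z d -> cderiv g z d.
Proof.
move=> [r r0 rH] H e e0; have [s s0 sH] := H e e0; exists (Num.min r s); first by rewrite lt_min r0.
move=> h; rewrite lt_min => /andP[hr /sH]; rewrite rH//.
by have := rH 0; rewrite cmod0 addr0 => ->.
Qed.

Lemma cderiv_cont f z d : cderiv f z d -> forall e : R, 0 < e ->
  exists2 r : R, 0 < r & forall h, cmod h < r -> cmod (f (z + h) - f z) < e.
Proof.
move=> H e e0; have [r r0 rH] := H 1 ltr01.
have d1 : 0 < cmod d + 1 by rewrite ltr_wpDl ?cmod_ge0.
exists (Num.min r (e / (cmod d + 1))); first by rewrite lt_min r0 divr_gt0.
move=> h; rewrite lt_min => /andP[/rH hr]; rewrite ltr_pdivlMr// => he.
rewrite -(subrK (d * h) (f (z + h) - f z)); apply: le_lt_trans (cmodD _ _) _.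
by apply: le_lt_trans he; rewrite cmodM; lra.
Qed.

Lemma cdiffble_ccont f : (forall z, cdiffble f z) -> ccont f.
Proof. by move=> H z e e0; have [d] := H z; move/cderiv_cont; exact. Qed.

Lemma cderiv_invX z n : z != 0 ->
  cderiv (fun x => x ^- n) z (- n%:R * z ^- n.+1).
Proof.
move=> z0; elim: n => [|n IH].
  rewrite oppr0 mul0r; under eq_fun do rewrite expr0 invr1; exact: cderiv_cst.
have := cderivM (cderivV z0 (cderiv_id z)) IH.
rewrite (_ : (fun x => _ * _) = (fun x => x ^- n.+1)); last first.
  by apply/funext => x; rewrite exprS invfM.
rewrite (_ : _ + _ = - (n.+1)%:R * z ^- n.+2)//.
by rewrite -natr1 !exprS; field; rewrite expf_neq0.
Qed.

Lemma lcontV (f : R -> R[i]) : (forall t, f t != 0) -> lcont f -> lcont (fun t => (f t)^-1).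
Proof.
move=> f0 [f1 f2].
have n0 t : re (f t) ^+ 2 + im (f t) ^+ 2 != 0.
  by rewrite -sqr_cmod expf_neq0// cmod_eq0.
have nc : continuous (fun t => (re (f t) ^+ 2 + im (f t) ^+ 2)^-1).
  move=> t; apply: cvgV; first exact: n0.
  by apply: cvgD; apply: cvgM; [exact: f1|exact: f1|exact: f2|exact: f2].
have E1 z : re z^-1 = re z / (re z ^+ 2 + im z ^+ 2) by case: z.
have E2 z : im z^-1 = - im z / (re z ^+ 2 + im z ^+ 2) by case: z => a b; rewrite mulNr.
split=> t.
  by under eq_fun do rewrite E1; apply: cvgM; [exact: f1|exact: nc].
by under eq_fun do rewrite E2; apply: cvgM; [apply: cvgN; exact: f2|exact: nc].
Qed.

Lemma lcontX (f : R -> R[i]) n : lcont f -> lcont (fun t => f t ^+ n).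
Proof.
move=> cf; elim: n => [|n IH]; first by under eq_fun do rewrite expr0; exact: lcont_cst.
by under eq_fun do rewrite exprS; exact: lcontM.
Qed.

Definition sqcont S f := [/\ lcont (fun t => f (t +i* (- S))), lcont (fun t => f (S +i* t)),
  lcont (fun t => f (t +i* S)) & lcont (fun t => f ((- S) +i* t))].

Definition sqint S f := rectint f (- S) S (- S) S.

(** The full lines that carry the sides. Since [integ] rests on an antiderivative on the whole real
    line, integrands have to be continuous on these lines and not only on the sides, which are
    singled out by [on_sq] for the size estimates. *)
Definition on_lines S z := (`|re z| == S) || (`|im z| == S).

Lemma on_edges S t : 0 < S -> [/\ on_lines S (t +i* (-S)), on_lines S (S +i* t),
  on_lines S (t +i* S) & on_lines S ((-S) +i* t)].
Proof. by move=> S0; rewrite /on_lines /= normrN (gtr0_norm S0) !eqxx !orbT. Qed.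

Lemma sqint_ext S f g : 0 < S -> (forall z, on_lines S z -> f z = g z) ->
  sqint S f = sqint S g.
Proof.
move=> S0 H; rewrite /sqint /rectint.
by congr (_ + _ - _ - _); [|congr (_ * _)| |congr (_ * _)];
   congr cinteg; apply/funext => t; apply: H; have [] := on_edges t S0.
Qed.

Lemma sqcontD S f g : sqcont S f -> sqcont S g -> sqcont S (fun z => f z + g z).
Proof. by move=> [? ? ? ?] [? ? ? ?]; split; exact: lcontD. Qed.

Lemma sqcontM S f g : sqcont S f -> sqcont S g -> sqcont S (fun z => f z * g z).
Proof. by move=> [? ? ? ?] [? ? ? ?]; split; exact: lcontM. Qed.

Lemma sqcont_cst S c : sqcont S (fun=> c).
Proof. by split; exact: lcont_cst. Qed.

Lemma sqcontX S f n : sqcont S f -> sqcont S (fun z => f z ^+ n).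
Proof. by move=> [? ? ? ?]; split; exact: lcontX. Qed.

Lemma sqcont_ccont S f : ccont f -> sqcont S f.
Proof. by move=> cf; split; [exact: ccont_hline|exact: ccont_vline|exact: ccont_hline|exact: ccont_vline]. Qed.

Lemma sqcontV S f : 0 < S -> (forall z, on_lines S z -> f z != 0) -> sqcont S f ->
  sqcont S (fun z => (f z)^-1).
Proof.
move=> S0 f0 [? ? ? ?]; split; apply: lcontV => // t; apply: f0;
  by have [] := on_edges t S0.
Qed.

Lemma sqcont_sum S n (F : nat -> R[i] -> R[i]) : (forall k, sqcont S (F k)) ->
  sqcont S (fun z => \sum_(k < n) F k z).
Proof.
move=> H; elim: n => [|n IH].
  by under eq_fun do rewrite big_ord0; exact: sqcont_cst.
by under eq_fun do rewrite big_ord_recr; exact: sqcontD.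
Qed.

Lemma sqintD S f g : sqcont S f -> sqcont S g ->
  sqint S (fun z => f z + g z) = sqint S f + sqint S g.
Proof.
by move=> [? ? ? ?] [? ? ? ?]; rewrite /sqint /rectint !cintegD//; ring.
Qed.

Lemma sqintZ S c f : sqcont S f -> sqint S (fun z => c * f z) = c * sqint S f.
Proof. by move=> [? ? ? ?]; rewrite /sqint /rectint !cintegZ//; ring. Qed.

Lemma sqint0 S : sqint S (fun=> 0) = 0.
Proof.
rewrite -[RHS](mul0r (sqint S (fun=> 0))) -sqintZ; last exact: sqcont_cst.
by congr sqint; apply/funext => z; rewrite mul0r.
Qed.

Lemma sqint_sum S n (F : nat -> R[i] -> R[i]) : (forall k, sqcont S (F k)) ->
  sqint S (fun z => \sum_(k < n) F k z) = \sum_(k < n) sqint S (F k).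
Proof.
move=> H; elim: n => [|n IH].
  by rewrite big_ord0; under eq_fun do rewrite big_ord0; exact: sqint0.
under eq_fun do rewrite big_ord_recr; rewrite sqintD//; last exact: sqcont_sum.
by rewrite IH big_ord_recr.
Qed.

Definition on_sq S z := [&& on_lines S z, `|re z| <= S & `|im z| <= S].

Lemma sqint_bound S f M : 0 < S -> sqcont S f ->
  (forall z, on_sq S z -> cmod (f z) <= M) ->
  cmod (sqint S f) <= 16 * M * S.
Proof.
move=> S0 [c1 c2 c3 c4] H; have SS : - S <= S by lra.
have SE : `|S| = S by rewrite gtr0_norm.
have on1 t : - S <= t <= S -> on_sq S (t +i* (-S)).
  by move=> tS; have [? ? ? ?] := on_edges t S0; apply/and3P; rewrite /= normrN SE ler_norml.
have on2 t : - S <= t <= S -> on_sq S (S +i* t).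
  by move=> tS; have [? ? ? ?] := on_edges t S0; apply/and3P; rewrite /= SE ler_norml.
have on3 t : - S <= t <= S -> on_sq S (t +i* S).
  by move=> tS; have [? ? ? ?] := on_edges t S0; apply/and3P; rewrite /= SE ler_norml.
have on4 t : - S <= t <= S -> on_sq S ((-S) +i* t).
  by move=> tS; have [? ? ? ?] := on_edges t S0; apply/and3P; rewrite /= normrN SE ler_norml.
have B1 := cinteg_bound SS c1 (fun t tS => H _ (on1 t tS)).
have B2 := cinteg_bound SS c2 (fun t tS => H _ (on2 t tS)).
have B3 := cinteg_bound SS c3 (fun t tS => H _ (on3 t tS)).
have B4 := cinteg_bound SS c4 (fun t tS => H _ (on4 t tS)).
rewrite /sqint /rectint.
apply: le_trans (cmodB _ _) _; rewrite cmodM cmodi mul1r; apply: le_trans (lerD (cmodB _ _) B4) _.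
apply: le_trans (lerD (lerD (cmodD _ _) (lexx _)) (lexx _)) _.
by rewrite cmodM cmodi mul1r; apply: le_trans (lerD (lerD (lerD B1 B2) B3) (lexx _)) _; lra.
Qed.

Lemma on_lines_ge S z : on_lines S z -> S <= cmod z.
Proof. by move=> /orP[]/eqP <-; rewrite ?cmod_Re ?cmod_Im. Qed.

(** The integrand has the primitive [G] away from 0, so the four sides telescope at the corners. *)
Lemma sqint_invX S n : 0 < S -> sqint S (fun z => z ^- n.+2) = 0.
Proof.
move=> S0.
have on_neq z : on_lines S z -> z != 0.
  by move=> /on_lines_ge Sz; rewrite -cmod_gt0 (lt_le_trans S0).
pose G z : R[i] := - n.+1%:R^-1 * z ^- n.+1.
have dG z : on_lines S z -> cderiv G z (z ^- n.+2).
  move=> /on_neq z0; have := cderivM (cderiv_cst (- n.+1%:R^-1) z) (cderiv_invX n.+1 z0).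
  by rewrite mulr0 addr0 mulrA mulrNN mulVf ?pnatr_eq0// mul1r.
have on1 t : on_lines S (t +i* (-S)) by have [] := on_edges t S0.
have on2 t : on_lines S (S +i* t) by have [] := on_edges t S0.
have on3 t : on_lines S (t +i* S) by have [] := on_edges t S0.
have on4 t : on_lines S ((-S) +i* t) by have [] := on_edges t S0.
have c : sqcont S (fun z => z ^- n.+2).
  apply: sqcontV => //; first by move=> z /on_neq z0; rewrite expf_neq0.
  by apply: sqcontX; apply: sqcont_ccont; apply: cdiffble_ccont => z; exists 1; exact: cderiv_id.
case: c => c1 c2 c3 c4; rewrite /sqint /rectint -!cintegZ//.
have [h1 h1'] := is_derive_hline (fun t => dG _ (on1 t)).
have [h2 h2'] := is_derive_vline (fun t => dG _ (on2 t)).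
have [h3 h3'] := is_derive_hline (fun t => dG _ (on3 t)).
have [h4 h4'] := is_derive_vline (fun t => dG _ (on4 t)).
rewrite (cintegE _ _ h1 h1') (cintegE _ _ h2 h2') (cintegE _ _ h3 h3') (cintegE _ _ h4 h4').
move: (G (S +i* - S)) (G ((- S) +i* - S)) (G (S +i* S)) (G ((- S) +i* S)) => *; ring.
Qed.

(** The value 2 pi i is never computed: Cauchy's formula is normalized by dividing by this integral.
    Each side contributes at least 1 to its imaginary part. *)
Lemma sqint_inv_neq0 S : 0 < S -> sqint S (fun z => z^-1) != 0.
Proof.
move=> S0.
have c : sqcont S (fun z => z^-1).
  apply: sqcontV => //; first by move=> z /on_lines_ge Sz; rewrite -cmod_gt0 (lt_le_trans S0).
  by apply: sqcont_ccont; apply: cdiffble_ccont => z; exists 1; exact: cderiv_id.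
case: c => [[_ c1] [c2 _] [_ c3] [c4 _]].
suff : 4 <= im (sqint S (fun z => z^-1)).
  by move=> H; apply/negP => /eqP E; move: H; rewrite E /=; lra.
have i0 : re ('i : R[i]) = 0 by []. have i1 : im ('i : R[i]) = 1 by [].
rewrite /sqint /rectint !ReImE i0 i1 !mul0r !add0r !mul1r.
have SS : - S <= S by lra.
have key x : - S <= x <= S -> (2 * S)^-1 <= S / (x ^+ 2 + S ^+ 2).
  move=> xS; have h : 0 < x ^+ 2 + S ^+ 2 by rewrite ltr_wpDl ?sqr_ge0// exprn_gt0.
  rewrite ler_pdivlMr// mulrC ler_pdivrMr ?mulr_gt0//; nra.
have E1 : (2 * S)^-1 * (S - - S) = 1 by field; lra.
have E2 : - (2 * S)^-1 * (S - - S) = - 1 by field; lra.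
have B1 : 1 <= integ (fun t => im (t +i* (- S))^-1) (- S) S.
  by rewrite -E1; apply: integ_ge SS c1 _ => x /key; rewrite /= sqrrN mulNr opprK.
have B2 : 1 <= integ (fun t => re (S +i* t)^-1) (- S) S.
  by rewrite -E1; apply: integ_ge SS c2 _ => x /key; rewrite /= addrC.
have B3 : integ (fun t => im (t +i* S)^-1) (- S) S <= - 1.
  by rewrite -E2; apply: integ_le SS c3 _ => x /key; rewrite /= lerN2.
have B4 : integ (fun t => re ((- S) +i* t)^-1) (- S) S <= - 1.
  by rewrite -E2; apply: integ_le SS c4 _ => x /key; rewrite /= mulNr lerN2 sqrrN addrC.
rewrite /cinteg /=; move: B1 B2 B3 B4; rewrite /=; lra.
Qed.

Lemma lcont_bounded (f : R -> R[i]) (a b : R) : a <= b -> lcont f ->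
  exists M : R, forall t, a <= t <= b -> cmod (f t) <= M.
Proof.
move=> ab [f1 f2].
have [|c _ cP] := @EVT_max R (fun t => `|re (f t)| + `|im (f t)|) a b ab.
  apply: continuous_subspaceT => t; apply: cvgD; apply: cvg_norm; [exact: f1|exact: f2].
exists (`|re (f c)| + `|im (f c)|) => t tab; apply: le_trans (cmod_le_ReIm _) _.
by apply: cP; rewrite in_itv.
Qed.

Lemma sqcont_bounded S f : 0 < S -> sqcont S f ->
  exists M : R, forall z, on_sq S z -> cmod (f z) <= M.
Proof.
move=> S0 [c1 c2 c3 c4]; have SS : - S <= S by lra.
have [M1 H1] := lcont_bounded SS c1; have [M2 H2] := lcont_bounded SS c2.
have [M3 H3] := lcont_bounded SS c3; have [M4 H4] := lcont_bounded SS c4.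
exists (Num.max (Num.max M1 M2) (Num.max M3 M4)) => -[x y] /and3P[/=].
rewrite !ler_norml => + xS yS; rewrite !le_max /on_lines /= !eqr_norml => /orP[/andP[]/orP[]/eqP E _|/andP[]/orP[]/eqP E _].
- by rewrite {1 2 3 4}E (H2 _ yS) ?orbT.
- by rewrite {1 2 3 4}E (H4 _ yS) ?orbT.
- by rewrite {1 2 3 4}E (H3 _ xS) ?orbT.
- by rewrite {1 2 3 4}E (H1 _ xS).
Qed.

(** The difference quotient [q], completed by the derivative [D] at [w], is continuous everywhere
    and differentiable off [w], so its integral vanishes by [goursat_except]. *)
Lemma cauchy_quotient f w S : (forall z, cdiffble f z) -> `|re w| < S -> `|im w| < S ->
  sqint S (fun z => f z * (z - w)^-1) = f w * sqint S (fun z => (z - w)^-1).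
Proof.
move=> df rw iw; have S0 : 0 < S by apply: le_lt_trans rw.
have [D wD] := df w; pose q z := if z == w then D else (f z - f w) * (z - w)^-1.
have dq z : z != w -> cdiffble q z.
  move=> zw; have [d fd] := df z; have zw0 : z - w != 0 by rewrite subr_eq0.
  have H1 : cderiv (fun x => f x + - f w) z (d + 0) by apply: cderivD => //; exact: cderiv_cst.
  have H2 : cderiv (fun x => x + - w) z (1 + 0) by apply: cderivD; [exact: cderiv_id|exact: cderiv_cst].
  have H3 := cderivM H1 (cderivV (f := fun x => x - w) zw0 H2).
  eexists; apply: cderiv_near H3; exists (cmod (z - w)); first by rewrite cmod_gt0.
  move=> h hr; rewrite /q ifF//; apply/negP => /eqP E; move: hr.
  by rewrite -E opprD addNKr cmodN ltxx.
have cq : ccont q.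
  move=> z; have [->|/dq [d /cderiv_cont//]] := eqVneq z w.
  move=> e e0; have [r r0 rH] := wD (e / 2) (divr_gt0 e0 (ltr0n _ 2)).
  exists r => // h /rH; rewrite /q eqxx; case: eqP => [_|/eqP hw].
    by rewrite subrr cmod0.
  have h0 : h != 0 by apply: contraNneq hw => ->; rewrite addr0.
  rewrite -ler_pdivrMr ?cmod_gt0// -cmodV -cmodM => H; apply: le_lt_trans (_ : e / 2 < e); last lra.
  rewrite (_ : _ - D = (f (w + h) - f w - D * h) * h^-1)//.
  by rewrite [w + h - w]addrC addKr [in RHS]mulrBl mulfK.
have q0 : sqint S q = 0.
  apply: (goursat_except (u := re w) (v := im w)) => //; rewrite -?ltr_norml//.
  by move=> z; case: (w) dq => u v; exact.
have on_neq z : on_lines S z -> z - w != 0.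
  by move=> /orP[]/eqP E; rewrite subr_eq0; apply: contraTneq isT => zw; move: rw iw; rewrite -zw E ltxx.
have cw : sqcont S (fun z => (z - w)^-1).
  apply: sqcontV => //; apply: sqcont_ccont; apply: cdiffble_ccont => z; exists (1 + 0).
  by apply: cderivD; [exact: cderiv_id|exact: cderiv_cst].
have cf : sqcont S f by apply: sqcont_ccont; exact: cdiffble_ccont.
move: q0; rewrite (@sqint_ext S q (fun z => f z * (z - w)^-1 + (- f w) * (z - w)^-1))//; last first.
  move=> z /on_neq; rewrite subr_eq0 /q => /negbTE ->.
  by rewrite mulrBl mulNr.
rewrite sqintD; [|exact: sqcontM|by apply: sqcontM => //; exact: sqcont_cst].
by rewrite sqintZ// mulNr => /eqP; rewrite subr_eq0 => /eqP.
Qed.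

Lemma inv_geom z w N : z != 0 -> z - w != 0 ->
  (z - w)^-1 = \sum_(k < N) w ^+ k * z ^- k.+1 + w ^+ N * (z ^- N * (z - w)^-1).
Proof.
move=> z0 zw; elim: N => [|N IH]; first by rewrite big_ord0 !expr0 invr1 !mul1r add0r.
rewrite big_ord_recr /= {1}IH -addrA; congr (_ + _).
by rewrite !exprS; field; rewrite zw z0 expf_neq0.
Qed.

(** The finite geometric series [inv_geom] is integrated term by term. The remainder carries the
    factor [(w / z) ^+ N] with [cmod z >= S] on the sides, and [cmod (z - w) >= S - r] makes [M]
    independent of [N] and [w]. *)
Lemma cauchy_expand S f r : 0 < r -> r < S -> sqcont S f -> exists M : R, forall N w, cmod w <= r ->
  cmod (sqint S (fun z => f z * (z - w)^-1) -
        \sum_(k < N) sqint S (fun z => f z * z ^- k.+1) * w ^+ k) <= M * (cmod w / S) ^+ N.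
Proof.
move=> r0 rS cf; have S0 : 0 < S by exact: lt_trans rS.
have [M HM] := sqcont_bounded S0 cf.
have z0 z : on_lines S z -> z != 0 by move=> /on_lines_ge zS; rewrite -cmod_gt0 (lt_le_trans S0).
exists (16 * (M / (S - r)) * S) => N w wr.
have cid : sqcont S id by apply: sqcont_ccont; apply: cdiffble_ccont => z; exists 1; exact: cderiv_id.
have dist z : on_lines S z -> S - r <= cmod (z - w).
  by move=> /on_lines_ge zS; have := cmodD (z - w) w; rewrite subrK; lra.
have on_neq z : on_lines S z -> z - w != 0.
  by move=> /dist H; rewrite -cmod_gt0; lra.
have cw : sqcont S (fun z => (z - w)^-1).
  apply: sqcontV => //; apply: sqcontD => //; exact: sqcont_cst.
have cX k : sqcont S (fun z => z ^- k).
  by apply: sqcontV; [|move=> z /z0 ?; rewrite expf_neq0|exact: sqcontX].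
pose g z := f z * (z ^- N * (z - w)^-1).
have cg : sqcont S g by apply: sqcontM => //; exact: sqcontM.
have ck k : sqcont S (fun z => w ^+ k * (f z * z ^- k.+1)).
  by apply: sqcontM; [exact: sqcont_cst|exact: sqcontM].
rewrite (@sqint_ext S _ (fun z => \sum_(k < N) w ^+ k * (f z * z ^- k.+1) + w ^+ N * g z))//; last first.
  move=> z oz; rewrite {1}(inv_geom N (z0 _ oz) (on_neq _ oz)) mulrDr /g mulrCA; congr (_ + _).
  by rewrite mulr_sumr; apply: eq_bigr => k _; rewrite mulrCA.
rewrite sqintD; [|exact: (sqcont_sum _ ck)|by apply: sqcontM => //; exact: sqcont_cst].
rewrite (sqint_sum _ ck)// sqintZ//.
rewrite (_ : _ - _ = w ^+ N * sqint S g); last first.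
  rewrite addrAC -sumrB big1 ?add0r// => k _.
  by rewrite sqintZ ?[_ * w ^+ k]mulrC ?subrr//; exact: sqcontM.
rewrite cmodM cmodX exprMn mulrCA ler_wpM2l ?exprn_ge0 ?cmod_ge0//.
apply: le_trans (sqint_bound S0 cg (M := M / (S - r) * S^-1 ^+ N) _) _; last first.
  by apply: le_of_eq; ring.
move=> z zs; have /and3P[zl _ _] := zs; have Sr : 0 < S - r by lra.
rewrite /g !cmodM !cmodV cmodX mulrAC -!mulrA; apply: ler_pM => //; rewrite ?cmod_ge0 ?mulr_ge0 ?invr_ge0 ?exprn_ge0 ?cmod_ge0//.
  exact: HM.
rewrite exprVn; apply: ler_pM; rewrite ?invr_ge0 ?exprn_ge0 ?cmod_ge0//.
  by rewrite lef_pV2 ?posrE ?exprn_gt0// ?lerXn2r ?nnegrE ?cmod_ge0 ?(ltW S0)//; [exact: on_lines_ge|rewrite cmod_gt0 z0].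
by rewrite lef_pV2 ?posrE// ?dist// (lt_le_trans Sr)// dist.
Qed.

(* f is entire with Taylor coefficients a, stated through the size of the
   N-th remainder, with geometric decay, on every disc. *)
Definition powser f (a : nat -> R[i]) := forall r, 0 < r -> exists M : R, forall N w, cmod w <= r ->
  cmod (f w - \sum_(k < N) a k * w ^+ k) <= M * (cmod w / (2 * r)) ^+ N.

(** If the coefficients below [n] agree, the two remainders of order [n.+1] at a small real point
    [t] give a difference of order [t] for the n-th ones. *)
Lemma coef_unique f (a b : nat -> R[i]) (r A B x y : R) : 0 < r -> 
  (forall N w, cmod w <= r -> cmod (f w - \sum_(k < N) a k * w ^+ k) <= A * (cmod w / x) ^+ N) ->
  (forall N w, cmod w <= r -> cmod (f w - \sum_(k < N) b k * w ^+ k) <= B * (cmod w / y) ^+ N) ->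
  a =1 b.
Proof.
move=> r0 HA HB n; elim/ltn_ind: n => n IH; apply/eqP; rewrite -subr_eq0 -cmod_eq0 eq_le cmod_ge0 andbT.
pose C := `|A| * `|x|^-1 ^+ n.+1 + `|B| * `|y|^-1 ^+ n.+1.
have C0 : 0 <= C by rewrite addr_ge0// mulr_ge0// exprn_ge0// invr_ge0.
apply/ler_addgt0Pr => e e0; rewrite add0r.
pose t := Num.min r (e / (C + 1)).
have t0 : 0 < t by rewrite lt_min r0 divr_gt0// ltr_wpDl.
have tE : cmod t%:C = t by rewrite cmodR gtr0_norm.
have tr : cmod t%:C <= r by rewrite tE ge_min lexx.
have {HA}HA := HA n.+1 t%:C tr; have {HB}HB := HB n.+1 t%:C tr.
have key : cmod (a n - b n) * t ^+ n <= C * t ^+ n.+1.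
  rewrite -{1}tE -cmodX -cmodM.
  rewrite (_ : _ * _ = (f t%:C - \sum_(k < n.+1) b k * t%:C ^+ k) - (f t%:C - \sum_(k < n.+1) a k * t%:C ^+ k)); last first.
    rewrite !big_ord_recr /= [in RHS](eq_bigr (fun k : 'I_n => a k * t%:C ^+ k)); last by move=> k _; rewrite IH.
    ring.
  apply: le_trans (cmodB _ _) _; rewrite /C mulrDl addrC lerD//.
    apply: le_trans HA _; rewrite tE -mulrA -exprMn [_ * t]mulrC.
    by rewrite (le_trans (ler_norm _))// normrM normrX normrM normfV (gtr0_norm t0).
  apply: le_trans HB _; rewrite tE -mulrA -exprMn [_ * t]mulrC.
  by rewrite (le_trans (ler_norm _))// normrM normrX normrM normfV (gtr0_norm t0).
move: key; rewrite exprS mulrA ler_pM2r ?exprn_gt0// => /le_trans; apply.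
have : t <= e / (C + 1) by rewrite ge_min lexx orbT.
by rewrite ler_pdivlMr ?ltr_wpDl// => H; nra.
Qed.

(** Cauchy's formula on the square of half-side [2 * r] yields coefficients that may depend on [r];
    [coef_unique] shows that they do not. *)
Lemma entire_powser f : (forall z, cdiffble f z) -> exists a, powser f a.
Proof.
move=> df.
have ex r : 0 < r -> exists a : nat -> R[i], exists M : R, forall N w, cmod w <= r ->
    cmod (f w - \sum_(k < N) a k * w ^+ k) <= M * (cmod w / (2 * r)) ^+ N.
  move=> r0; have rS : r < 2 * r by lra.
  have S0 : 0 < 2 * r by lra.
  have cf : sqcont (2 * r) f by apply: sqcont_ccont; exact: cdiffble_ccont.
  pose c := sqint (2 * r) (fun z => z^-1); have c0 : c != 0 by exact: sqint_inv_neq0.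
  (* Independence of the pole: in the expansion for the constant function 1 all terms but the first
     vanish by [sqint_invX], and the remainder tends to 0. *)
  have cE w : cmod w <= r -> sqint (2 * r) (fun z => (z - w)^-1) = c.
    move=> wr; apply/eqP; rewrite -subr_eq0 -cmod_eq0 eq_le cmod_ge0 andbT.
    have [M HM] := cauchy_expand r0 rS (sqcont_cst (2 * r) 1).
    have M0 : 0 <= M.
      by have := HM 0%N w wr; rewrite expr0 mulr1; apply: le_trans; exact: cmod_ge0.
    have h N : cmod (sqint (2 * r) (fun z => (z - w)^-1) - c) <= M * 2^-1 ^+ N.+1.
      have := HM N.+1 w wr; under eq_fun do rewrite mul1r.
      rewrite big_ord_recl /= expr0 mulr1 big1 ?addr0; last first.
        move=> k _; under eq_fun do rewrite mul1r; rewrite /bump /= add1n.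
        by rewrite sqint_invX ?mul0r.
      have -> : sqint (2 * r) (fun z => 1 / z ^+ 1) = c.
        by congr sqint; apply/funext => z; rewrite expr1 mul1r.
      move=> /le_trans; apply; rewrite ler_wpM2l// lerXn2r ?nnegrE ?invr_ge0// ?divr_ge0 ?cmod_ge0//.
        lra.
      by rewrite ler_pdivrMr// mulrA mulVf ?mul1r.
    apply/ler_addgt0Pr => e e0; rewrite add0r.
    apply: le_trans (h (Num.bound (M / e))) _.
    rewrite exprVn ler_pdivrMr ?exprn_gt0// mulrC -ler_pdivrMr//.
    by apply: ltW; apply: upper_nthrootP.
  have [M HM] := cauchy_expand r0 rS cf.
  exists (fun k => sqint (2 * r) (fun z => f z * z ^- k.+1) / c), (M / cmod c) => N w wr.
  have := HM N w wr; rewrite cauchy_quotient//; try exact: le_lt_trans (cmod_Re _) (le_lt_trans wr rS);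
    try exact: le_lt_trans (cmod_Im _) (le_lt_trans wr rS).
  rewrite cE// => H; rewrite mulrAC ler_pdivlMr ?cmod_gt0// -cmodM mulrBl mulr_suml.
  apply: le_trans H; apply: le_of_eq; congr (cmod (_ - _)).
  by apply: eq_bigr => k _; field.
(* The coefficients found for radius 1 serve for every radius. *)
have [a [A HA]] := ex 1 ltr01.
exists a => r r0; have [b [B HB]] := ex r r0; exists B => N w wr.
have m0 : 0 < Num.min 1 r by rewrite lt_min ltr01.
rewrite (eq_bigr (fun k : 'I_N => b k * w ^+ k)); first exact: HB.
move=> k _; congr (_ * _); move: (k : nat) => {}k.
apply: (coef_unique m0 _ _ k) => [n z|n z]; rewrite le_min => /andP[h1 h2].
  exact: HA.
exact: HB.
Qed.

End cauchy.

(** * Entire power series *)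

Section power_series.
Variable R : realType.
Implicit Types (f g : R[i] -> R[i]) (a b : nat -> R[i]) (z w : R[i]).
Local Notation re := complex.Re.
Local Notation im := complex.Im.

Lemma entireP f : entire f <-> forall z, cdiffble f z.
Proof.
split=> [H z|H z _].
  by have /derivableP/is_derive_cderiv := H z I; exists ('D_1 (f : R[i]^o -> R[i]^o) z).
by have [d /is_derive_cderiv[]] := H z.
Qed.

Definition decay a := forall r : R, 0 < r -> exists2 M : R, 0 <= M & forall n, cmod (a n) * r ^+ n <= M.

(** The intervals of radius [2 * M / 2 ^+ N] around the partial sums are nested. Their common point
    is the sum, and the rate of convergence comes with it. *)
Lemma real_series_half (b : nat -> R) (M : R) : (forall n, `|b n| <= M / 2 ^+ n) ->
  exists s, forall N, `|s - \sum_(k < N) b k| <= 2 * M / 2 ^+ N.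
Proof.
move=> bM.
have E N : 2 * M / 2 ^+ N.+1 = M / 2 ^+ N by rewrite exprS invfM; field; rewrite expf_neq0.
pose l N := \sum_(k < N) b k - 2 * M / 2 ^+ N; pose r N := \sum_(k < N) b k + 2 * M / 2 ^+ N.
have [s sP] : exists s, forall N, l N <= s <= r N.
  apply: nested_segments => N; rewrite /l /r ?big_ord_recr /= ?E.
  - by have := bM N; rewrite ler_norml -!mulrA; lra.
  - by have := bM N; rewrite ler_norml -!mulrA; lra.
  - have M0 : 0 <= M by have := bM 0%N; rewrite expr0 divr1; apply: le_trans.
    have : 0 <= 2 * M / 2 ^+ N by rewrite divr_ge0 ?mulr_ge0 ?exprn_ge0.
    lra.
by exists s => N; have := sP N; rewrite /l /r ler_norml; lra.
Qed.

Lemma complex_series_half (b : nat -> R[i]) (M : R) : (forall n, cmod (b n) <= M / 2 ^+ n) ->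
  exists s, forall N, cmod (s - \sum_(k < N) b k) <= 4 * M / 2 ^+ N.
Proof.
move=> bM.
have Res N : re (\sum_(k < N) b k) = \sum_(k < N) re (b k).
  by elim: N => [|N IH]; rewrite ?big_ord0// !big_ord_recr /= ReD IH.
have Ims N : im (\sum_(k < N) b k) = \sum_(k < N) im (b k).
  by elim: N => [|N IH]; rewrite ?big_ord0// !big_ord_recr /= ImD IH.
have [|s sP] := @real_series_half (fun k => re (b k)) M.
  by move=> n; exact: le_trans (cmod_Re _) (bM n).
have [|t tP] := @real_series_half (fun k => im (b k)) M.
  by move=> n; exact: le_trans (cmod_Im _) (bM n).
exists (s +i* t) => N; apply: le_trans (cmod_le_ReIm _) _; rewrite !ReImE /= Res Ims.
have := sP N; have := tP N; rewrite -!mulrA; lra.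
Qed.

Lemma half_to0 (M e : R) : 0 < e -> exists N, M / 2 ^+ N < e.
Proof.
move=> e0; exists (Num.bound (M / e)); rewrite ltr_pdivrMr ?exprn_gt0//.
by rewrite mulrC -ltr_pdivrMr//; exact: upper_nthrootP.
Qed.

Lemma powser_half f a : powser f a -> forall r : R, 0 < r -> exists2 M : R, 0 <= M &
  forall N w, cmod w <= r -> cmod (f w - \sum_(k < N) a k * w ^+ k) <= M / 2 ^+ N.
Proof.
move=> fa r r0; have [M HM] := fa r r0.
have M0 : 0 <= M.
  by have := HM 0%N 0; rewrite cmod0 expr0 mulr1 => /(_ (ltW r0)); apply: le_trans; exact: cmod_ge0.
exists M => // N w wr; apply: le_trans (HM N w wr) _; rewrite ler_wpM2l// -exprVn lerXn2r//.
- by rewrite nnegrE divr_ge0 ?cmod_ge0//; lra.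
- by rewrite nnegrE invr_ge0.
- by rewrite ler_pdivrMr; lra.
Qed.

Lemma powser_decay f a : powser f a -> decay a.
Proof.
move=> fa r r0; have [M HM] := fa r r0.
have rE : cmod (r%:C) = r by rewrite cmodR gtr0_norm.
have M0 : 0 <= M.
  by have := HM 0%N 0; rewrite cmod0 expr0 mulr1 => /(_ (ltW r0)); apply: le_trans; exact: cmod_ge0.
exists (2 * M); first by rewrite mulr_ge0.
move=> n; rewrite -{1}rE -cmodX -cmodM.
have h m : cmod (f r%:C - \sum_(k < m) a k * r%:C ^+ k) <= M.
  apply: le_trans (HM m _ _) _; rewrite rE//.
  rewrite -[leRHS]mulr1 ler_wpM2l// exprn_ile1 ?divr_ge0 ?ler_pdivrMr//; lra.
rewrite (_ : _ * _ = (f r%:C - \sum_(k < n) a k * r%:C ^+ k) - (f r%:C - \sum_(k < n.+1) a k * r%:C ^+ k)); last first.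
  by rewrite big_ord_recr /=; ring.
by apply: le_trans (cmodB _ _) _; apply: le_trans (lerD (h _) (h _)) _; lra.
Qed.

(** The sum is first found pointwise, with a rate that depends on the point. The uniform rate on a
    disc comes from decay at radius [4 * r]: the terms after the N-th are at most [M * q ^+ N] times
    powers of 1/2. *)
Lemma decay_powser a : decay a -> exists f, powser f a.
Proof.
move=> da.
have ex w : exists s : R[i], exists C : R, forall N, cmod (s - \sum_(k < N) a k * w ^+ k) <= C / 2 ^+ N.
  have r0 : 0 < 2 * (cmod w + 1) by have := cmod_ge0 w; lra.
  have [M M0 HM] := da _ r0.
  have [|s sP] := @complex_series_half (fun k => a k * w ^+ k) M; last by exists s, (4 * M).
  move=> n; rewrite ler_pdivlMr ?exprn_gt0// cmodM cmodX -mulrA -exprMn.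
  apply: le_trans (HM n); rewrite ler_wpM2l ?cmod_ge0// lerXn2r ?nnegrE ?mulr_ge0 ?cmod_ge0//; have := cmod_ge0 w; lra.
have [f fP] := choice ex; exists f => r r0.
have [M M0 HM] := da (4 * r) (mulr_gt0 (ltr0n _ 4) r0).
exists (2 * M) => N w wr; set q := cmod w / (2 * r).
have q0 : 0 <= q by rewrite divr_ge0 ?cmod_ge0//; lra.
have q1 : q <= 2^-1.
  by rewrite /q ler_pdivrMr; lra.
have tail K : cmod (\sum_(k < N + K) a k * w ^+ k - \sum_(k < N) a k * w ^+ k) <= 2 * M * q ^+ N * (1 - 2^-1 ^+ K).
  elim: K => [|K IH]; first by rewrite addn0 subrr cmod0 expr0 subrr mulr0.
  rewrite addnS big_ord_recr /= -addrA [_ - \sum_(_ < _) _]addrC addrA; apply: le_trans (cmodD _ _) _.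
  have h : cmod (a (N + K)%N * w ^+ (N + K)) <= M * (q ^+ N * 2^-1 ^+ K).
    apply: le_trans (_ : M * (cmod w / (4 * r)) ^+ (N + K) <= _).
      rewrite cmodM cmodX expr_div_n mulrA ler_pdivlMr ?exprn_gt0 ?mulr_gt0// mulrAC ler_wpM2r ?exprn_ge0 ?cmod_ge0//.
    rewrite ler_wpM2l// exprD ler_pM// ?exprn_ge0 ?divr_ge0 ?cmod_ge0 ?mulr_ge0 ?(ltW r0)//.
      rewrite lerXn2r ?nnegrE ?divr_ge0 ?cmod_ge0 ?mulr_ge0 ?(ltW r0)// /q.
      rewrite ler_wpM2l ?cmod_ge0// lef_pV2 ?posrE; lra.
    rewrite lerXn2r ?nnegrE ?divr_ge0 ?cmod_ge0 ?mulr_ge0 ?invr_ge0 ?(ltW r0)//.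
    by rewrite ler_pdivrMr; lra.
  by apply: le_trans (lerD IH h) _; rewrite exprS; lra.
have [C HC] := fP w.
apply/ler_addgt0Pr => e e0; have [K hK] := half_to0 `|C| e0.
rewrite (_ : f w - _ = (f w - \sum_(k < N + K) a k * w ^+ k) + (\sum_(k < N + K) a k * w ^+ k - \sum_(k < N) a k * w ^+ k)); last by ring.
apply: le_trans (cmodD _ _) _; rewrite addrC; apply: lerD.
  apply: le_trans (tail K) _; rewrite ler_piMr ?mulr_ge0 ?exprn_ge0//.
apply: le_trans (HC _) _; apply: le_trans (_ : `|C| / 2 ^+ K <= _); last exact: ltW.
apply: le_trans (_ : `|C| / 2 ^+ (N + K) <= _).
  by rewrite ler_wpM2r ?invr_ge0 ?exprn_ge0// ler_norm.
by rewrite ler_wpM2l// lef_pV2 ?posrE ?exprn_gt0// ler_weXn2l ?leq_addl// ler1n.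
Qed.

Lemma pow_taylor2 z h (r : R) n : 1 <= r -> cmod z <= r -> cmod (z + h) <= r ->
  cmod ((z + h) ^+ n.+1 - z ^+ n.+1 - n.+1%:R * z ^+ n * h) <= cmod h ^+ 2 * (4 * r) ^+ n.+1.
Proof.
move=> r1 zr zhr; have r0 : 0 <= r by lra.
(* The square of [n.+1] is at most [4 ^+ n.+1], so the polynomial factor is absorbed by the
   geometric one. *)
suff H : cmod ((z + h) ^+ n.+1 - z ^+ n.+1 - n.+1%:R * z ^+ n * h) <= cmod h ^+ 2 * (n.+1%:R ^+ 2 * r ^+ n.+1).
  apply: le_trans H _; rewrite ler_wpM2l ?sqr_ge0// exprMn ler_wpM2r ?exprn_ge0//.
  rewrite -!natrX ler_nat; elim: n.+1 => // m IH; rewrite (expnS 4); nia.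
elim: n => [|n IH].
  rewrite !expr1 expr0 mulr1 mul1r (_ : _ - _ - _ = 0); last by ring.
  by rewrite cmod0 mulr_ge0 ?sqr_ge0// mulr_ge0.
rewrite (_ : _ - _ - _ = (z + h) * ((z + h) ^+ n.+1 - z ^+ n.+1 - n.+1%:R * z ^+ n * h) + n.+1%:R * z ^+ n * h ^+ 2); last first.
  by rewrite -(natr1 n.+1) !exprS; ring.
apply: le_trans (cmodD _ _) _; rewrite !cmodM !cmodX cmod_nat.
have h1 : cmod (z + h) * cmod ((z + h) ^+ n.+1 - z ^+ n.+1 - n.+1%:R * z ^+ n * h) <= r * (cmod h ^+ 2 * (n.+1%:R ^+ 2 * r ^+ n.+1)).
  by apply: ler_pM => //; exact: cmod_ge0.
have h2 : n.+1%:R * cmod z ^+ n * cmod h ^+ 2 <= n.+1%:R * r ^+ n.+2 * cmod h ^+ 2.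
  rewrite ler_wpM2r ?sqr_ge0// ler_wpM2l//; apply: le_trans (_ : r ^+ n <= _).
    by rewrite lerXn2r ?nnegrE ?cmod_ge0.
  by rewrite ler_weXn2l// leqW.
apply: le_trans (lerD h1 h2) _.
rewrite -(natr1 n.+1) [r ^+ n.+2]exprS; set x := n.+1%:R; set y := r ^+ n.+1.
have x0 : 0 <= x :> R by [].
have y0 : 0 <= r * y by rewrite mulr_ge0 ?exprn_ge0.
have := sqr_ge0 (cmod h); set u := _ ^+ 2 => u0.
have uy : 0 <= u * (r * y) by exact: mulr_ge0.
have : 0 <= x * (u * (r * y)) by exact: mulr_ge0.
lra.
Qed.

Lemma powser_entire f a : powser f a -> forall z, cdiffble f z.
Proof.
move=> fa z; have da := powser_decay fa.
pose r := cmod z + 1; have r1 : 1 <= r by rewrite lerDr cmod_ge0.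
have r0 : 0 < r by lra.
(* Of the factor 8, a factor 4 pays for [pow_taylor2] and a factor 2 makes the differentiated series
   converge like [2 ^- n]. *)
have [M M0 HM] := da (8 * r) (mulr_gt0 (ltr0n _ 8) r0).
have Mr n : cmod (a n) * (4 * r) ^+ n <= M / 2 ^+ n.
  rewrite ler_pdivlMr ?exprn_gt0// -mulrA -exprMn.
  by rewrite (_ : 4 * r * 2 = 8 * r)//; ring.
have [|D DP] := @complex_series_half (fun k => k.+1%:R * a k.+1 * z ^+ k) M.
  move=> n; apply: le_trans (le_trans (Mr n.+1) _); last first.
    by rewrite ler_wpM2l// lef_pV2 ?posrE ?exprn_gt0// ler_weXn2l// ler1n.
  have -> : cmod (n.+1%:R * a n.+1 * z ^+ n) = cmod (a n.+1) * (n.+1%:R * cmod z ^+ n).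
    by rewrite !cmodM cmodX cmod_nat; ring.
  rewrite ler_wpM2l ?cmod_ge0//.
  rewrite exprMn; apply: le_trans (_ : 4 ^+ n.+1 * r ^+ n <= _); last first.
    by rewrite ler_wpM2l ?exprn_ge0// ler_weXn2l.
  apply: ler_pM; rewrite ?exprn_ge0 ?cmod_ge0//.
    by rewrite -natrX ler_nat ltnW// ltn_expl.
  by rewrite lerXn2r ?nnegrE ?cmod_ge0// ?(ltW r0)// /r lerDl.
exists D => e e0; exists (Num.min 1 (e / (2 * M + 1))).
  by rewrite lt_min ltr01 divr_gt0//; lra.
move=> h; rewrite lt_min ltr_pdivlMr; last by lra.
move=> /andP[h1 he].
have zr : cmod z <= r by rewrite lerDl.
have zhr : cmod (z + h) <= r by apply: le_trans (cmodD _ _) _; rewrite lerD2l ltW.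
have [C C0 HC] := powser_half fa r0.
(* The second order remainders of the monomials are summed. The bound is uniform in [N] and
   therefore survives the passage to the limit in [lim]. *)
have poly N : cmod (\sum_(k < N.+1) a k * (z + h) ^+ k - \sum_(k < N.+1) a k * z ^+ k -
    (\sum_(k < N) k.+1%:R * a k.+1 * z ^+ k) * h) <= cmod h ^+ 2 * (M * (1 - 2^-1 ^+ N)).
  elim: N => [|N IH].
    by rewrite !big_ord_recl !big_ord0 !expr0 mul0r subr0 subrr cmod0 subrr !mulr0.
  rewrite [\sum_(k < N.+2) a k * (z + h) ^+ k]big_ord_recr [\sum_(k < N.+2) a k * z ^+ k]big_ord_recr.
  rewrite [\sum_(k < N.+1) _.+1%:R * _ * _]big_ord_recr /=.
  rewrite (_ : _ - _ - _ = (\sum_(k < N.+1) a k * (z + h) ^+ k - \sum_(k < N.+1) a k * z ^+ k -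
    (\sum_(k < N) k.+1%:R * a k.+1 * z ^+ k) * h) + a N.+1 * ((z + h) ^+ N.+1 - z ^+ N.+1 - N.+1%:R * z ^+ N * h)); last by ring.
  apply: le_trans (cmodD _ _) _; apply: le_trans (lerD IH _) _.
    rewrite cmodM; apply: ler_wpM2l; first exact: cmod_ge0.
    exact: (pow_taylor2 _ r1 zr zhr).
  rewrite [cmod (a _) * _]mulrCA -mulrDr ler_wpM2l ?sqr_ge0//; have := Mr N.+1; rewrite -exprVn !exprS; lra.
have lim : cmod (f (z + h) - f z - D * h) <= cmod h ^+ 2 * M.
  apply/ler_addgt0Pr => d d0.
  have [N hN] := half_to0 (2 * C + 4 * M * cmod h) d0.
  rewrite (_ : _ - _ - _ = (f (z + h) - \sum_(k < N.+1) a k * (z + h) ^+ k) -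
    (f z - \sum_(k < N.+1) a k * z ^+ k) - (D - \sum_(k < N) k.+1%:R * a k.+1 * z ^+ k) * h +
    (\sum_(k < N.+1) a k * (z + h) ^+ k - \sum_(k < N.+1) a k * z ^+ k -
    (\sum_(k < N) k.+1%:R * a k.+1 * z ^+ k) * h)); last by ring.
  apply: le_trans (cmodD _ _) _; rewrite addrC; apply: lerD.
    apply: le_trans (poly N) _; rewrite ler_wpM2l ?sqr_ge0// ler_piMr//.
  apply: le_trans (cmodB _ _) _; apply: le_trans (lerD (cmodB _ _) (lexx _)) _.
  have k1 := HC N.+1 _ zhr; have k2 := HC N.+1 _ zr.
  have k3 : cmod ((D - \sum_(k < N) k.+1%:R * a k.+1 * z ^+ k) * h) <= 4 * M / 2 ^+ N * cmod h.
    by rewrite cmodM ler_wpM2r ?cmod_ge0.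
  have k4 : C / 2 ^+ N.+1 <= C / 2 ^+ N.
    by rewrite ler_wpM2l// lef_pV2 ?posrE ?exprn_gt0// ler_weXn2l// ler1n.
  apply: le_trans (ltW hN); rewrite mulrDl -!mulrA in k3 *; lra.
apply: le_trans lim _; rewrite expr2 mulrAC ler_wpM2r ?cmod_ge0//; have := cmod_ge0 h; nra.
Qed.

Lemma powserD f g a b : powser f a -> powser g b ->
  powser (fun z => f z + g z) (fun k => a k + b k).
Proof.
move=> fa gb r r0; have [M HM] := fa r r0; have [K HK] := gb r r0.
exists (M + K) => N w wr; rewrite (_ : _ - _ = (f w - \sum_(k < N) a k * w ^+ k) + (g w - \sum_(k < N) b k * w ^+ k)).
  by apply: le_trans (cmodD _ _) _; rewrite mulrDl lerD ?HM ?HK.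
under eq_bigr do rewrite mulrDl.
by rewrite big_split /=; ring.
Qed.

Lemma powserZ c f a : powser f a -> powser (fun z => c * f z) (fun k => c * a k).
Proof.
move=> fa r r0; have [M HM] := fa r r0.
exists (cmod c * M) => N w wr; rewrite (_ : _ - _ = c * (f w - \sum_(k < N) a k * w ^+ k)).
  by rewrite cmodM -mulrA ler_wpM2l ?cmod_ge0 ?HM.
rewrite mulrBr mulr_sumr; congr (_ - _); apply: eq_bigr => k _; ring.
Qed.

Lemma powserB f g a b : powser f a -> powser g b ->
  powser (fun z => f z - g z) (fun k => a k - b k).
Proof.
move=> fa gb; have := powserD fa (powserZ (-1) gb).
rewrite (_ : (fun z => _) = (fun z => f z - g z)); last by apply/funext => z; rewrite mulN1r.
by rewrite (_ : (fun k => a k + _) = (fun k => a k - b k))//; apply/funext => z; rewrite mulN1r.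
Qed.

Lemma powser0 : powser (fun=> 0 : R[i]) (fun=> 0 : R[i]).
Proof.
move=> r r0; exists 0 => N w _; rewrite big1 ?subrr ?cmod0 ?mul0r// => k _.
by rewrite mul0r.
Qed.

Lemma powser_sum (I : Type) (s : seq I) (F : I -> R[i] -> R[i]) (A : I -> nat -> R[i]) :
  (forall i, powser (F i) (A i)) ->
  powser (fun z => \sum_(i <- s) F i z) (fun k => \sum_(i <- s) A i k).
Proof.
move=> H; elim: s => [|i s IH].
  rewrite (_ : (fun z => _) = (fun=> 0)); last by apply/funext => z; rewrite big_nil.
  rewrite (_ : (fun k => _) = (fun=> 0)); last by apply/funext => z; rewrite big_nil.
  exact: powser0.
rewrite (_ : (fun z => _) = (fun z => F i z + \sum_(j <- s) F j z)); last first.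
  by apply/funext => z; rewrite big_cons.
rewrite (_ : (fun k => _) = (fun k => A i k + \sum_(j <- s) A j k)); last first.
  by apply/funext => k; rewrite big_cons.
exact: powserD.
Qed.

(** The finitely supported sequence [b] decays, hence has a sum by [decay_powser]; its partial sums
    are constant from [n] on, so this sum is the polynomial. *)
Lemma powser_poly (n : nat) a : powser (fun z => \sum_(k < n) a k * z ^+ k)
  (fun k => if (k < n)%N then a k else 0).
Proof.
set b : nat -> R[i] := fun k => if (k < n)%N then a k else 0.
have db : decay b.
  move=> r r0; exists (\sum_(k < n) cmod (a k) * r ^+ k).
    by apply: sumr_ge0 => k _; rewrite mulr_ge0 ?cmod_ge0 ?exprn_ge0// ltW.
  move=> k; rewrite /b; case: ltnP => kn; last first.
    by rewrite cmod0 mul0r; apply: sumr_ge0 => j _; rewrite mulr_ge0 ?cmod_ge0 ?exprn_ge0// ltW.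
  rewrite (bigD1 (Ordinal kn))//= lerDl; apply: sumr_ge0 => j _.
  by rewrite mulr_ge0 ?cmod_ge0 ?exprn_ge0// ltW.
have [f fb] := decay_powser db.
suff <- : f = (fun z => \sum_(k < n) a k * z ^+ k) by [].
apply/funext => w; apply/eqP; rewrite -subr_eq0 -cmod_eq0 eq_le cmod_ge0 andbT.
have r0 : 0 < cmod w + 1 by rewrite ltr_wpDl ?cmod_ge0.
have [M M0 HM] := powser_half fb r0.
apply/ler_addgt0Pr => e e0; rewrite add0r; have [N hN] := half_to0 M e0.
have wr : cmod w <= cmod w + 1 by rewrite lerDl.
have := HM (n + N)%N w wr; rewrite big_split_ord /= [\sum_(i < N) b (n + i)%N * _]big1 ?addr0; last first.
  by move=> k _; rewrite /b ifF ?mul0r//; apply/negbTE; rewrite -leqNgt leq_addr.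
rewrite (eq_bigr (fun k : 'I_n => a k * w ^+ k)); last by move=> k _; rewrite /b ltn_ord.
move=> /le_trans; apply; apply: le_trans (ltW hN).
by rewrite ler_wpM2l// lef_pV2 ?posrE ?exprn_gt0// ler_weXn2l ?leq_addl// ler1n.
Qed.

End power_series.

(** * Area measure *)

Section lebesgue_affine.
Variable R : realType.
Local Notation mu := (@lebesgue_measure R).
Local Notation RM := (measurableTypeR R).

(** The image of Lebesgue measure under the translation agrees with it on half-open intervals, so
    the two are equal by uniqueness. *)
Lemma lebesgue_integral_shift (a : R) (g : RM -> \bar R) :
  measurable_fun setT g -> (forall x, 0 <= g x)%E ->
  (\int[mu]_x g (x + a)%R = \int[mu]_x g x)%E.
Proof.
move=> mg g0; pose phi : RM -> RM := fun x => x + a.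
have mphi : measurable_fun setT phi.
  by apply: measurable_funD => //; exact: measurable_cst.
pose phim : {mfun RM >-> RM} := HB.pack phi (isMeasurableFun.Build _ _ _ _ phi mphi).
rewrite -[RHS](@eq_measure_integral _ _ _ setT _ (pushforward mu phim) g); last first.
  move=> A mA _; apply/esym/lebesgue_measure_unique => //= _ [[x y]] _ <-.
  rewrite /pushforward (_ : _ @^-1` _ = `]x - a, y - a]%classic); last first.
    by apply/seteqP; split => t /=; rewrite /phi !in_itv /= ltrBlDr lerBrDr.
  rewrite !lebesgue_measure_itv/= !lte_fin ltrD2r; case: ifP => // _.
  by rewrite -!EFinB; congr EFin; ring.
rewrite ge0_integral_pushforward//=.
Qed.

Lemma lebesgue_integral_scale (c : R) (g : RM -> \bar R) : 0 < c ->
  measurable_fun setT g -> (forall x, 0 <= g x)%E ->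
  (\int[mu]_x g x = c%:E * \int[mu]_x g (c * x)%R)%E.
Proof.
move=> c0 mg g0; pose phi : RM -> RM := fun x => c * x.
have mphi : measurable_fun setT phi.
  by apply: measurable_funM => //; exact: measurable_cst.
pose phim : {mfun RM >-> RM} := HB.pack phi (isMeasurableFun.Build _ _ _ _ phi mphi).
rewrite (@eq_measure_integral _ _ _ setT (mscale (NngNum (ltW c0)) (pushforward mu phim)) _ g); last first.
  move=> A mA _; apply/lebesgue_measure_unique => //= _ [[x y]] _ <-.
  change (mu `]x, y]%classic = (c%:E * mu (phi @^-1` `]x, y]%classic))%E).
  rewrite (_ : _ @^-1` _ = `]x / c, y / c]%classic); last first.
    by apply/seteqP; split => t /=; rewrite /phi !in_itv /= ltr_pdivrMr// ler_pdivlMr// [t * c]mulrC.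
  rewrite !lebesgue_measure_itv/= !lte_fin ltr_pM2r ?invr_gt0//; case: ifP => _; last by rewrite mule0.
  by rewrite -!EFinB -EFinM; congr EFin; field; rewrite gt_eqF.
rewrite ge0_integral_mscale//= ge0_integral_pushforward//=.
Qed.

End lebesgue_affine.

Section area.
Variable R : realType.
Local Notation mu := (@lebesgue_measure R).
Local Notation RM := (measurableTypeR R).
Local Notation re := complex.Re.
Local Notation im := complex.Im.
Implicit Types (g h : R[i] -> \bar R) (w z : R[i]).

(** With the second coordinate fixed, the shear is a translation, so Tonelli's theorem reduces the
    claim to dimension one. *)
Lemma area_hshear (G : RM * RM -> \bar R) (a : R) : measurable_fun setT G -> (forall p, 0 <= G p)%E ->
  (\int[@area_measure R]_p G ((p.1 + a * p.2)%R, p.2) = \int[@area_measure R]_p G p)%E.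
Proof.
move=> mG G0; rewrite /area_measure.
have mG' : measurable_fun setT (fun p : RM * RM => G ((p.1 + a * p.2)%R, p.2)).
  apply: measurableT_comp => //; apply: measurable_fun_pair => //.
  apply: measurable_funD => //; apply: measurable_funM => //; exact: measurable_cst.
rewrite !fubini_tonelli2//; apply: eq_integral => y _; rewrite /fubini_G /=.
apply: (@lebesgue_integral_shift _ (a * y) (fun x => G (x, y))) => //.
exact: measurable_fun_pair1.
Qed.

Lemma area_vshear (G : RM * RM -> \bar R) (a : R) : measurable_fun setT G -> (forall p, 0 <= G p)%E ->
  (\int[@area_measure R]_p G (p.1, (p.2 + a * p.1)%R) = \int[@area_measure R]_p G p)%E.
Proof.
move=> mG G0; rewrite /area_measure.
have mG' : measurable_fun setT (fun p : RM * RM => G (p.1, (p.2 + a * p.1)%R)).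
  apply: measurableT_comp => //; apply: measurable_fun_pair => //.
  apply: measurable_funD => //; apply: measurable_funM => //; exact: measurable_cst.
rewrite !fubini_tonelli1//; apply: eq_integral => x _; rewrite /fubini_F /=.
apply: (@lebesgue_integral_shift _ (a * x) (fun y => G (x, y))) => //.
exact: measurable_fun_pair2.
Qed.

Definition cmeas g := measurable_fun setT (fun p : RM * RM => g (p.1 +i* p.2)).

Definition aint g : \bar R := (\int[@area_measure R]_p g (p.1 +i* p.2))%E.

Lemma cmeas_lin g (a b c d : R) : cmeas g ->
  measurable_fun setT (fun p : RM * RM => g ((a * p.1 + b * p.2) +i* (c * p.1 + d * p.2))).
Proof.
move=> mg; apply: (@measurableT_comp _ _ _ _ _ _ (fun p : RM * RM => g (p.1 +i* p.2)) setT (fun p : RM * RM => (a * p.1 + b * p.2, c * p.1 + d * p.2) : RM * RM)) => //.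
by apply: measurable_fun_pair => //; apply: measurable_funD => //; apply: measurable_funM => //; exact: measurable_cst.
Qed.

Lemma cmeas_mul g w : cmeas g -> cmeas (fun z => g (w * z)).
Proof.
case: w => a b mg; rewrite /cmeas.
have -> : (fun p : RM * RM => g ((a +i* b) * (p.1 +i* p.2))) =
  (fun p => g ((a * p.1 + (- b) * p.2) +i* (b * p.1 + a * p.2))).
  by apply/funext => p; congr g; apply: complex_ext => /=; ring.
exact: cmeas_lin.
Qed.

(* A rotation other than -1 is a product of three shears. *)
Lemma aint_rot g w : cmeas g -> (forall z, 0 <= g z)%E -> cmod w = 1 -> w != -1 ->
  aint (fun z => g (w * z)) = aint g.
Proof.
case: w => c s mg g0 w1 wN; rewrite /aint.
have cs : c ^+ 2 + s ^+ 2 = 1 by have := sqr_cmod (c +i* s); rewrite w1 expr1n /= => <-.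
have c1 : 1 + c != 0.
  apply: contra wN => /eqP E; have cE : c = -1 by lra.
  have : s ^+ 2 = 0 by move: cs; rewrite cE; lra.
  by move/eqP; rewrite sqrf_eq0 => /eqP ->; rewrite cE eq_complex /= oppr0 !eqxx.
(* The tangent of half the angle, which is the parameter of the two horizontal shears. *)
pose t := s / (1 + c).
have tc : t * (1 + c) = s by rewrite /t mulfVK.
have ts : t * s = 1 - c.
  have E : s * s = 1 - c ^+ 2 by lra.
  by rewrite /t mulrAC E; field.
have sh (a b d e : R) : measurable_fun setT (fun p : RM * RM => g ((a * p.1 + b * p.2) +i* (d * p.1 + e * p.2))).
  exact: cmeas_lin.
have m2 : measurable_fun setT (fun p : RM * RM => g ((p.1 + - t * p.2) +i* p.2)).
  rewrite (_ : (fun p => _) = (fun p : RM * RM => g ((1 * p.1 + - t * p.2) +i* (0 * p.1 + 1 * p.2)))) //.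
  by apply/funext => p; congr (g (_ +i* _)); ring.
have m3 : measurable_fun setT (fun p : RM * RM => g ((p.1 + - t * (p.2 + s * p.1)) +i* (p.2 + s * p.1))).
  rewrite (_ : (fun p => _) = (fun p : RM * RM => g (((1 - t * s) * p.1 + - t * p.2) +i* (s * p.1 + 1 * p.2)))) //.
  by apply/funext => p; congr (g (_ +i* _)); ring.
have S1 := area_hshear (- t) mg (fun p => g0 _).
have S2 := area_vshear s m2 (fun p => g0 _).
have S3 := area_hshear (- t) m3 (fun p => g0 _).
apply: etrans (etrans S3 (etrans S2 S1)).
apply: eq_integral => -[x y] _ /=; congr g; apply: complex_ext => /=.
  have -> : x + - t * y + - t * (y + s * (x + - t * y)) = x * (1 - t * s) - t * y * (1 + (1 - t * s)) by ring.
  by rewrite ts -tc; ring.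
have -> : y + s * (x + - t * y) = s * x + (1 - t * s) * y by ring.
by rewrite ts; ring.
Qed.

Lemma aint_scale g (r : R) : 0 < r -> cmeas g -> (forall z, 0 <= g z)%E ->
  aint g = ((r ^+ 2)%:E * aint (fun z => g (r%:C * z)%R))%E.
Proof.
move=> r0 mg g0; rewrite /aint /area_measure.
have mg' := cmeas_mul r%:C mg.
rewrite !fubini_tonelli1//.
transitivity (\int[mu]_x (r%:E * (\int[mu]_y g (x +i* (r * y)%R))))%E.
  apply: eq_integral => x _; apply: (@lebesgue_integral_scale _ r (fun y => g (x +i* y))) => //.
  exact: (measurable_fun_pair2 (f := fun p : RM * RM => g (p.1 +i* p.2))).
have mF : measurable_fun setT (fun p : RM * RM => g (p.1 +i* (r * p.2)%R)).
  by have := cmeas_lin 1 0 0 r mg; under eq_fun do rewrite mul1r !mul0r addr0 add0r.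
have mI : measurable_fun setT (fun x : RM => \int[mu]_y g (x +i* (r * y)%R))%E.
  exact: (measurable_fun_fubini_tonelli_F (m2 := mu) (fun p : RM * RM => g (p.1 +i* (r * p.2)%R)) mF (fun p => g0 _)).
have I0 : forall x : RM, (0 <= \int[mu]_y g (x +i* (r * y)%R))%E by move=> x; exact: integral_ge0.
apply: etrans (@ge0_integralZl_EFin _ _ _ mu setT measurableT _ (fun x _ => I0 x) mI _ (ltW r0)) _.
have S := @lebesgue_integral_scale _ r _ r0 mI I0.
apply: etrans (congr1 (fun u => (r%:E * u)%E) S) _.
rewrite muleA -EFinM -expr2; congr (_ * _)%E.
apply: eq_integral => x _; apply: eq_integral => y _; congr g.
by apply: complex_ext => /=; ring.
Qed.

End area.

(** * Roots of unity and the discrete Fourier transform *)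

Section roots_of_unity.
Variable R : realType.
Local Notation re := complex.Re.
Local Notation im := complex.Im.

(* A primitive 2^j-th root of unity. *)
Fixpoint zeta j : R[i] := if j is k.+1 then (if k is 0%N then -1 else sqrtc (zeta k)) else 1.

Lemma zetaS j : zeta j.+1 ^+ 2 = zeta j.
Proof. by case: j => [|j]; [rewrite /= sqrrN expr1n|rewrite [zeta j.+2]/= sqr_sqrtc]. Qed.

Lemma zetaXj j : zeta j ^+ (2 ^ j) = 1.
Proof. by elim: j => [|j IH]; rewrite ?expr1n// expnS exprM zetaS. Qed.

(** This fails if -1 is not put in by hand at the first step of [zeta], because the principal square
    root of 1 is 1; afterwards the choice of root is immaterial. *)
Lemma zetaXN j : zeta j.+1 ^+ (2 ^ j) = -1.
Proof. by elim: j => [|j IH]; rewrite ?expr1// expnS exprM zetaS. Qed.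

(** For odd [n], raising [zeta j.+1 ^+ n = 1] to the power [2 ^ j] would give [(-1) ^+ n = 1]; even
    exponents descend to the previous root. *)
Lemma zeta_neq1 j n : (0 < n < 2 ^ j)%N -> zeta j ^+ n != 1.
Proof.
elim: j n => [|j IH] n /andP[n0 nj].
  by move: n0 nj; rewrite expn0 ltnS leqn0 lt0n => /negP.
have [on|/negbTE on] := boolP (odd n).
  apply/eqP => E; have := zetaXN j => E2.
  have : (-1 : R[i]) ^+ n = 1 by rewrite -E2 -exprM mulnC exprM E expr1n.
  rewrite -signr_odd on expr1 => /eqP; rewrite eq_complex /= => /andP[/eqP]; lra.
rewrite -(odd_double_half n) on add0n -mul2n exprM zetaS IH//.
by move: nj on; rewrite expnS; have := odd_double_half n; lia.
Qed.

Lemma cmod_zeta j : cmod (zeta j) = 1.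
Proof.
have := congr1 (@ComplexField.Normc.normc R) (zetaXj j); rewrite cmodX cmod1 => /eqP.
by rewrite -[X in _ == X](expr1n _ (2 ^ j)) eqrXn2 ?cmod_ge0 ?expn_gt0// => /eqP.
Qed.

(** Rotation by -1 is excluded in [aint_rot]; hence the condition [1 < j] wherever integrals are
    rotated. *)
Lemma zeta_neqN1 j : (1 < j)%N -> zeta j != -1.
Proof.
case: j => [|[|j]]// _; apply/eqP => E; have := zetaXN j.+1.
rewrite E expnS exprM sqrrN !expr1n => /eqP; rewrite eq_complex /= => /andP[/eqP]; lra.
Qed.

Lemma mulcJ (z : R[i]) : z * conjc z = (cmod z ^+ 2)%:C.
Proof. by rewrite sqr_cmod; case: z => a b; apply: complex_ext => /=; ring. Qed.

Lemma zetaJ j n l : (n < 2 ^ j)%N -> (l < 2 ^ j)%N ->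
  \sum_(k < 2 ^ j) (zeta j ^+ n * conjc (zeta j ^+ l)) ^+ k = if n == l then (2 ^ j)%:R else 0.
Proof.
move=> nj lj; set x := _ * _.
have inv m : zeta j ^+ m * conjc (zeta j ^+ m) = 1.
  by rewrite mulcJ cmodX cmod_zeta !expr1n.
case: eqP => [E|/eqP nl].
  by rewrite (eq_bigr (fun=> 1)) ?sumr_const ?card_ord// => k _; rewrite /x E inv expr1n.
have x1 : x != 1.
  wlog ln : n l nj lj nl @x / (l < n)%N => [H|].
    have [ln|nl'] := ltnP l n; first exact: H.
    have := H l n lj nj; rewrite eq_sym nl => /(_ isT); rewrite ltn_neqAle nl nl' => /(_ isT).
    by apply: contra => /eqP xE; rewrite -(conjcK (zeta j ^+ l)) -rmorphM /= mulrC -/x xE conjc1.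
  have := zeta_neq1 (j := j) (n := (n - l)%N); rewrite subn_gt0 ln (leq_ltn_trans (leq_subr _ _))// => /(_ isT).
  by rewrite /x -{2}(subnK (ltnW ln)) exprD -mulrA inv mulr1.
have : (x - 1) * \sum_(k < 2 ^ j) x ^+ k = 0.
  rewrite -subrX1 /x exprMn -rmorphXn /= -!exprM ![(_ * 2 ^ j)%N]mulnC !exprM zetaXj !expr1n.
  by rewrite conjc1 mulr1 subrr.
by move/eqP; rewrite mulf_eq0 subr_eq0 (negbTE x1) => /eqP.
Qed.

(** Summing over [k] first, orthogonality of the characters leaves the diagonal terms; [N <= 2 ^ j]
    rules out aliasing. *)
Lemma discrete_parseval j N (b : nat -> R[i]) : (N <= 2 ^ j)%N ->
  \sum_(k < 2 ^ j) cmod (\sum_(n < N) b n * zeta j ^+ (k * n)) ^+ 2 =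
  2 ^+ j * \sum_(n < N) cmod (b n) ^+ 2.
Proof.
move=> Nj; apply: (@complexI R); rewrite rmorph_sum /=.
have H (k : 'I_(2 ^ j)) : (cmod (\sum_(n < N) b n * zeta j ^+ (k * n)) ^+ 2)%:C =
    \sum_(n < N) \sum_(l < N) b n * conjc (b l) * (zeta j ^+ n * conjc (zeta j ^+ l)) ^+ k.
  rewrite -mulcJ rmorph_sum /= mulr_suml; apply: eq_bigr => n _.
  rewrite mulr_sumr; apply: eq_bigr => l _.
  by rewrite rmorphM /= exprMn -!exprM -rmorphXn /= -exprM ![(k * _)%N]mulnC; ring.
rewrite (eq_bigr _ (fun k _ => H k)) exchange_big /= rmorphM rmorph_sum /= mulr_sumr.
apply: eq_bigr => n _; rewrite exchange_big /=.
rewrite (bigD1 n)//= [X in _ + X]big1 ?addr0; last first.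
  move=> l ln; rewrite -mulr_sumr zetaJ ?(leq_trans (ltn_ord _))//.
  by rewrite ifF ?mulr0//; apply/negbTE; rewrite eq_sym.
rewrite -mulr_sumr zetaJ ?(leq_trans (ltn_ord _))// eqxx mulcJ natrX mulrC.
by rewrite -[2 ^+ j in RHS]natrX (rmorph_nat (@real_complex R)) natrX.
Qed.

End roots_of_unity.

(** * Measurability and integration of functions on the plane *)

Section area_calculus.
Variable R : realType.
Local Notation mu := (@lebesgue_measure R).
Local Notation RM := (measurableTypeR R).
Local Notation re := complex.Re.
Local Notation im := complex.Im.
Implicit Types (g h : R[i] -> \bar R) (u v : R[i] -> R) (w z : R[i]).

Definition rmeas u := measurable_fun setT (fun p : RM * RM => u (p.1 +i* p.2)).

Lemma rmeas_cmeas u : rmeas u -> cmeas (fun z => (u z)%:E).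
Proof. by move=> mu; apply/measurable_EFinP. Qed.

Lemma rmeas_re : rmeas (@complex.Re R).
Proof. exact: measurable_fst. Qed.

Lemma rmeas_im : rmeas (@complex.Im R).
Proof. exact: measurable_snd. Qed.

Lemma rmeas_cst (c : R) : rmeas (fun=> c).
Proof. exact: measurable_cst. Qed.

Lemma rmeasD u v : rmeas u -> rmeas v -> rmeas (fun z => u z + v z).
Proof. by move=> mu mv; exact: measurable_funD. Qed.

Lemma rmeasB u v : rmeas u -> rmeas v -> rmeas (fun z => u z - v z).
Proof. by move=> mu mv; exact: measurable_funB. Qed.

Lemma rmeasM u v : rmeas u -> rmeas v -> rmeas (fun z => u z * v z).
Proof. by move=> mu mv; exact: measurable_funM. Qed.

Lemma rmeasX u n : rmeas u -> rmeas (fun z => u z ^+ n).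
Proof. by move=> mu; exact: measurable_funX. Qed.

Lemma rmeas_sum (I : Type) (s : seq I) (F : I -> R[i] -> R) : (forall i, rmeas (F i)) ->
  rmeas (fun z => \sum_(i <- s) F i z).
Proof.
move=> H; elim: s => [|i s IH].
  rewrite (_ : (fun z => _) = (fun=> 0)); first exact: rmeas_cst.
  by apply/funext => z; rewrite big_nil.
rewrite (_ : (fun z => _) = (fun z => F i z + \sum_(j <- s) F j z)); first exact: rmeasD.
by apply/funext => z; rewrite big_cons.
Qed.

Lemma rmeas_mul u w : rmeas u -> rmeas (fun z => u (w * z)).
Proof. by move=> /rmeas_cmeas/(cmeas_mul w)/measurable_EFinP. Qed.

Lemma rmeas_cmod2 (f : R[i] -> R[i]) : rmeas (fun z => re (f z)) -> rmeas (fun z => im (f z)) ->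
  rmeas (fun z => cmod (f z) ^+ 2).
Proof.
move=> m1 m2; rewrite (_ : (fun z => _) = (fun z => re (f z) ^+ 2 + im (f z) ^+ 2)).
  by apply: rmeasD; exact: rmeasX.
by apply/funext => z; rewrite sqr_cmod.
Qed.

Lemma rmeas_cmodX n : rmeas (fun z => cmod z ^+ (2 * n)).
Proof.
rewrite (_ : (fun z => _) = (fun z => (cmod z ^+ 2) ^+ n)); last by apply/funext => z; rewrite exprM.
by apply: rmeasX; apply: (@rmeas_cmod2 id); [exact: rmeas_re|exact: rmeas_im].
Qed.

Lemma rmeas_cvg (F : nat -> R[i] -> R) u : (forall n, rmeas (F n)) ->
  (forall z, F n z @[n --> \oo] --> u z) -> rmeas u.
Proof. by move=> mF cF; apply: (measurable_fun_cvg mF) => p _; exact: cF. Qed.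

Lemma rmeas_disc u (r : R) : 0 <= r -> rmeas u -> rmeas (fun z => if cmod z <= r then u z else 0).
Proof.
move=> r0 mu; rewrite (_ : (fun z => _) = (fun z => if cmod z ^+ 2 <= r ^+ 2 then u z else 0)); last first.
  by apply/funext => z; rewrite ler_pXn2r ?nnegrE ?cmod_ge0.
rewrite /rmeas; apply: measurable_fun_ifT => //.
apply: measurable_fun_ler; last exact: measurable_cst.
by apply: (@rmeas_cmod2 id); [exact: rmeas_re|exact: rmeas_im].
Qed.

Lemma rmeas_poly_re (a : nat -> R[i]) N : rmeas (fun z => re (\sum_(k < N) a k * z ^+ k)) /\
  rmeas (fun z => im (\sum_(k < N) a k * z ^+ k)).
Proof.
have mX k : rmeas (fun z => re (z ^+ k)) /\ rmeas (fun z => im (z ^+ k)).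
  elim: k => [|k [h1 h2]]; first by split; exact: rmeas_cst.
  split.
    rewrite (_ : (fun z => _) = (fun z => re z * re (z ^+ k) - im z * im (z ^+ k))).
      by apply: rmeasB; apply: rmeasM => //; [exact: rmeas_re|exact: rmeas_im].
    by apply/funext => z; rewrite exprS ReM.
  rewrite (_ : (fun z => _) = (fun z => re z * im (z ^+ k) + im z * re (z ^+ k))).
    by apply: rmeasD; apply: rmeasM => //; [exact: rmeas_re|exact: rmeas_im].
  by apply/funext => z; rewrite exprS ImM.
elim: N => [|N [IH1 IH2]].
  split; [rewrite (_ : (fun z => _) = (fun=> 0))|rewrite (_ : (fun z => _) = (fun=> 0))];
  by [exact: rmeas_cst|apply/funext => z; rewrite big_ord0].
have [h1 h2] := mX N; split.
  rewrite (_ : (fun z => _) = (fun z => re (\sum_(k < N) a k * z ^+ k) +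
      (re (a N) * re (z ^+ N) - im (a N) * im (z ^+ N)))).
    by apply: rmeasD => //; apply: rmeasB; apply: rmeasM => //; exact: rmeas_cst.
  by apply/funext => z; rewrite big_ord_recr /= !ReImE.
rewrite (_ : (fun z => _) = (fun z => im (\sum_(k < N) a k * z ^+ k) +
      (re (a N) * im (z ^+ N) + im (a N) * re (z ^+ N)))).
  by apply: rmeasD => //; apply: rmeasD; apply: rmeasM => //; exact: rmeas_cst.
by apply/funext => z; rewrite big_ord_recr /= !ReImE.
Qed.

Lemma half_cvg (x : nat -> R) (l M : R) : (forall n, `|x n - l| <= M / 2 ^+ n) ->
  x n @[n --> \oo] --> l.
Proof.
move=> H; apply/cvgrPdist_le => e e0; have [N HN] := half_to0 M e0.
exists N => // n /= Nn; rewrite distrC; apply: le_trans (H n) _.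
have M0 : 0 <= M by have := H 0%N; rewrite expr0 divr1; apply: le_trans.
by apply: le_trans (ltW HN); rewrite ler_wpM2l// lef_pV2 ?posrE ?exprn_gt0// ler_weXn2l// ler1n.
Qed.

Lemma powser_cvg (f : R[i] -> R[i]) a z : powser f a ->
  (re (\sum_(k < n) a k * z ^+ k) @[n --> \oo] --> re (f z)) /\
  (im (\sum_(k < n) a k * z ^+ k) @[n --> \oo] --> im (f z)).
Proof.
move=> fa; have r0 : 0 < cmod z + 1 by rewrite ltr_wpDl ?cmod_ge0.
have [M M0 HM] := powser_half fa r0.
have zr : cmod z <= cmod z + 1 by rewrite lerDl.
split; apply: (half_cvg (M := M)) => n; rewrite distrC; apply: le_trans (HM n z zr).
  by apply: le_trans (cmod_Re _); rewrite !ReImE.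
by apply: le_trans (cmod_Im _); rewrite !ReImE.
Qed.

Lemma rmeas_powser (f : R[i] -> R[i]) a : powser f a ->
  rmeas (fun z => re (f z)) /\ rmeas (fun z => im (f z)).
Proof.
move=> fa; split.
  apply: (rmeas_cvg (F := fun n z => re (\sum_(k < n) a k * z ^+ k))) => [n|z].
    by have [] := rmeas_poly_re a n.
  by have [] := powser_cvg z fa.
apply: (rmeas_cvg (F := fun n z => im (\sum_(k < n) a k * z ^+ k))) => [n|z].
  by have [] := rmeas_poly_re a n.
by have [] := powser_cvg z fa.
Qed.

Lemma aintD g h : cmeas g -> cmeas h -> (forall z, 0 <= g z)%E -> (forall z, 0 <= h z)%E ->
  (aint (fun z => g z + h z) = aint g + aint h)%E.
Proof.
move=> mg mh g0 h0.
exact: (@ge0_integralD _ _ _ (@area_measure R) setT measurableT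
  (fun p : RM * RM => g (p.1 +i* p.2)) (fun p : RM * RM => h (p.1 +i* p.2))
  (fun p _ => g0 _) mg (fun p _ => h0 _) mh).
Qed.

Lemma aintZ g (c : R) : cmeas g -> (forall z, 0 <= g z)%E -> 0 <= c ->
  (aint (fun z => c%:E * g z) = c%:E * aint g)%E.
Proof.
move=> mg g0 c0.
exact: (@ge0_integralZl_EFin _ _ _ (@area_measure R) setT measurableT
  (fun p : RM * RM => g (p.1 +i* p.2)) (fun p _ => g0 _) mg _ c0).
Qed.

Lemma aint_ge0 g : (forall z, 0 <= g z)%E -> (0 <= aint g)%E.
Proof. by move=> g0; apply: integral_ge0. Qed.

Lemma aint_le g h : cmeas g -> cmeas h -> (forall z, 0 <= g z)%E -> 
  (forall z, g z <= h z)%E -> (aint g <= aint h)%E.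
Proof.
move=> mg mh g0 gh.
apply: (@ge0_le_integral _ _ _ (@area_measure R) setT measurableT
  (fun p : RM * RM => g (p.1 +i* p.2)) (fun p : RM * RM => h (p.1 +i* p.2))) => //.
Qed.

Lemma aint_ext g h : g =1 h -> aint g = aint h.
Proof. by move=> gh; apply: eq_integral => p _; exact: gh. Qed.

Lemma aint_sum (I : Type) (s : seq I) (F : I -> R[i] -> \bar R) :
  (forall i, cmeas (F i)) -> (forall i z, 0 <= F i z)%E ->
  aint (fun z => \sum_(i <- s) F i z)%E = (\sum_(i <- s) aint (F i))%E.
Proof.
move=> mF F0.
exact: (@ge0_integral_sum _ _ _ (@area_measure R) setT measurableT I
  (fun i (p : RM * RM) => F i (p.1 +i* p.2)) mF (fun i p _ => F0 i _) s).
Qed.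

Lemma aint_nneseries (F : nat -> R[i] -> \bar R) :
  (forall i, cmeas (F i)) -> (forall i z, 0 <= F i z)%E ->
  aint (fun z => \sum_(i <oo) F i z)%E = (\sum_(i <oo) aint (F i))%E.
Proof.
move=> mF F0.
exact: (@integral_nneseries _ _ _ (@area_measure R) setT measurableT
  (fun i (p : RM * RM) => F i (p.1 +i* p.2)) mF (fun i p _ => F0 i _)).
Qed.

Lemma aint_fatou (F : nat -> R[i] -> \bar R) g :
  (forall i, cmeas (F i)) -> (forall i z, 0 <= F i z)%E ->
  (forall z, F n z @[n --> \oo] --> g z) ->
  (aint g <= limn_einf (fun n => aint (F n)))%E.
Proof.
move=> mF F0 Fg.
apply: le_trans (@fatou _ _ _ (@area_measure R) setT measurableT
  (fun i (p : RM * RM) => F i (p.1 +i* p.2)) mF (fun i p _ => F0 i _)).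
apply: le_of_eq; apply: eq_integral => p _.
by have [-> _] := cvg_limn_einf_sup (Fg (p.1 +i* p.2)).
Qed.

End area_calculus.

(** * Moments of discs and tents *)

Section disc_moments.
Variable R : realType.
Local Notation mu := (@lebesgue_measure R).
Local Notation RM := (measurableTypeR R).
Local Notation re := complex.Re.
Local Notation im := complex.Im.
Implicit Types (z : R[i]).

Definition disc_fun n (r : R) z : R := if cmod z <= r then cmod z ^+ (2 * n) else 0.

Lemma rmeas_disc_fun n r : 0 <= r -> rmeas (disc_fun n r).
Proof. by move=> r0; apply: rmeas_disc => //; exact: rmeas_cmodX. Qed.

Lemma disc_fun_ge0 n r z : 0 <= disc_fun n r z.
Proof. by rewrite /disc_fun; case: ifP => // _; rewrite exprn_ge0 ?cmod_ge0. Qed.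

Definition discE n : \bar R := aint (fun z => (disc_fun n 1 z)%:E).

Lemma aint_rect (x : R) : 0 < x ->
  aint (fun z => (if (`|re z| <= x) && (`|im z| <= x) then 1 else 0)%:E) = ((2 * x) ^+ 2)%:E.
Proof.
move=> x0; pose S : set RM := `[- x, x]%classic.
have -> : aint (fun z => (if (`|re z| <= x) && (`|im z| <= x) then 1 else 0)%:E) =
   (\int[@area_measure R]_p (\1_(S `*` S) p)%:E)%E.
  apply: eq_integral => -[s t] _; rewrite indicE /= !ler_norml; congr (_%:E).
  case: ifPn => [/andP[h1 h2]|h].
    by rewrite mem_set// /S /setX /= !in_itv.
  rewrite memNset// /S /setX /= !in_itv /= => -[h1 h2].
  by move: h; rewrite h1 h2.
have mS : measurable S by exact: measurable_itv.
rewrite integral_indic ?setIT//; last exact: measurableX.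
have mSE : mu S = (2 * x)%:E.
  rewrite (lebesgue_measure_itv `[- x, x]) /= lte_fin ifT; last by rewrite -subr_gt0 opprK addr_gt0.
  by rewrite -EFinB; congr EFin; ring.
apply: etrans (product_measure1E _ _ mS mS) _.
by apply: etrans (congr2 (fun a b => (a * b)%E) mSE mSE) _; rewrite -EFinM.
Qed.

Lemma rmeas_rect (x : R) : rmeas (fun z => (if (`|re z| <= x) && (`|im z| <= x) then 1 else 0)).
Proof.
pose S : set RM := `[- x, x]%classic.
have mS : measurable S by exact: measurable_itv.
rewrite /rmeas (_ : (fun p => _) = \1_(S `*` S)); last first.
  apply/funext => -[s t]; rewrite indicE /= !ler_norml.
  case: ifPn => [/andP[h1 h2]|h].
    by rewrite mem_set// /S /setX /= !in_itv.
  rewrite memNset// /S /setX /= !in_itv /= => -[h1 h2].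
  by move: h; rewrite h1 h2.
by apply: measurable_indic; exact: measurableX.
Qed.

(** A square around the disc gives finiteness, and a square inside gives positivity in [discE0_ge];
    no more is asked of the area. *)
Lemma discE_le n : (discE n <= 4%:E)%E.
Proof.
have := @aint_rect 1 ltr01; rewrite mulr1 (_ : 2 ^+ 2 = 4); last by rewrite -natrX.
move=> <-; apply: aint_le.
- by apply: rmeas_cmeas; exact: rmeas_disc_fun.
- by apply: rmeas_cmeas; exact: rmeas_rect.
- by move=> z; rewrite lee_fin disc_fun_ge0.
- move=> z; rewrite lee_fin /disc_fun; case: ifPn => h; last by case: ifP.
  by rewrite (le_trans (cmod_Re z) h) (le_trans (cmod_Im z) h)/= exprn_ile1 ?cmod_ge0.
Qed.

Lemma discE0_ge : (1%:E <= discE 0)%E.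
Proof.
have := @aint_rect 2^-1; rewrite mulfV// expr1n => <-; last by rewrite invr_gt0.
apply: aint_le.
- by apply: rmeas_cmeas; exact: rmeas_rect.
- by apply: rmeas_cmeas; exact: rmeas_disc_fun.
- by move=> z; rewrite lee_fin; case: ifP.
- move=> z; rewrite lee_fin /disc_fun muln0 expr0; case: ifPn => [/andP[h1 h2]|_]; last by case: ifP.
  rewrite ifT//; apply: le_trans (cmod_le_ReIm z) _; lra.
Qed.

Definition disc n : R := fine (discE n).

Lemma discEE n : discE n = (disc n)%:E.
Proof.
rewrite /disc fineK// fin_numElt (le_lt_trans (discE_le n)) ?ltry// andbT.
by rewrite (lt_le_trans (ltNyr 0))//; apply: aint_ge0 => z; rewrite lee_fin disc_fun_ge0.
Qed.

Lemma disc_ge0 n : 0 <= disc n.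
Proof. by rewrite -lee_fin -discEE; apply: aint_ge0 => z; rewrite lee_fin disc_fun_ge0. Qed.

Lemma disc0_ge1 : 1 <= disc 0.
Proof. by rewrite -lee_fin -discEE discE0_ge. Qed.

Lemma aint_homog (u : R -> R) (n : nat) (r : R) : 0 < r -> rmeas (fun z => u (cmod z)) ->
  (forall s, 0 <= s -> 0 <= u s) ->
  aint (fun z => (cmod z ^+ (2 * n) * u (cmod z / r))%:E) =
  ((r ^+ (2 * n.+1))%:E * aint (fun z => (cmod z ^+ (2 * n) * u (cmod z))%:E))%E.
Proof.
move=> r0 mu u0.
have mv : rmeas (fun z => cmod z ^+ (2 * n) * u (cmod z / r)).
  apply: rmeasM; first exact: rmeas_cmodX.
  have := rmeas_mul (r^-1)%:C mu; rewrite (_ : (fun z => _) = (fun z => u (cmod z / r)))//.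
  by apply/funext => z; rewrite cmodM cmodR gtr0_norm ?invr_gt0// mulrC.
rewrite (aint_scale r0 (rmeas_cmeas mv)); last first.
  move=> z; rewrite lee_fin mulr_ge0 ?exprn_ge0 ?cmod_ge0// u0// divr_ge0 ?cmod_ge0//; exact: ltW.
under aint_ext => z.
  rewrite cmodM cmodR gtr0_norm// [r * _]mulrC mulfK ?gt_eqF// exprMn [_ * r ^+ _]mulrC -mulrA EFinM.
  over.
rewrite /= aintZ; last 3 first.
- by apply: rmeas_cmeas; apply: rmeasM => //; exact: rmeas_cmodX.
- by move=> z; rewrite lee_fin mulr_ge0 ?exprn_ge0 ?cmod_ge0// u0 ?cmod_ge0.
- by rewrite exprn_ge0// ltW.
by rewrite muleA -EFinM -exprD mulnS.
Qed.

Lemma disc_scale n r : 0 < r ->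
  aint (fun z => (disc_fun n r z)%:E) = (r ^+ (2 * n.+1) * disc n)%:E.
Proof.
move=> r0; pose u (s : R) : R := if s <= 1 then 1 else 0.
have mu : rmeas (fun z => u (cmod z)) by apply: rmeas_disc => //; exact: rmeas_cst.
have u0 s : 0 <= s -> 0 <= u s by rewrite /u; case: ifP.
have E1 : (fun z => (disc_fun n r z)%:E) = (fun z => (cmod z ^+ (2 * n) * u (cmod z / r))%:E).
  apply/funext => z; rewrite /disc_fun /u ler_pdivrMr// mul1r; congr EFin.
  by case: ifP; rewrite ?mulr1 ?mulr0.
have E2 : (fun z => (disc_fun n 1 z)%:E) = (fun z => (cmod z ^+ (2 * n) * u (cmod z))%:E).
  by apply/funext => z; rewrite /disc_fun /u; congr EFin; case: ifP; rewrite ?mulr1 ?mulr0.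
by rewrite E1 aint_homog// -E2 -/(discE n) discEE EFinM.
Qed.

(* Splitting the disc by a circle of radius r pins down the n-th moment up to o(1) as r -> 1. *)
Lemma disc_sandwich n (r : R) : 0 < r -> r < 1 ->
  r ^+ (2 * n) * (disc 0 * (1 - r ^+ 2)) <= disc n * (1 - r ^+ (2 * n.+1)) <= disc 0 * (1 - r ^+ 2).
Proof.
move=> r0 r1.
pose ann m z : R := if cmod z <= r then 0 else disc_fun m 1 z.
have annE m z : ann m z = disc_fun m 1 z - disc_fun m r z.
  rewrite /ann /disc_fun; case: ifPn => [h|_]; last by rewrite subr0.
  by rewrite (le_trans h (ltW r1)) subrr.
have mann m : rmeas (ann m).
  rewrite (_ : ann m = fun z => disc_fun m 1 z - disc_fun m r z); last by apply/funext => z; rewrite annE.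
  by apply: rmeasB; apply: rmeas_disc_fun => //; exact: ltW.
have ann0 m z : 0 <= ann m z by rewrite /ann; case: ifP => // _; exact: disc_fun_ge0.
have I m : aint (fun z => (ann m z)%:E) = (disc m * (1 - r ^+ (2 * m.+1)))%:E.
  have H : (aint (fun z => (ann m z)%:E) + aint (fun z => (disc_fun m r z)%:E) = discE m)%E.
    rewrite -aintD.
    - by apply: aint_ext => z; rewrite annE -EFinD subrK.
    - exact: rmeas_cmeas.
    - by apply: rmeas_cmeas; apply: rmeas_disc_fun; exact: ltW.
    - by move=> z; rewrite lee_fin.
    - by move=> z; rewrite lee_fin disc_fun_ge0.
  move: H; rewrite disc_scale// discEE.
  have : (0 <= aint (fun z => (ann m z)%:E))%E by apply: aint_ge0 => z; rewrite lee_fin.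
  by case: aint => [x _|//|//]; rewrite -EFinD => -[H]; congr EFin; apply: (addIr (r ^+ (2 * m.+1) * disc m)); rewrite H; ring.
have I0 := I 0%N; rewrite muln1 in I0.
apply/andP; split; rewrite -lee_fin -I.
  rewrite EFinM -I0 -aintZ; last 3 first.
  - exact: rmeas_cmeas.
  - by move=> z; rewrite lee_fin.
  - by rewrite exprn_ge0// ltW.
  apply: aint_le.
  - have : rmeas (fun z => r ^+ (2 * n) * ann 0%N z) by apply: rmeasM => //; exact: rmeas_cst.
    by move/rmeas_cmeas.
  - exact: rmeas_cmeas.
  - by move=> z; rewrite lee_fin mulr_ge0// exprn_ge0// ltW.
  - move=> z; rewrite -EFinM lee_fin /ann /disc_fun; case: ifPn => [_|]; first by rewrite mulr0.
    rewrite -ltNge => h; case: ifP => _; last by rewrite mulr0.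
    by rewrite muln0 expr0 mulr1 lerXn2r ?nnegrE ?cmod_ge0 ?(ltW r0)// ltW.
rewrite -I0; apply: aint_le.
- exact: rmeas_cmeas.
- exact: rmeas_cmeas.
- by move=> z; rewrite lee_fin.
- move=> z; rewrite lee_fin /ann /disc_fun; case: ifPn => // _; case: ifP => // h.
  by rewrite muln0 expr0 exprn_ile1 ?cmod_ge0.
Qed.

Lemma bernoulli (x : R) n : 0 <= x -> x <= 1 -> 1 - n%:R * (1 - x) <= x ^+ n.
Proof.
move=> x0 x1; elim: n => [|n IH]; first by rewrite mul0r subr0 expr0.
rewrite exprS -natr1; apply: le_trans (ler_wpM2l x0 IH).
rewrite -subr_ge0 (_ : _ - _ = n%:R * (1 - x) ^+ 2); last by ring.
by rewrite mulr_ge0 ?sqr_ge0.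
Qed.

(** Divided by [1 - r ^+ 2], the inequalities of [disc_sandwich] contain a geometric sum of [n.+1]
    terms that all tend to 1 with [r]. This gives the exact ratio of the moments without polar
    coordinates. *)
Lemma discM n : n.+1%:R * disc n = disc 0.
Proof.
pose K := disc 0; pose i := disc n; have K0 : 0 <= K by exact: disc_ge0.
have i0 : 0 <= i by exact: disc_ge0.
have key (r : R) : 0 < r -> r < 1 -> r ^+ (2 * n) * K <= n.+1%:R * i /\ n.+1%:R * i * r ^+ (2 * n) <= K.
  move=> r0 r1; have /andP[] := disc_sandwich n r0 r1.
  have x1 : 0 < 1 - r ^+ 2 by rewrite subr_gt0 exprn_ilt1// ltW.
  rewrite exprM [r ^+ (2 * n.+1)]exprM -/K -/i; set x := r ^+ 2 in x1 *.
  have x0 : 0 <= x by rewrite exprn_ge0// ltW.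
  have -> : 1 - x ^+ n.+1 = (1 - x) * \sum_(k < n.+1) x ^+ k.
    by rewrite -opprB subrX1 -mulNr opprB.
  have c1 c : \sum_(k < n.+1) c = n.+1%:R * c :> R by rewrite sumr_const card_ord mulr_natl.
  have s1 : \sum_(k < n.+1) x ^+ k <= n.+1%:R.
    rewrite -[leRHS]mulr1 -c1; apply: ler_sum => k _.
    by rewrite exprn_ile1//; lra.
  have s2 : n.+1%:R * x ^+ n <= \sum_(k < n.+1) x ^+ k.
    rewrite -c1; apply: ler_sum => k _.
    by rewrite ler_wiXn2l//; [lra|rewrite -ltnS].
  rewrite [i * _]mulrCA [K * _]mulrC [x ^+ n * _]mulrCA !ler_pM2l// => h1 h2; split.
    by apply: le_trans h1 _; rewrite mulrC ler_wpM2r.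
  by apply: le_trans h2; rewrite mulrAC mulrC ler_wpM2l.
have lim (A B : R) : 0 <= A -> (forall r : R, 0 < r -> r < 1 -> r ^+ (2 * n) * A <= B) -> A <= B.
  move=> A0 H; apply/ler_addgt0Pr => e e0.
  (* By Bernoulli's inequality the loss at [r = 1 - d] is at most [(2 * n)%:R * d * A <= e]. *)
  pose d := Num.min 2^-1 (e / ((2 * n)%:R * A + 1)).
  have D0 : 0 < (2 * n)%:R * A + 1 by rewrite ltr_wpDl// mulr_ge0.
  have d0 : 0 < d by rewrite lt_min invr_gt0 ltr0n/= divr_gt0.
  have d1 : d <= 2^-1 by rewrite ge_min lexx.
  have d2 : d * ((2 * n)%:R * A + 1) <= e by rewrite -ler_pdivlMr// ge_min lexx orbT.
  have r0 : 0 < 1 - d by lra.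
  have r1 : 1 - d < 1 by lra.
  have hB := H _ r0 r1.
  have := @bernoulli (1 - d) (2 * n) (ltW r0) (ltW r1); rewrite opprB addrCA subrr addr0 => hb.
  have := ler_wpM2r A0 hb; nra.
apply/eqP; rewrite eq_le; apply/andP; split; apply: lim => //.
- by rewrite mulr_ge0.
- by move=> r r0 r1; have [_] := key r r0 r1; rewrite mulrC.
- by move=> r r0 r1; have [] := key r r0 r1.
Qed.

(** A continuous decreasing substitute for the indicator of the unit interval. The even exponent
    makes it a polynomial in the square of the modulus inside the disc, so its moments are
    differences of disc moments. *)
Definition tent M (s : R) : R := if s <= 1 then 1 - s ^+ (2 * M) else 0.

Lemma tent_ge0 M s : 0 <= s -> 0 <= tent M s.
Proof. by move=> s0; rewrite /tent; case: ifP => // s1; rewrite subr_ge0 exprn_ile1. Qed.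

Lemma rmeas_tent M : rmeas (fun z => tent M (cmod z)).
Proof. by apply: rmeas_disc => //; apply: rmeasB; [exact: rmeas_cst|exact: rmeas_cmodX]. Qed.

Lemma tent_moment n M : aint (fun z => (cmod z ^+ (2 * n) * tent M (cmod z))%:E) =
  (disc n - disc (n + M))%:E.
Proof.
have t0 z : 0 <= cmod z ^+ (2 * n) * tent M (cmod z).
  by rewrite mulr_ge0 ?exprn_ge0 ?tent_ge0 ?cmod_ge0.
have H : (aint (fun z => (cmod z ^+ (2 * n) * tent M (cmod z))%:E) + discE (n + M) = discE n)%E.
  rewrite -aintD.
  - apply: aint_ext => z; rewrite -EFinD /tent /disc_fun; congr EFin; case: ifP => _; last by rewrite mulr0 addr0.
    by rewrite mulnDr exprD; ring.
  - by apply: rmeas_cmeas; apply: rmeasM; [exact: rmeas_cmodX|exact: rmeas_tent].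
  - by apply: rmeas_cmeas; exact: rmeas_disc_fun.
  - by move=> z; rewrite lee_fin.
  - by move=> z; rewrite lee_fin disc_fun_ge0.
move: H; rewrite !discEE.
have : (0 <= aint (fun z => (cmod z ^+ (2 * n) * tent M (cmod z))%:E))%E by apply: aint_ge0 => z; rewrite lee_fin.
by case: aint => [x _|//|//]; rewrite -EFinD => -[H]; congr EFin; rewrite -H; ring.
Qed.

Lemma scaled_tent_moment n M (r : R) : 0 < r ->
  aint (fun z => (cmod z ^+ (2 * n) * tent M (cmod z / r))%:E) =
  (r ^+ (2 * n.+1) * (disc n - disc (n + M)))%:E.
Proof.
move=> r0; rewrite aint_homog//; [|exact: rmeas_tent|exact: tent_ge0].
by rewrite tent_moment EFinM.
Qed.

End disc_moments.

Lemma sum_ord_cst (R : pzRingType) (m : nat) (c : R) : \sum_(k < m) c = m%:R * c.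
Proof. by rewrite sumr_const card_ord mulr_natl. Qed.

(** * Parseval for radial weights *)

Section parseval.
Variable R : realType.
Local Notation re := complex.Re.
Local Notation im := complex.Im.
Implicit Types (z : R[i]) (f : R[i] -> R[i]) (a : nat -> R[i]).
Variable W : R[i] -> R.
Hypothesis W0 : forall z, 0 <= W z.
Hypothesis mW : rmeas W.
Hypothesis radW : forall w z, cmod w = 1 -> W (w * z) = W z.

Definition moment n : \bar R := aint (fun z => (cmod z ^+ (2 * n) * W z)%:E).

Definition wnorm f : \bar R := aint (fun z => (cmod (f z) ^+ 2 * W z)%:E).

Lemma wnorm_rot f a j k : powser f a -> (1 < j)%N ->
  wnorm (fun z => f (zeta R j ^+ k * z)) = wnorm f.
Proof.
move=> fa j1; have [m1 m2] := rmeas_powser fa.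
elim: k => [|k IH]; first by apply: aint_ext => z; rewrite expr0 mul1r.
rewrite -IH /wnorm; set g := fun z => (cmod (f (zeta R j ^+ k * z)) ^+ 2 * W z)%:E.
rewrite -[RHS](@aint_rot _ g (zeta R j)).
- apply: aint_ext => z; rewrite /g mulrA -exprSr radW ?cmod_zeta//.
- apply: rmeas_cmeas; apply: rmeasM => //.
  by apply: rmeas_cmod2; [exact: (rmeas_mul _ m1)|exact: (rmeas_mul _ m2)].
- by move=> z; rewrite lee_fin mulr_ge0 ?sqr_ge0.
- exact: cmod_zeta.
- exact: zeta_neqN1.
Qed.

(** The mean of the squared modulus over rotations of [z], in place of the mean over the whole
    circle. *)
Definition avg f j z : R := \sum_(k < 2 ^ j) cmod (f (zeta R j ^+ k * z)) ^+ 2 / 2 ^+ j.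

Lemma rmeas_avg f a j : powser f a -> rmeas (avg f j).
Proof.
move=> fa; have [m1 m2] := rmeas_powser fa.
apply: rmeas_sum => k; apply: rmeasM; last exact: rmeas_cst.
by apply: rmeas_cmod2; [exact: (rmeas_mul _ m1)|exact: (rmeas_mul _ m2)].
Qed.

Lemma avg_ge0 f j z : 0 <= avg f j z.
Proof. by apply: sumr_ge0 => k _; rewrite divr_ge0 ?sqr_ge0 ?exprn_ge0. Qed.

Lemma wnorm_avg f a j : powser f a -> (1 < j)%N ->
  aint (fun z => (avg f j z * W z)%:E) = wnorm f.
Proof.
move=> fa j1; have [m1 m2] := rmeas_powser fa.
have mk k : rmeas (fun z => cmod (f (zeta R j ^+ k * z)) ^+ 2 * W z).
  by apply: rmeasM => //; apply: rmeas_cmod2; [exact: (rmeas_mul _ m1)|exact: (rmeas_mul _ m2)].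
transitivity (aint (fun z => \sum_(k < 2 ^ j) ((2 ^+ j)^-1%:E * (cmod (f (zeta R j ^+ k * z)) ^+ 2 * W z)%:E)))%E.
  apply: aint_ext => z; rewrite /avg mulr_suml -sumEFin; apply: eq_bigr => k _.
  by rewrite -EFinM; congr EFin; ring.
have i0 : 0 <= (2 ^+ j)^-1 :> R by rewrite invr_ge0 exprn_ge0.
rewrite aint_sum; last 2 first.
- move=> k; have : rmeas (fun z => (2 ^+ j)^-1 * (cmod (f (zeta R j ^+ k * z)) ^+ 2 * W z)).
    by apply: rmeasM => //; exact: rmeas_cst.
  by move/rmeas_cmeas.
- by move=> k z; rewrite -EFinM lee_fin; apply: (mulr_ge0 i0); rewrite mulr_ge0 ?sqr_ge0.
rewrite (eq_bigr (fun=> (2 ^+ j)^-1%:E * wnorm f))%E; last first.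
  move=> k _; rewrite aintZ//; first by congr (_ * _)%E; exact: (wnorm_rot k fa j1).
  - by apply: rmeas_cmeas; exact: mk.
  - by move=> z; rewrite lee_fin mulr_ge0 ?sqr_ge0.
have w0 : (0 <= wnorm f)%E by apply: aint_ge0 => z; rewrite lee_fin mulr_ge0 ?sqr_ge0.
rewrite -ge0_sume_distrl; last by move=> k _; rewrite lee_fin.
by rewrite sumEFin sum_ord_cst natrX mulfV ?mul1e// expf_neq0.
Qed.

Lemma avg_poly a N j z : (N <= 2 ^ j)%N ->
  avg (fun x => \sum_(n < N) a n * x ^+ n) j z = \sum_(n < N) cmod (a n) ^+ 2 * cmod z ^+ (2 * n).
Proof.
move=> Nj; rewrite /avg -mulr_suml.
rewrite (eq_bigr (fun k : 'I_(2 ^ j) => cmod (\sum_(n < N) (a n * z ^+ n) * zeta R j ^+ (k * n)) ^+ 2)); last first.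
  move=> k _; congr (cmod _ ^+ 2); apply: eq_bigr => n _.
  by rewrite exprMn -exprM; ring.
rewrite (@discrete_parseval _ j N (fun n => a n * z ^+ n))// mulrAC mulfV ?expf_neq0// mul1r.
by apply: eq_bigr => n _; rewrite cmodM cmodX exprMn -exprM mulnC.
Qed.

(** For the j-th Taylor polynomial the average is exact, as [j <= 2 ^ j]. Replacing [f] by it
    changes the modulus by at most [M / 2 ^+ j], and the sum of the two moduli is at most
    [3 * M]. *)
Lemma avg_close f a z : powser f a -> exists C : R, forall j,
  `|avg f j z - \sum_(n < j) cmod (a n) ^+ 2 * cmod z ^+ (2 * n)| <= C / 2 ^+ j.
Proof.
move=> fa; have r0 : 0 < cmod z + 1 by rewrite ltr_wpDl ?cmod_ge0.
have [M M0 HM] := powser_half fa r0.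
exists (3 * M * M) => j; rewrite -(@avg_poly a j j z) ?(ltnW (ltn_expl _ _))// /avg -sumrB.
apply: le_trans (ler_norm_sum _ _ _) _.
have B (k : 'I_(2 ^ j)) : `|cmod (f (zeta R j ^+ k * z)) ^+ 2 / 2 ^+ j -
    cmod (\sum_(n < j) a n * (zeta R j ^+ k * z) ^+ n) ^+ 2 / 2 ^+ j| <= 3 * M * M / 2 ^+ j / 2 ^+ j.
  set w := _ * z; have wE : cmod w = cmod z by rewrite cmodM cmodX cmod_zeta expr1n mul1r.
  have wr : cmod w <= cmod z + 1 by rewrite wE lerDl.
  rewrite -mulrBl normrM [X in _ * X]ger0_norm ?invr_ge0 ?exprn_ge0// ler_wpM2r ?invr_ge0 ?exprn_ge0//.
  set P := \sum_(n < j) _; have h : cmod (f w - P) <= M / 2 ^+ j by exact: HM.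
  have fM : cmod (f w) <= M by have := HM 0%N w wr; rewrite big_ord0 subr0 expr0 divr1.
  have h2 : cmod P <= cmod (f w) + cmod (f w - P).
    by rewrite -{1}(subKr (f w) P); exact: cmodB.
  have h1 : cmod (f w) <= cmod P + cmod (f w - P).
    by rewrite -{1}(subrK P (f w)) addrC; exact: cmodD.
  have M2 : M / 2 ^+ j <= M by rewrite ler_piMr// invf_le1 ?exprn_gt0// exprn_ege1// ler1n.
  rewrite subr_sqr normrM -!mulrA; rewrite [3 * _]mulrCA !mulrA.
  have d : `|cmod (f w) - cmod P| <= M / 2 ^+ j by rewrite ler_norml; lra.
  have s : `|cmod (f w) + cmod P| <= 3 * M.
    by rewrite ger0_norm ?addr_ge0 ?cmod_ge0//; lra.
  apply: le_trans (ler_pM _ _ d s) _ => //.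
  by apply: le_of_eq; ring.
apply: le_trans (ler_sum _ (fun k _ => B k)) _.
rewrite sum_ord_cst natrX.
by apply: le_of_eq; field; rewrite expf_neq0.
Qed.

Lemma moment_ge0 n : (0 <= moment n)%E.
Proof. by apply: aint_ge0 => z; rewrite lee_fin mulr_ge0 ?exprn_ge0 ?cmod_ge0. Qed.

Lemma wnorm_poly a N : wnorm (fun x => \sum_(n < N) a n * x ^+ n) =
  (\sum_(n < N) (cmod (a n) ^+ 2)%:E * moment n)%E.
Proof.
rewrite -(@wnorm_avg _ _ N.+2 (powser_poly N a))//.
(* The order [N.+2] ensures both [N <= 2 ^ j] for the exact average and [1 < j] for the
   rotations. *)
have Nj : (N <= 2 ^ N.+2)%N by apply: ltnW; apply: ltn_trans (ltn_expl N.+2 _); rewrite // ltnS leqnSn.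
transitivity (aint (fun z => \sum_(n < N) ((cmod (a n) ^+ 2)%:E * (cmod z ^+ (2 * n) * W z)%:E)))%E.
  apply: aint_ext => z; rewrite avg_poly// mulr_suml -sumEFin.
  by apply: eq_bigr => k _; rewrite -EFinM mulrA.
have mk (k : nat) : rmeas (fun z => cmod z ^+ (2 * k) * W z) by apply: rmeasM => //; exact: rmeas_cmodX.
rewrite aint_sum; last 2 first.
- move=> k; have : rmeas (fun z => cmod (a k) ^+ 2 * (cmod z ^+ (2 * k) * W z)).
    by apply: rmeasM => //; exact: rmeas_cst.
  by move/rmeas_cmeas.
- by move=> k z; rewrite -EFinM lee_fin !mulr_ge0 ?sqr_ge0 ?exprn_ge0 ?cmod_ge0.
apply: eq_bigr => k _; rewrite aintZ//.
- exact: rmeas_cmeas.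
- by move=> z; rewrite lee_fin !mulr_ge0 ?sqr_ge0 ?exprn_ge0 ?cmod_ge0.
- exact: sqr_ge0.
Qed.

(** Fatou's lemma twice, so that no dominating function has to be found: applied to the Taylor
    polynomials, whose norms are the partial sums, it gives one inequality; applied to the averages
    of [f], which converge to the series and all have the integral [wnorm f], it gives the other. *)
Lemma parseval f a : powser f a ->
  wnorm f = (\sum_(n <oo) (cmod (a n) ^+ 2)%:E * moment n)%E.
Proof.
move=> fa; have [m1 m2] := rmeas_powser fa.
have term0 n : (0 <= (cmod (a n) ^+ 2)%:E * moment n)%E.
  by rewrite mule_ge0 ?lee_fin ?sqr_ge0 ?moment_ge0.
apply/eqP; rewrite eq_le; apply/andP; split.
  have := @aint_fatou R (fun N z => (cmod (\sum_(n < N) a n * z ^+ n) ^+ 2 * W z)%:E)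
    (fun z => (cmod (f z) ^+ 2 * W z)%:E).
  move=> /(_ _ _ _)/le_trans; apply.
  - move=> N; apply: rmeas_cmeas; apply: rmeasM => //.
    by have [? ?] := rmeas_poly_re a N; exact: rmeas_cmod2.
  - by move=> N z; rewrite lee_fin mulr_ge0 ?sqr_ge0.
  - move=> z; apply/cvg_EFin; first by near=> x.
    have [c1 c2] := powser_cvg z fa; rewrite /comp /=.
    apply: cvgM; last exact: cvg_cst.
    under eq_fun do rewrite sqr_cmod; rewrite sqr_cmod.
    by apply: cvgD; rewrite expr2; under eq_fun do rewrite expr2; apply: cvgM.
  under eq_fun do rewrite [aint _]wnorm_poly.
  rewrite is_cvg_limn_einfE; last first.
    by under eq_fun do rewrite -(big_mkord xpredT (fun n => (cmod (a n) ^+ 2)%:E * moment n)%E); exact: is_cvg_nneseries.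
  by under eq_fun do rewrite -(big_mkord xpredT (fun n => (cmod (a n) ^+ 2)%:E * moment n)%E).
have mk (k : nat) : rmeas (fun z => cmod z ^+ (2 * k) * W z) by apply: rmeasM => //; exact: rmeas_cmodX.
have mk2 (k : nat) : rmeas (fun z => cmod (a k) ^+ 2 * (cmod z ^+ (2 * k) * W z)).
  by apply: rmeasM => //; exact: rmeas_cst.
have k0 k z : 0 <= cmod (a k) ^+ 2 * (cmod z ^+ (2 * k) * W z).
  by rewrite !mulr_ge0 ?sqr_ge0 ?exprn_ge0 ?cmod_ge0.
have -> : (\sum_(n <oo) (cmod (a n) ^+ 2)%:E * moment n)%E =
    aint (fun z => \sum_(n <oo) (cmod (a n) ^+ 2 * (cmod z ^+ (2 * n) * W z))%:E)%E.
  rewrite aint_nneseries; last 2 first.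
  - by move=> k; exact: rmeas_cmeas.
  - by move=> k z; rewrite lee_fin.
  apply: eq_eseriesr => k _; rewrite /moment -aintZ//.
  - exact: rmeas_cmeas.
  - by move=> z; rewrite lee_fin !mulr_ge0 ?sqr_ge0 ?exprn_ge0 ?cmod_ge0.
  - exact: sqr_ge0.
(* The shift by 2 provides the condition [1 < j] of [wnorm_avg]. *)
have := @aint_fatou R (fun j z => (avg f j.+2 z * W z)%:E)
  (fun z => \sum_(n <oo) (cmod (a n) ^+ 2 * (cmod z ^+ (2 * n) * W z))%:E)%E.
move=> /(_ _ _ _)/le_trans; apply.
- by move=> j; apply: rmeas_cmeas; apply: rmeasM => //; exact: (rmeas_avg _ fa).
- by move=> j z; rewrite lee_fin mulr_ge0// avg_ge0.
- move=> z; have [C HC] := avg_close z fa.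
  pose T j := \sum_(n < j) cmod (a n) ^+ 2 * (cmod z ^+ (2 * n) * W z).
  have TE j : T j = (\sum_(n < j) cmod (a n) ^+ 2 * cmod z ^+ (2 * n)) * W z.
    by rewrite mulr_suml; apply: eq_bigr => n _; rewrite mulrA.
  have ATd j : `|avg f j z * W z - T j| <= C * W z / 2 ^+ j.
    rewrite TE -mulrBl normrM [`|W z|]ger0_norm// mulrAC ler_wpM2r//.
  have r0 : 0 < cmod z + 1 by rewrite ltr_wpDl ?cmod_ge0.
  have [M M0 HM] := powser_half fa r0.
  have avgM j : avg f j z <= M ^+ 2.
    apply: le_trans (_ : \sum_(k < 2 ^ j) M ^+ 2 / 2 ^+ j <= _).
      apply: ler_sum => k _; rewrite ler_wpM2r ?invr_ge0 ?exprn_ge0// lerXn2r ?nnegrE ?cmod_ge0//.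
      have := HM 0%N (zeta R j ^+ k * z); rewrite big_ord0 subr0 expr0 divr1; apply.
      by rewrite cmodM cmodX cmod_zeta expr1n mul1r lerDl.
    rewrite sum_ord_cst natrX mulrCA mulfV ?mulr1// expf_neq0//.
  have ndT : nondecreasing_seq T.
    by apply/nondecreasing_seqP => j; rewrite /T big_ord_recr /= lerDl.
  have C0 : 0 <= C by have := HC 0%N; rewrite expr0 divr1; apply: le_trans.
  have ubT : has_ubound (range T).
    exists (M ^+ 2 * W z + C * W z) => _ [j _ <-].
    have := ATd j; rewrite ler_norml => /andP[h _].
    have h2 : avg f j z * W z <= M ^+ 2 * W z by rewrite ler_wpM2r.
    have h3 : C * W z / 2 ^+ j <= C * W z.
      by rewrite ler_piMr ?mulr_ge0// invf_le1 ?exprn_gt0// exprn_ege1// ler1n.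
    lra.
  have cT := nondecreasing_is_cvgn ndT ubT.
  have -> : (\sum_(n <oo) (cmod (a n) ^+ 2 * (cmod z ^+ (2 * n) * W z))%:E)%E = (limn T)%:E.
    apply/cvg_lim => //; under eq_fun do rewrite sumEFin big_mkord.
    by apply: cvg_EFin; [near=> x|].
  have cA : (avg f j z * W z) @[j --> \oo] --> limn T.
    rewrite (_ : (fun j => _) = (fun j => (avg f j z * W z - T j) + T j)); last by apply/funext => j; rewrite subrK.
    rewrite -[limn T]add0r; apply: cvgD => //.
    by apply: (half_cvg (M := C * W z)) => j; rewrite subr0.
  apply: cvg_EFin; first by near=> x.
  by move: cA; rewrite -(cvg_shiftn 2) /=; under eq_fun do rewrite addn2.
under eq_fun do rewrite (wnorm_avg fa)//.
by have [-> _] := cvg_limn_einf_sup (cvg_cst (wnorm f)).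
Unshelve. all: by end_near. Qed.

End parseval.

(** * A weight with lacunary level radii *)

Section weight.
Variable R : realType.
Variable K : nat -> nat.
Hypothesis K0 : K 0 = 0%N.
Hypothesis Kgap : forall j, (K j + 4 * j.+1 + 13 <= K j.+1)%N.

Lemma K_lt i j : (i < j)%N -> (K i + 4 * j + 13 <= K j)%N.
Proof.
elim: j => // j IH; rewrite ltnS leq_eqVlt => /predU1P[->|/IH]; first exact: Kgap.
by have := Kgap j; lia.
Qed.

Lemma K_mono i j : (i <= j)%N -> (K i <= K j)%N.
Proof. by rewrite leq_eqVlt => /predU1P[->//|/K_lt]; lia. Qed.

Lemma K_inj : injective K.
Proof.
move=> i j E; case: (ltngtP i j) => // /K_lt; lia.
Qed.

Lemma K_ge j : (j <= K j)%N.
Proof. by case: j => // j; have := @K_lt 0 j.+1 isT; lia. Qed.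

Lemma level_ex k : exists j, (k < K j)%N.
Proof. by exists k.+1; exact: K_ge. Qed.

(* [level k] is the number of j with K j <= k. The coefficients [wcoef] of the
   tents are such that, as a function of k, the contribution [peak k n] of the
   k-th tent to the n-th moment increases up to k = K (block n) and decreases
   afterwards. *)
Definition level k := ex_minn (level_ex k).

Lemma levelE k j : (level k <= j)%N = (k < K j)%N.
Proof.
rewrite /level; case: ex_minnP => m km mmin; apply/idP/idP => [/K_mono|/mmin//].
exact: leq_trans.
Qed.

(** By [peak_step] the ratio of consecutive peaks is 2 to the power [2 * n.+1 - slope k], which
    compares [n.+1] with [2 ^ level k]. Because [slope k] is odd the exponent never vanishes, so the
    ratio is at least 2 or at most 1/2. *)
Definition slope k := ((2 ^ (level k).+1).-1)%N.
Definition dexp k := (\sum_(i < k) slope i)%N.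
Definition wcoef k : R := 2 ^- dexp k.
(** At [k = K (block n)] the level exceeds [block n], hence [n < wM k], and by [disc_diff_ge] the
    tent keeps at least half of the n-th moment of its disc. *)
Definition wM k := (2 ^ level k)%N.

Lemma wM_gt0 k : (0 < wM k)%N. Proof. by rewrite expn_gt0. Qed.

Lemma slope_gt0 k : (0 < slope k)%N.
Proof. by rewrite /slope expnS; have := wM_gt0 k; rewrite /wM; lia. Qed.

Lemma dexpS k : dexp k.+1 = (dexp k + slope k)%N.
Proof. by rewrite /dexp big_ord_recr. Qed.

Lemma dexp_ge k : (k <= dexp k)%N.
Proof. by elim: k => // k IH; rewrite dexpS; have := slope_gt0 k; lia. Qed.

Lemma wcoef_gt0 k : 0 < wcoef k. Proof. by rewrite invr_gt0 exprn_gt0. Qed.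

Lemma wcoef_le k : wcoef k <= 2 ^- k.
Proof. by rewrite lef_pV2 ?posrE ?exprn_gt0// ler_weXn2l ?ler1n ?dexp_ge. Qed.

Definition wterm k (r : R) := wcoef k * tent (wM k) (`|r| / 2 ^+ k).

Lemma tent_le1 M (s : R) : 0 <= s -> tent M s <= 1.
Proof. by move=> s0; rewrite /tent; case: ifP => // _; rewrite gerBl exprn_ge0. Qed.

Lemma scaled_ge0 k (r : R) : 0 <= `|r| / 2 ^+ k.
Proof. by rewrite divr_ge0 ?exprn_ge0. Qed.

Lemma wterm_ge0 k r : 0 <= wterm k r.
Proof. by rewrite mulr_ge0 ?tent_ge0 ?scaled_ge0// ltW// wcoef_gt0. Qed.

Lemma wterm_le k r : wterm k r <= 1 / 2 ^+ k.
Proof.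
rewrite mul1r; apply: le_trans (wcoef_le k); rewrite ler_piMr ?tent_le1 ?scaled_ge0//.
by rewrite ltW ?wcoef_gt0.
Qed.

Definition weight r := limn (fun N => \sum_(k < N) wterm k r).

Lemma weight_approx r N : `|weight r - \sum_(k < N) wterm k r| <= 2 / 2 ^+ N.
Proof.
have [|s sP] := @real_series_half R (fun k => wterm k r) 1.
  by move=> n; rewrite ger0_norm ?wterm_ge0// wterm_le.
rewrite /weight; have -> : limn (fun N => \sum_(k < N) wterm k r) = s.
  apply/cvg_lim => //; apply: (half_cvg (M := 2)) => n; rewrite distrC.
  by have := sP n; rewrite mulr1.
by have := sP N; rewrite mulr1.
Qed.

Lemma weight_cvg r : \sum_(k < N) wterm k r @[N --> \oo] --> weight r.
Proof. by apply: (half_cvg (M := 2)) => n; rewrite distrC weight_approx. Qed.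

Lemma tent_nonincreasing M (s t : R) : 0 <= s -> s <= t -> tent M t <= tent M s.
Proof.
move=> s0 st; rewrite /tent; case: ifPn => t1.
  by rewrite (le_trans st t1) lerB// lerXn2r ?nnegrE// (le_trans s0).
by case: ifPn => // s1; rewrite subr_ge0 exprn_ile1.
Qed.

Lemma tent_decreasing M (s t : R) : (0 < M)%N -> 0 <= s -> s < t -> s < 1 -> tent M t < tent M s.
Proof.
move=> M0 s0 st s1; rewrite /tent (ltW s1); case: ifPn => t1.
  by rewrite ltrD2l ltrN2 ltrXn2r ?nnegrE ?(le_trans s0 (ltW st))// muln_eq0/= -lt0n.
by rewrite subr_gt0 exprn_ilt1// muln_eq0/= -lt0n.
Qed.

(* The increment of a series with nonnegative increments dominates any single one. *)
Lemma weight_diff_ge (r t d : R) k : (forall i, wterm i t <= wterm i r) ->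
  d <= wterm k r - wterm k t -> d <= weight r - weight t.
Proof.
move=> H hd; apply/ler_addgt0Pr => e e0; have [N hN] := half_to0 4 e0.
have h1 := weight_approx r (k.+1 + N); have h2 := weight_approx t (k.+1 + N).
have hh : 2 / 2 ^+ (k.+1 + N) <= 2 / 2 ^+ N :> R.
  by rewrite ler_wpM2l// lef_pV2 ?posrE ?exprn_gt0// ler_weXn2l ?ler1n ?leq_addl.
have : wterm k r - wterm k t <= \sum_(i < k.+1 + N) wterm i r - \sum_(i < k.+1 + N) wterm i t.
  have kN : (k < k.+1 + N)%N by rewrite leq_addr.
  rewrite -sumrB (bigD1 (Ordinal kN))//= lerDl; apply: sumr_ge0 => i _.
  by rewrite subr_ge0.
move: h1 h2; rewrite !ler_norml; lra.
Qed.

Lemma weight_ge_term r k : wterm k r <= weight r.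
Proof.
have w0 : weight r - (weight r - weight r) = weight r by rewrite subrr subr0.
apply/ler_addgt0Pr => e e0; have [N hN] := half_to0 2 e0.
have h1 := weight_approx r (k.+1 + N).
have hh : 2 / 2 ^+ (k.+1 + N) <= 2 / 2 ^+ N :> R.
  by rewrite ler_wpM2l// lef_pV2 ?posrE ?exprn_gt0// ler_weXn2l ?ler1n ?leq_addl.
have : wterm k r <= \sum_(i < k.+1 + N) wterm i r.
  have kN : (k < k.+1 + N)%N by rewrite leq_addr.
  rewrite (bigD1 (Ordinal kN))//= lerDl; apply: sumr_ge0 => i _.
  exact: wterm_ge0.
move: h1; rewrite !ler_norml; lra.
Qed.

Lemma scale_large (r : R) : exists k, `|r| / 2 ^+ k < 1.
Proof. exact: half_to0. Qed.

Lemma weight_gt0 r : 0 < weight r.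
Proof.
have [k hk] := scale_large r; apply: lt_le_trans (weight_ge_term r k).
rewrite mulr_gt0 ?wcoef_gt0// /tent (ltW hk) subr_gt0 exprn_ilt1 ?scaled_ge0//.
by rewrite muln_eq0/= -lt0n wM_gt0.
Qed.

(** No tent increases, and one whose disc contains [r] in its interior decreases strictly. *)
Lemma weight_decreasing (r t : R) : 0 <= r -> r < t -> weight t < weight r.
Proof.
move=> r0 rt; have [k hk] := scale_large r; have t0 : 0 <= t by lra.
have rtn : `|r| < `|t| by rewrite !ger0_norm.
rewrite -subr_gt0; apply: lt_le_trans (_ : wterm k r - wterm k t <= _).
  rewrite subr_gt0 ltr_pM2l ?wcoef_gt0//; apply: tent_decreasing; rewrite ?scaled_ge0 ?wM_gt0//.
  by rewrite ltr_pM2r// invr_gt0 exprn_gt0.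
apply: (@weight_diff_ge r t _ k) => // i.
rewrite ler_pM2l ?wcoef_gt0// tent_nonincreasing ?scaled_ge0//.
by rewrite ler_pM2r ?invr_gt0 ?exprn_gt0// ltW.
Qed.

(** Beyond radius [2 ^+ m] the first [m] tents vanish and only the tail of the series remains. *)
Lemma weight_le r m : 2 ^+ m <= `|r| -> weight r <= 2 / 2 ^+ m.
Proof.
move=> hr; have := weight_approx r m; rewrite big1 ?subr0; last first.
  move=> k _; rewrite /wterm /tent; case: ifPn => [|_]; last by rewrite mulr0.
  rewrite ler_pdivrMr ?exprn_gt0// mul1r => h; have := le_trans hr h.
  by rewrite ler_eXn2l ?ltr1n// leqNgt ltn_ord.
by rewrite ler_norml => /andP[_].
Qed.

(** The next tent alone suffices: its argument is at most 1/2, where the tent is at least 1/2. *)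
Lemma weight_ge (r : R) k : `|r| <= 2 ^+ k -> wcoef k.+1 / 2 <= weight r.
Proof.
move=> hr; apply: le_trans (weight_ge_term r k.+1); rewrite ler_pM2l ?wcoef_gt0//.
have h : `|r| / 2 ^+ k.+1 <= 2^-1.
  by rewrite exprS ler_pdivrMr ?mulr_gt0 ?exprn_gt0// mulKf.
have h0 := scaled_ge0 k.+1 r.
rewrite /tent ifT; last by lra.
have : (`|r| / 2 ^+ k.+1) ^+ (2 * wM k.+1) <= `|r| / 2 ^+ k.+1.
  rewrite -[leRHS]expr1 ler_wiXn2l//; last by have := wM_gt0 k.+1; lia.
  by lra.
lra.
Qed.

Lemma wterm_continuous k : continuous (wterm k).
Proof.
(* As a maximum with 0 the tent is visibly continuous at the edge of its disc, and the even power
   removes the absolute value. *)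
have -> : wterm k = fun r => wcoef k * Num.max 0 (1 - (r / 2 ^+ k) ^+ (2 * wM k)).
  apply/funext => r; congr (_ * _); rewrite /tent.
  have E : (r / 2 ^+ k) ^+ (2 * wM k) = (`|r| / 2 ^+ k) ^+ (2 * wM k).
    by rewrite !exprM -[in LHS]real_normK ?num_real// normrM normfV [`|2 ^+ k|]ger0_norm ?exprn_ge0.
  rewrite E; case: ifPn => [h|]; first by rewrite max_r// subr_ge0 exprn_ile1 ?scaled_ge0.
  rewrite -ltNge => h; rewrite max_l// subr_le0 exprn_ege1// ltW//.
move=> r; apply: cvgM; first exact: cvg_cst.
apply: (@continuous_max R R (cst 0) (fun s => 1 - (s / 2 ^+ k) ^+ (2 * wM k)) r); first exact: cvg_cst.
apply: cvgB; first exact: cvg_cst.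
have c1 : {for r, continuous (fun s : R => s / 2 ^+ k)}.
  by apply: cvgM; [exact: cvg_id|exact: cvg_cst].
exact: (continuous_comp c1 (@exprn_continuous R (2 * wM k) (r / 2 ^+ k))).
Qed.

Lemma weight_continuous : continuous weight.
Proof.
have cP N : continuous (fun r => \sum_(k < N) wterm k r).
  elim: N => [|N IH] r.
    by under eq_fun do rewrite big_ord0; exact: cvg_cst.
  by under eq_fun do rewrite big_ord_recr /=; apply: cvgD; [exact: IH|exact: wterm_continuous].
move=> r; apply/cvgrPdist_lt => e e0.
have e3 : 0 < e / 3 by lra.
have [N hN] := half_to0 2 e3.
have /cvgrPdist_lt/(_ _ e3) := cP N r; apply: filterS => t ht.
have h1 := weight_approx r N; have h2 := weight_approx t N.
by move: ht h1 h2; rewrite !ltr_norml !ler_norml; lra.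
Qed.

Lemma rmeas_weight : rmeas (fun z : R[i] => weight (cmod z)).
Proof.
have mk k : rmeas (fun z : R[i] => wterm k (cmod z)).
  have m : rmeas (fun z : R[i] => tent (wM k) (cmod z)) by exact: rmeas_tent.
  have := rmeas_mul ((2 ^+ k)^-1)%:C m.
  move=> {}m; have : rmeas (fun z : R[i] => wcoef k * tent (wM k) (cmod (((2 ^+ k)^-1)%:C * z))).
    by apply: rmeasM => //; exact: rmeas_cst.
  rewrite (_ : (fun z => _) = (fun z : R[i] => wterm k (cmod z)))//.
  apply/funext => z; rewrite /wterm cmodM cmodR !ger0_norm ?invr_ge0 ?exprn_ge0 ?cmod_ge0//.
  by congr (_ * tent _ _); rewrite mulrC.
apply: (rmeas_cvg (F := fun N z => \sum_(k < N) wterm k (cmod z))) => [N|z].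
  by apply: rmeas_sum => i; exact: mk.
exact: weight_cvg.
Qed.

Definition peak k n : R := wcoef k * (2 ^+ k) ^+ (2 * n.+1).

Lemma peakE k n : peak k n = wcoef k * (2 ^+ k) ^+ (2 * n.+1).
Proof. by []. Qed.

Lemma peak_gt0 k n : 0 < peak k n.
Proof. by rewrite mulr_gt0 ?wcoef_gt0 ?exprn_gt0. Qed.

Local Notation W := (fun z : R[i] => weight (cmod z)).

Lemma moment_series n :
  moment W n = (\sum_(k <oo) (peak k n * (disc R n - disc R (n + wM k)))%:E)%E.
Proof.
have EF r : (weight r)%:E = (\sum_(k <oo) (wterm k r)%:E)%E.
  apply/esym/cvg_lim => //; under eq_fun do rewrite sumEFin big_mkord.
  by apply: cvg_EFin; [near=> x|exact: weight_cvg].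
have mk k : rmeas (fun z : R[i] => tent (wM k) (cmod z / 2 ^+ k)).
  have m : rmeas (fun z : R[i] => tent (wM k) (cmod z)) by exact: rmeas_tent.
  have := rmeas_mul ((2 ^+ k)^-1)%:C m.
  rewrite (_ : (fun z => _) = (fun z : R[i] => tent (wM k) (cmod z / 2 ^+ k)))//.
  by apply/funext => z; rewrite cmodM cmodR ger0_norm ?invr_ge0 ?exprn_ge0// mulrC.
have mk2 k : rmeas (fun z : R[i] => cmod z ^+ (2 * n) * tent (wM k) (cmod z / 2 ^+ k)).
  by apply: rmeasM => //; exact: rmeas_cmodX.
have t0 k z : 0 <= cmod z ^+ (2 * n) * tent (wM k) (cmod z / 2 ^+ k) :> R.
  by rewrite mulr_ge0 ?exprn_ge0 ?cmod_ge0// tent_ge0// divr_ge0 ?cmod_ge0 ?exprn_ge0.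
rewrite /moment (@aint_ext R _ (fun z => \sum_(k <oo)
  ((wcoef k)%:E * (cmod z ^+ (2 * n) * tent (wM k) (cmod z / 2 ^+ k))%:E))%E); last first.
  move=> z; rewrite EFinM EF -nneseriesZl; last by move=> i _; rewrite lee_fin wterm_ge0.
  apply: eq_eseriesr => k _; rewrite /wterm ger0_norm ?cmod_ge0// -!EFinM; congr EFin; ring.
rewrite aint_nneseries.
- apply: eq_eseriesr => k _; rewrite aintZ.
  + by rewrite scaled_tent_moment ?exprn_gt0// -EFinM /peak mulrA.
  + exact: rmeas_cmeas.
  + by move=> z; rewrite lee_fin.
  + by rewrite ltW ?wcoef_gt0.
- move=> k; have : rmeas (fun z : R[i] => wcoef k * (cmod z ^+ (2 * n) * tent (wM k) (cmod z / 2 ^+ k))).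
    by apply: rmeasM => //; exact: rmeas_cst.
  by move/rmeas_cmeas.
- by move=> k z; rewrite -EFinM lee_fin mulr_ge0// ltW ?wcoef_gt0.
Unshelve. all: by end_near. Qed.

(** The area pi of the unit disc; its positivity is all that matters. *)
Definition kappa : R := disc R 0.

Lemma kappa_gt0 : 0 < kappa. Proof. exact: lt_le_trans (disc0_ge1 R). Qed.

Lemma disc_kappa n : disc R n = kappa / n.+1%:R.
Proof. by rewrite /kappa -(discM R n) mulrAC mulfV ?mul1r// pnatr_eq0. Qed.

Lemma disc_diff_le n M : 0 <= disc R n - disc R (n + M) <= kappa / n.+1%:R.
Proof.
rewrite !disc_kappa subr_ge0 gerBl divr_ge0 ?(ltW kappa_gt0)// andbT.
by rewrite ler_pM2l ?kappa_gt0// lef_pV2 ?posrE// ler_nat ltnS leq_addr.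
Qed.

Lemma disc_diff_ge n M : (n < M)%N -> kappa / (2 * n.+1%:R) <= disc R n - disc R (n + M).
Proof.
move=> nM; rewrite !disc_kappa -mulrBr ler_pM2l ?kappa_gt0// lerBrDr.
apply: le_trans (_ : (2 * n.+1%:R)^-1 + (2 * n.+1%:R)^-1 <= _).
  by rewrite lerD2l lef_pV2 ?posrE ?mulr_gt0// -natrM ler_nat; lia.
have : n.+1%:R != 0 :> R by rewrite pnatr_eq0.
by set x := n.+1%:R => x0; apply: le_of_eq; field.
Qed.

Definition block n := trunc_log 2 n.+1.

Lemma blockP n : (2 ^ block n <= n.+1 < 2 ^ (block n).+1)%N.
Proof. exact: trunc_log_bounds. Qed.

Lemma block_eq n j : (2 ^ j <= n.+1 < 2 ^ j.+1)%N -> block n = j.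
Proof. by move=> /(@trunc_log_eq 2); exact. Qed.

Lemma peak_step n k : peak k.+1 n * 2 ^+ slope k = peak k n * 2 ^+ (2 * n.+1).
Proof.
rewrite /peak /wcoef dexpS exprD exprS exprMn; field.
by rewrite !expf_neq0.
Qed.

Lemma peak_up n k : (k < K (block n))%N -> 2 * peak k n <= peak k.+1 n.
Proof.
rewrite -levelE => h; have e : (slope k).+1 = (2 ^ (level k).+1)%N.
  by rewrite /slope prednK ?expn_gt0.
have h2 : ((slope k).+1 <= 2 * n.+1)%N.
  rewrite e expnS leq_mul2l /=; apply: leq_trans (proj1 (andP (blockP n))).
  by rewrite leq_pexp2l.
rewrite -(@ler_pM2r _ (2 ^+ slope k)) ?exprn_gt0// peak_step mulrAC [leLHS]mulrC ler_pM2l ?peak_gt0//.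
by rewrite -exprS ler_weXn2l ?ler1n.
Qed.

Lemma peak_down n k : (K (block n) <= k)%N -> 2 * peak k.+1 n <= peak k n.
Proof.
rewrite leqNgt -levelE -ltnNge => h; have e : (slope k).+1 = (2 ^ (level k).+1)%N.
  by rewrite /slope prednK ?expn_gt0.
have h2 : ((2 * n.+1).+1 <= slope k)%N.
  rewrite -ltnS e; apply: leq_trans (_ : 2 * 2 ^ (block n).+1 <= _)%N.
    by have /andP[_] := blockP n; lia.
  by rewrite -expnS leq_pexp2l.
rewrite -(@ler_pM2r _ (2 ^+ slope k)) ?exprn_gt0// -mulrA peak_step mulrCA ler_pM2l ?peak_gt0//.
by rewrite -exprS ler_weXn2l ?ler1n.
Qed.

Lemma peak_far_up n k d : (k + d = K (block n))%N -> 2 ^+ d * peak k n <= peak (K (block n)) n.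
Proof.
elim: d k => [|d IH] k E; first by rewrite expr0 mul1r -E addn0.
have h : (k.+1 + d = K (block n))%N by rewrite -E addSnnS.
apply: le_trans (IH _ h); rewrite exprSr -mulrA ler_pM2l ?exprn_gt0//.
by apply: peak_up; rewrite -E; lia.
Qed.

Lemma peak_far_down n d : 2 ^+ d * peak (K (block n) + d)%N n <= peak (K (block n)) n.
Proof.
elim: d => [|d IH]; first by rewrite expr0 mul1r addn0.
apply: le_trans IH; rewrite exprSr -mulrA ler_pM2l ?exprn_gt0// addnS.
by apply: peak_down; rewrite leq_addr.
Qed.

Lemma peak_max n k : peak k n <= peak (K (block n)) n.
Proof.
have [h|h] := leqP (K (block n)) k.
  have := peak_far_down n (k - K (block n)); rewrite subnKC//; apply: le_trans.
  by rewrite ler_peMl ?(ltW (peak_gt0 _ _))// exprn_ege1// ler1n.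
have := @peak_far_up n k (K (block n) - k); rewrite subnKC ?(ltnW h)// => /(_ erefl); apply: le_trans.
by rewrite ler_peMl ?(ltW (peak_gt0 _ _))// exprn_ege1// ler1n.
Qed.

Lemma half_sum (N : nat) : \sum_(i < N) (2 ^- i : R) <= 2.
Proof.
suff : \sum_(i < N) (2 ^- i : R) <= 2 - 2 * 2 ^- N.
  by move=> /le_trans; apply; rewrite gerBl mulr_ge0// invr_ge0 exprn_ge0.
elim: N => [|N IH]; first by rewrite big_ord0 expr0 invr1 mulr1 subrr.
rewrite big_ord_recr /= exprS invfM; lra.
Qed.

(** The peaks decay geometrically with ratio 1/2 on either side of the maximum, so each side
    contributes at most twice the maximum. *)
Lemma peak_sum n N : \sum_(k < N) peak k n <= 4 * peak (K (block n)) n.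
Proof.
set j := K (block n); set p := peak j n.
have p0 : 0 <= p by rewrite ltW ?peak_gt0.
have sub : \sum_(k < N) peak k n <= \sum_(k < j + N) peak k n.
  rewrite [leRHS](eq_bigl xpredT)//.
  rewrite -[in leRHS](big_mkord xpredT (fun k => peak k n)) -(big_mkord xpredT (fun k => peak k n)).
  rewrite (@big_cat_nat _ _ _ N 0 (j + N))//= ?leq_addl// lerDl.
  by apply: sumr_ge0 => i _; rewrite ltW ?peak_gt0.
apply: le_trans sub _; rewrite big_split_ord /=.
apply: le_trans (lerD (_ : _ <= 2 * p) (_ : _ <= 2 * p)) _; last by lra.
  rewrite (reindex_inj rev_ord_inj) /=.
  apply: le_trans (_ : \sum_(i < j) 2 ^- i * p <= _).
    apply: ler_sum => i _.
    have E : ((j - i.+1) + i.+1 = K (block n))%N by rewrite subnK.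
    have := peak_far_up E; rewrite -/p => h.
    rewrite mulrC ler_pdivlMr ?exprn_gt0// mulrC; apply: le_trans h.
    by rewrite ler_pM2r ?peak_gt0// ler_weXn2l ?ler1n.
  by rewrite -mulr_suml ler_wpM2r ?half_sum.
apply: le_trans (_ : \sum_(i < N) 2 ^- i * p <= _); last by rewrite -mulr_suml ler_wpM2r ?half_sum.
apply: ler_sum => i _; rewrite mulrC ler_pdivlMr ?exprn_gt0// mulrC.
exact: peak_far_down.
Qed.

Lemma moment_le n : (moment W n <= (4 * peak (K (block n)) n * (kappa / n.+1%:R))%:E)%E.
Proof.
rewrite moment_series; apply: lime_le.
  by apply: is_cvg_nneseries => k _ _; rewrite lee_fin mulr_ge0 ?(ltW (peak_gt0 _ _))//; have /andP[] := disc_diff_le n (wM k).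
near=> N; rewrite sumEFin lee_fin big_mkord.
apply: le_trans (_ : \sum_(k < N) peak k n * (kappa / n.+1%:R) <= _).
  apply: ler_sum => k _; rewrite ler_pM2l ?peak_gt0//.
  by have /andP[] := disc_diff_le n (wM k).
by rewrite -mulr_suml ler_wpM2r ?peak_sum// divr_ge0 ?(ltW kappa_gt0).
Unshelve. all: by end_near. Qed.

Lemma moment_ge n : ((peak (K (block n)) n * (kappa / (2 * n.+1%:R)))%:E <= moment W n)%E.
Proof.
set k := K (block n).
have lM : (n < wM k)%N.
  have /andP[_] := blockP n; rewrite /wM => /ltnW h.
  apply: leq_trans h _; rewrite leq_pexp2l// ltnNge levelE -/k ltnn//.
apply: le_trans (_ : (peak k n * (disc R n - disc R (n + wM k)))%:E <= _)%E.
  by rewrite lee_fin ler_pM2l ?peak_gt0// disc_diff_ge.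
rewrite moment_series; apply: le_trans (nneseries_lim_ge k.+1 _).
  rewrite big_nat_recr //= leeDr// sume_ge0// => i _.
  by rewrite lee_fin mulr_ge0 ?(ltW (peak_gt0 _ _))//; have /andP[] := disc_diff_le n (wM i).
by move=> i _; rewrite lee_fin mulr_ge0 ?(ltW (peak_gt0 _ _))//; have /andP[] := disc_diff_le n (wM i).
Qed.

End weight.

(** * Fock spaces of radial weights *)

Section fock_coefficients.
Variable R : realType.
Local Notation RM := (measurableTypeR R).
Local Notation re := complex.Re.
Local Notation im := complex.Im.
Implicit Types (z l : R[i]) (f g : R[i] -> R[i]) (a b : nat -> R[i]).
Variables (h : R -> R) (W : R[i] -> R) (v : nat -> R).
Hypothesis WE : forall z, expR (- h (cmod z)) = W z.
Hypothesis mW : rmeas W.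
Hypothesis v_gt0 : forall n, 0 < v n.
Hypothesis vE : forall n, moment W n = (v n)%:E.
Hypothesis v_growth : forall r : R, 0 < r -> exists2 M : R, 0 < M & forall n, r ^+ n <= M * v n.

Let W0 z : 0 <= W z. Proof. by rewrite -WE expR_ge0. Qed.

Let radW w z : cmod w = 1 -> W (w * z) = W z.
Proof. by move=> w1; rewrite -!WE cmodM w1 mul1r. Qed.

Lemma fock_sqnorm_wnorm f : fock_sqnorm h f = wnorm W f.
Proof. by apply: eq_integral => p _; rewrite WE. Qed.

Lemma fock_sqnorm_series f a : powser f a ->
  fock_sqnorm h f = (\sum_(n <oo) (cmod (a n) ^+ 2 * v n)%:E)%E.
Proof.
move=> fa; rewrite fock_sqnorm_wnorm (parseval W0 mW radW fa).
by apply: eq_eseriesr => n _; rewrite vE EFinM.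
Qed.

Lemma fock_powser f : fock_space h f -> exists a, powser f a.
Proof. by move=> [/entireP + _]; exact: entire_powser. Qed.

Lemma entire_of_powser f a : powser f a -> entire f.
Proof. by move=> fa; apply/entireP => z; exact: (powser_entire fa). Qed.

Let t0 a n : 0 <= cmod (a n) ^+ 2 * v n.
Proof. by rewrite mulr_ge0 ?sqr_ge0// ltW. Qed.

Lemma fock_sqnorm_ge0 f : (0 <= fock_sqnorm h f)%E.
Proof. by apply: integral_ge0 => p _; rewrite lee_fin mulr_ge0 ?sqr_ge0 ?expR_ge0. Qed.

Lemma fock_normE f : fock_space h f -> fock_sqnorm h f = (fock_norm h f ^+ 2)%:E.
Proof.
move=> [_ ff]; rewrite /fock_norm sqr_sqrtr ?fine_ge0 ?fock_sqnorm_ge0// fineK//.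
by rewrite fin_numElt ff andbT (lt_le_trans (ltNyr 0))// fock_sqnorm_ge0.
Qed.

(** Together with [fock_partial] and [fock_cvg] this lets the later sections work with sums over
    coefficients instead of integrals. *)
Lemma fock_bounded f a (B : R) : powser f a ->
  (forall N, \sum_(n < N) cmod (a n) ^+ 2 * v n <= B) ->
  fock_space h f /\ fock_norm h f ^+ 2 <= B.
Proof.
move=> fa H.
have le : (fock_sqnorm h f <= B%:E)%E.
  rewrite (fock_sqnorm_series fa); apply: lime_le.
    by apply: is_cvg_nneseries => n _ _; rewrite lee_fin.
  by near=> N; rewrite sumEFin lee_fin big_mkord.
have ff : fock_space h f by split; [exact: entire_of_powser fa|exact: le_lt_trans le (ltry _)].
by split => //; rewrite -lee_fin -fock_normE.
Unshelve. all: by end_near. Qed.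

Lemma fock_partial f a N : powser f a -> fock_space h f ->
  \sum_(n < N) cmod (a n) ^+ 2 * v n <= fock_norm h f ^+ 2.
Proof.
move=> fa ff; rewrite -lee_fin -fock_normE// (fock_sqnorm_series fa).
apply: le_trans (nneseries_lim_ge N _); last by move=> i _; rewrite lee_fin.
by rewrite sumEFin big_mkord.
Qed.

Lemma fock_cvg f a : powser f a -> fock_space h f ->
  \sum_(n < N) cmod (a n) ^+ 2 * v n @[N --> \oo] --> fock_norm h f ^+ 2.
Proof.
move=> fa ff.
have nd : nondecreasing_seq (fun N => \sum_(n < N) cmod (a n) ^+ 2 * v n).
  by apply/nondecreasing_seqP => N; rewrite big_ord_recr lerDl.
have ub : has_ubound (range (fun N => \sum_(n < N) cmod (a n) ^+ 2 * v n)).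
  by exists (fock_norm h f ^+ 2) => _ [N _ <-]; exact: fock_partial.
have c := nondecreasing_is_cvgn nd ub.
suff -> : fock_norm h f ^+ 2 = limn (fun N => \sum_(n < N) cmod (a n) ^+ 2 * v n) by [].
apply: EFin_inj; rewrite -fock_normE// (fock_sqnorm_series fa); apply/cvg_lim => //.
under eq_fun do rewrite sumEFin big_mkord.
by apply: cvg_EFin; [near=> x|].
Unshelve. all: by end_near. Qed.

Lemma cmod_sqD z l : cmod (z + l) ^+ 2 <= 2 * cmod z ^+ 2 + 2 * cmod l ^+ 2.
Proof.
rewrite !sqr_cmod !ReImE.
by have := sqr_ge0 (re z - re l); have := sqr_ge0 (im z - im l); lra.
Qed.

Lemma cmod_sqD_ge z l : cmod z ^+ 2 / 2 - cmod l ^+ 2 <= cmod (z + l) ^+ 2.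
Proof.
rewrite !sqr_cmod !ReImE.
by have := sqr_ge0 (re z + 2 * re l); have := sqr_ge0 (im z + 2 * im l); lra.
Qed.

Lemma fockD f g : fock_space h f -> fock_space h g -> fock_space h (fun z => f z + g z).
Proof.
move=> ff fg; have [a fa] := fock_powser ff; have [b gb] := fock_powser fg.
apply: (proj1 (fock_bounded (B := 2 * fock_norm h f ^+ 2 + 2 * fock_norm h g ^+ 2) (powserD fa gb) _)).
move=> N; apply: le_trans (_ : \sum_(n < N) (2 * (cmod (a n) ^+ 2 * v n) + 2 * (cmod (b n) ^+ 2 * v n)) <= _).
  apply: ler_sum => n _; have := ler_wpM2r (ltW (v_gt0 n)) (cmod_sqD (a n) (b n)).
  by rewrite mulrDl !mulrA.
rewrite big_split /= -!mulr_sumr; apply: lerD; rewrite ler_wpM2l//; exact: fock_partial.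
Qed.

Lemma fockZ c f : fock_space h f -> fock_space h (fun z => c * f z).
Proof.
move=> ff; have [a fa] := fock_powser ff.
apply: (proj1 (fock_bounded (B := cmod c ^+ 2 * fock_norm h f ^+ 2) (powserZ c fa) _)).
move=> N; rewrite (eq_bigr (fun n : 'I_N => cmod c ^+ 2 * (cmod (a n) ^+ 2 * v n))).
  by rewrite -mulr_sumr ler_wpM2l ?sqr_ge0//; exact: fock_partial.
by move=> n _; rewrite cmodM exprMn mulrA.
Qed.

(** Monomials are orthogonal with squared norms [v n], so these are the Taylor coefficients of the
    reproducing kernel at [l]. *)
Definition kcoef l n : R[i] := conjc l ^+ n * ((v n)^-1)%:C.

Lemma v_inv_growth (r : R) : 0 < r -> exists2 M : R, 0 < M & forall n, r ^+ n / v n <= M / 2 ^+ n.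
Proof.
move=> r0; have r2 : 0 < 2 * r by lra.
have [M M0 HM] := v_growth r2; exists M => // n.
rewrite ler_pdivrMr ?v_gt0// mulrAC ler_pdivlMr ?exprn_gt0//.
by rewrite [leLHS]mulrC -exprMn; exact: HM.
Qed.

Lemma kcoefE l n : cmod (kcoef l n) ^+ 2 * v n = (cmod l ^+ 2) ^+ n / v n.
Proof.
rewrite /kcoef cmodM cmodX cmodJ cmodR ger0_norm ?invr_ge0 ?(ltW (v_gt0 n))//.
by rewrite exprMn -!exprM [(2 * n)%N]mulnC; field; rewrite gt_eqF.
Qed.

Lemma kcoef_decay l : decay (kcoef l).
Proof.
move=> r r0; have s0 : 0 < (cmod l + 1) * r by rewrite mulr_gt0// ltr_wpDl ?cmod_ge0.
have [M M0 HM] := v_inv_growth s0; exists M; first exact: ltW.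
move=> n; rewrite /kcoef cmodM cmodX cmodJ cmodR ger0_norm ?invr_ge0 ?(ltW (v_gt0 n))//.
rewrite mulrAC -exprMn; apply: le_trans (le_trans (HM n) _); last first.
  by rewrite ler_piMr ?(ltW M0)// invf_le1 ?exprn_gt0// exprn_ege1// ler1n.
rewrite ler_wpM2r ?invr_ge0 ?(ltW (v_gt0 n))// lerXn2r ?nnegrE ?mulr_ge0 ?cmod_ge0 ?(ltW r0)//.
  by rewrite addr_ge0 ?cmod_ge0.
by rewrite ler_wpM2r ?(ltW r0)// lerDl.
Qed.

Definition kern l : R[i] -> R[i] := projT1 (cid (decay_powser (kcoef_decay l))).

Lemma kern_powser l : powser (kern l) (kcoef l).
Proof. by rewrite /kern; case: cid. Qed.

Lemma kern_fock l : fock_space h (kern l).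
Proof.
have s0 : 0 < cmod l ^+ 2 + 1 by rewrite ltr_wpDl ?sqr_ge0.
have [M M0 HM] := v_inv_growth s0.
apply: (proj1 (fock_bounded (B := M * 2) (kern_powser l) _)).
move=> N; apply: le_trans (_ : \sum_(n < N) M * 2 ^- n <= _); last first.
  by rewrite -mulr_sumr ler_wpM2l ?(ltW M0)// half_sum.
apply: ler_sum => n _; rewrite kcoefE; apply: le_trans (HM n).
rewrite ler_wpM2r ?invr_ge0 ?(ltW (v_gt0 n))// lerXn2r ?nnegrE ?sqr_ge0 ?(ltW s0)//.
by rewrite lerDl.
Qed.

Lemma kern_norm_gt0 l : 0 < fock_norm h (kern l).
Proof.
have := fock_partial 1 (kern_powser l) (kern_fock l).
rewrite big_ord_recl big_ord0 addr0 kcoefE expr0 div1r => H.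
have n0 : 0 <= fock_norm h (kern l) by exact: sqrtr_ge0.
rewrite lt_def n0 andbT; apply/eqP => E; move: H; rewrite E expr0n /=.
by rewrite leNgt invr_gt0 v_gt0.
Qed.

Definition re_inner f g : R :=
  \int[@area_measure R]_p re (f (p.1 +i* p.2) * conjc (g (p.1 +i* p.2)) * (expR (- h (cmod (p.1 +i* p.2))))%:C).

(** Polarization reduces the inner product to squared norms, for which Parseval's formula is
    available. *)
Lemma re_innerE f g : fock_space h f -> fock_space h g ->
  re_inner f g = (fock_norm h (fun z => f z + g z) ^+ 2 - fock_norm h (fun z => f z + (-1) * g z) ^+ 2) / 4.
Proof.
move=> ff fg; have fp := fockD ff fg; have fm := fockD ff (fockZ (-1) fg).
have int u : fock_space h u ->
    (@area_measure R).-integrable setT (EFin \o (fun p : RM * RM => cmod (u (p.1 +i* p.2)) ^+ 2 * expR (- h (cmod (p.1 +i* p.2))))).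
  move=> fu; apply/integrableP; split.
    have [a ua] := fock_powser fu; have [m1 m2] := rmeas_powser ua.
    apply/measurable_EFinP; have : rmeas (fun z => cmod (u z) ^+ 2 * W z).
      by apply: rmeasM => //; exact: rmeas_cmod2.
    rewrite /rmeas; congr measurable_fun; apply/funext => p; by rewrite WE.
  case: fu => _; apply: le_lt_trans; apply: le_of_eq.
  by apply: eq_integral => p _ /=; rewrite ger0_norm// mulr_ge0 ?sqr_ge0 ?expR_ge0.
have fineE u : fock_space h u -> fock_norm h u ^+ 2 =
    \int[@area_measure R]_p (cmod (u (p.1 +i* p.2)) ^+ 2 * expR (- h (cmod (p.1 +i* p.2)))).
  move=> fu; apply: EFin_inj; rewrite -fock_normE// /Rintegral fineK//.
  exact: (integrable_fin_num _ (int u fu)).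
rewrite !fineE// -RintegralB//; [|exact: (int _ fp)|exact: (int _ fm)].
rewrite mulrC -RintegralZl//; last first.
  have := integrableB measurableT (int _ fp) (int _ fm).
  by congr (_.-integrable _ _).
apply: eq_Rintegral => p _; rewrite !sqr_cmod !ReImE /=.
by case: (f _) (g _) => [x y] [s t] /=; field.
Qed.

(** The polarized partial sums of the norms are exactly the real parts of the Taylor partial sums of
    [f] at [l], since the factor [v n] cancels in [kcoef]; both sides converge. *)
Lemma re_inner_kern f l : fock_space h f -> re_inner f (kern l) = re (f l).
Proof.
move=> ff; have [a fa] := fock_powser ff; have fk := kern_fock l; have kp := kern_powser l.
rewrite re_innerE//.
have c1 := fock_cvg (powserD fa kp) (fockD ff fk).
have c2 := fock_cvg (powserD fa (powserZ (-1) kp)) (fockD ff (fockZ (-1) fk)).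
have c : (\sum_(n < N) cmod (a n + kcoef l n) ^+ 2 * v n -
   \sum_(n < N) cmod (a n + -1 * kcoef l n) ^+ 2 * v n) / 4 @[N --> \oo] -->
   (fock_norm h (fun z => f z + kern l z) ^+ 2 - fock_norm h (fun z => f z + (-1) * kern l z) ^+ 2) / 4.
  by apply: cvgM; [exact: cvgB|exact: cvg_cst].
have [d _] := powser_cvg l fa.
suff E : (fun N => (\sum_(n < N) cmod (a n + kcoef l n) ^+ 2 * v n -
   \sum_(n < N) cmod (a n + -1 * kcoef l n) ^+ 2 * v n) / 4) =
   (fun N => re (\sum_(k < N) a k * l ^+ k)).
  by rewrite E in c; exact: (cvg_unique _ c d).
apply/funext => N; rewrite -sumrB mulr_suml.
have -> : re (\sum_(k < N) a k * l ^+ k) = \sum_(k < N) re (a k * l ^+ k).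
  by elim: N => [|N IH]; rewrite ?big_ord0// !big_ord_recr /= ReD IH.
apply: eq_bigr => n _.
have -> : l ^+ n = conjc (kcoef l n) * (v n)%:C.
  rewrite /kcoef (rmorphM (@conjc R)) (rmorphXn (@conjc R)) /= conjcK oppr0 -/((v n)^-1)%:C.
  by rewrite -mulrA -(rmorphM (@real_complex R)) mulVf ?mulr1// gt_eqF.
by rewrite !sqr_cmod; case: (a n) (kcoef l n) => [x y] [s t] /=; field.
Qed.

Lemma im_inner_re f g : \int[@area_measure R]_p im (f (p.1 +i* p.2) * conjc (g (p.1 +i* p.2)) * (expR (- h (cmod (p.1 +i* p.2))))%:C) =
  re_inner (fun z => (- 'i) * f z) g.
Proof.
apply: eq_Rintegral => p _; rewrite !ReImE /=.
by case: (f _) (g _) => [x y] [s t] /=; ring.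
Qed.

Lemma kern_reproducing l : reproducing_kernel h l (kern l).
Proof.
split=> [|f ff]; first exact: kern_fock.
rewrite /fock_inner /cintegral; apply: complex_ext => /=.
  by rewrite -[LHS]re_inner_kern.
rewrite [RHS]im_inner_re re_inner_kern; last exact: fockZ.
by rewrite !ReImE /=; ring.
Qed.

Lemma kern_normalized l :
  normalized_kernel h l (fun z => kern l z / (fock_norm h (kern l))%:C).
Proof.
exists (kern l); split => //; first exact: kern_reproducing.
by rewrite gt_eqF// kern_norm_gt0.
Qed.

End fock_coefficients.

(** * The Riesz basis *)

Section block_sums.
Variable R : realType.

(** The number of indices in the blocks below [m], and therefore also the first index of block
    [m]. *)
Definition bsize m := ((2 ^ m).-1)%N.

Lemma bsizeS m : bsize m.+1 = (bsize m + 2 ^ m)%N.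
Proof. by rewrite /bsize expnS; have := expn_gt0 2 m; lia. Qed.

Lemma bsize_ge m : (m <= bsize m)%N.
Proof. by have := ltn_expl m (ltnSn 1); rewrite /bsize; lia. Qed.

Lemma bsize_mono m n : (m <= n)%N -> (bsize m <= bsize n)%N.
Proof. by move=> mn; rewrite /bsize -!subn1 leq_sub2r// leq_pexp2l. Qed.

Lemma block_bsize i k : (k < 2 ^ i)%N -> block (bsize i + k) = i.
Proof. by move=> ki; apply: block_eq; rewrite /bsize expnS; have := expn_gt0 2 i; lia. Qed.

Lemma block_lt n m : (block n < m)%N = (n < bsize m)%N.
Proof.
have /andP[h1 h2] := blockP n; have p0 := expn_gt0 2 m.
apply/idP/idP => [h|h].
  have : (2 ^ (block n).+1 <= 2 ^ m)%N by rewrite leq_pexp2l.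
  by rewrite /bsize; lia.
rewrite ltnNge; apply/negP => h3; have : (2 ^ m <= 2 ^ block n)%N by rewrite leq_pexp2l.
by move: h; rewrite /bsize; lia.
Qed.

Lemma bsize_le n : (bsize (block n) <= n)%N.
Proof. by have /andP[h1 _] := blockP n; rewrite /bsize; lia. Qed.

Lemma offset_lt n : (n - bsize (block n) < 2 ^ block n)%N.
Proof. by have /andP[_] := blockP n; rewrite /bsize expnS; have := expn_gt0 2 (block n); lia. Qed.

Lemma sum_blocks (V : nmodType) (F : nat -> V) m :
  \sum_(n < bsize m) F n = \sum_(i < m) \sum_(k < 2 ^ i) F (bsize i + k)%N.
Proof.
elim: m => [|m IH]; first by rewrite !big_ord0.
by rewrite bsizeS big_split_ord /= IH big_ord_recr.
Qed.

Lemma sum_le_bsize (F : nat -> R) N m : (N <= bsize m)%N -> (forall n, 0 <= F n) ->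
  \sum_(n < N) F n <= \sum_(n < bsize m) F n.
Proof.
move=> Nm F0; rewrite -(subnKC Nm) big_split_ord /= lerDl.
by apply: sumr_ge0.
Qed.

(** The 2^i indices of block [i] contribute 4^(-i) each. *)
Lemma block_decay_sum N : \sum_(n < N) (2 ^- (2 * block n) : R) <= 2.
Proof.
apply: le_trans (@sum_le_bsize (fun n => 2 ^- (2 * block n)) N N (bsize_ge N) _) _.
  by move=> n; rewrite invr_ge0 exprn_ge0.
rewrite (sum_blocks (fun n => 2 ^- (2 * block n) : R)); apply: le_trans (half_sum R N).
apply: ler_sum => i _; rewrite (eq_bigr (fun=> 2 ^- (2 * i))).
  by rewrite sum_ord_cst natrX mul2n -addnn exprD invfM mulrA mulfV ?mul1r// expf_neq0.
by move=> k _; rewrite block_bsize.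
Qed.

Lemma block_count N j : \sum_(n < N | block n == j) (1 : R) <= 2 ^+ j.
Proof.
rewrite big_mkcond /=.
apply: le_trans (@sum_le_bsize (fun n => if block n == j then 1 else 0) N (N + j.+1) _ _) _.
- by apply: leq_trans (bsize_ge _) (bsize_mono _); rewrite leq_addr.
- by move=> n; case: ifP.
rewrite (sum_blocks (fun n => if block n == j then 1 else 0 : R)).
have jN : (j < N + j.+1)%N by rewrite addnS ltnS leq_addl.
rewrite (bigD1 (Ordinal jN))//= [X in _ + X]big1 ?addr0.
  rewrite (eq_bigr (fun=> 1)) ?sum_ord_cst ?natrX ?mulr1//.
  by move=> k _; rewrite block_bsize// eqxx.
move=> i; rewrite -val_eqE /= => ij; rewrite big1// => k _.
by rewrite block_bsize// (negbTE ij).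
Qed.

Lemma cauchy_schwarz (I : Type) (s : seq I) (P : pred I) (x y : I -> R) :
  (\sum_(i <- s | P i) x i * y i) ^+ 2 <=
  (\sum_(i <- s | P i) x i ^+ 2) * (\sum_(i <- s | P i) y i ^+ 2).
Proof.
elim: s => [|i s IH]; first by rewrite !big_nil expr0n mulr0.
rewrite !big_cons; case: ifP => // _; move: IH.
set X := \sum_(_ <- _ | _) x _ ^+ 2; set Y := \sum_(_ <- _ | _) y _ ^+ 2; set S := \sum_(_ <- _ | _) _.
have X0 : 0 <= X by apply: sumr_ge0 => j _; exact: sqr_ge0.
have Y0 : 0 <= Y by apply: sumr_ge0 => j _; exact: sqr_ge0.
move: (x i) (y i) X Y S X0 Y0 => a b X Y S X0 Y0 H.
(* These are the cross terms of the induction step. Multiplied by [X] they become a square plus a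
   nonnegative term, so [X = 0], which forces [S = 0], is treated apart. *)
suff : 0 <= X * b ^+ 2 + Y * a ^+ 2 - 2 * S * a * b by lra.
have [X1|X1] := eqVneq X 0.
  have S0 : S = 0 by apply/eqP; rewrite -sqrf_eq0 eq_le sqr_ge0 andbT; apply: le_trans H _; rewrite X1 mul0r.
  by rewrite X1 S0 mulr0 !mul0r add0r subr0 mulr_ge0 ?sqr_ge0.
have X2 : 0 < X by rewrite lt_def X1.
rewrite -(pmulr_rge0 _ X2).
rewrite (_ : X * (X * b ^+ 2 + Y * a ^+ 2 - 2 * S * a * b) = (X * b - S * a) ^+ 2 + (X * Y - S ^+ 2) * a ^+ 2); last by ring.
by rewrite addr_ge0 ?sqr_ge0// mulr_ge0 ?sqr_ge0// subr_ge0.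
Qed.

Lemma cauchy_schwarzC (I : Type) (s : seq I) (P : pred I) (x y : I -> R[i]) :
  cmod (\sum_(i <- s | P i) x i * y i) ^+ 2 <=
  (\sum_(i <- s | P i) cmod (x i) ^+ 2) * (\sum_(i <- s | P i) cmod (y i) ^+ 2).
Proof.
apply: le_trans (cauchy_schwarz s P (fun i => cmod (x i)) (fun i => cmod (y i))).
rewrite lerXn2r ?nnegrE ?cmod_ge0//; first by apply: sumr_ge0 => i _; rewrite mulr_ge0 ?cmod_ge0.
by apply: le_trans (cmod_sum _ _ _) _; apply: ler_sum => i _; rewrite cmodM.
Qed.

End block_sums.

Section riesz.
Variable R : realType.
Local Notation re := complex.Re.
Local Notation im := complex.Im.
Implicit Types (z l : R[i]) (f g : R[i] -> R[i]) (a b A : nat -> R[i]).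
Variables (h : R -> R) (v : nat -> R) (ker : R[i] -> R[i] -> R[i]).
Hypothesis v_gt0 : forall n, 0 < v n.
Hypothesis f_powser : forall f, fock_space h f -> exists a, powser f a.
Hypothesis f_bounded : forall f a (B : R), powser f a ->
  (forall N, \sum_(n < N) cmod (a n) ^+ 2 * v n <= B) ->
  fock_space h f /\ fock_norm h f ^+ 2 <= B.
Hypothesis f_partial : forall f a N, powser f a -> fock_space h f ->
  \sum_(n < N) cmod (a n) ^+ 2 * v n <= fock_norm h f ^+ 2.
Hypothesis f_cvg : forall f a, powser f a -> fock_space h f ->
  \sum_(n < N) cmod (a n) ^+ 2 * v n @[N --> \oo] --> fock_norm h f ^+ 2.
Hypothesis ker_powser : forall l, powser (ker l) (kcoef v l).
Hypothesis ker_fock : forall l, fock_space h (ker l).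
Hypothesis ker_norm_gt0 : forall l, 0 < fock_norm h (ker l).

Variables (rad q : nat -> R).
Hypothesis rad_gt0 : forall j, 0 < rad j.
Hypothesis rad_inj : injective rad.
Hypothesis q_gt0 : forall j, 0 < q j.
Hypothesis on_block : forall n, q (block n) / 4 * rad (block n) ^+ (2 * n) <= v n <=
  4 * q (block n) * rad (block n) ^+ (2 * n).
(** In the exponent, [2 * block n] makes the sum over [n] converge. Dividing by the squared norm of
    a node kernel, at least [2 ^+ j / (4 * q j)], turns [j + 11] into [2 * j + 9], so the sum over
    the nodes converges as well. The resulting squared Hilbert-Schmidt norm is at most
    [2 * 2 * 2 ^- 9], that is 1/128. *)
Hypothesis off_block : forall n j, j != block n ->
  q j * rad j ^+ (2 * n) * 2 ^+ (2 * block n + j + 11) <= v n.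

(* The index p = 2^j - 1 + k with k < 2^j stands for the k-th node of the
   j-th circle. *)
Definition node p : R[i] := (rad (block p))%:C * zeta R (block p) ^+ (p - bsize (block p)).

Lemma cmod_node p : cmod (node p) = rad (block p).
Proof. by rewrite /node cmodM cmodR cmodX cmod_zeta expr1n mulr1 gtr0_norm. Qed.

Lemma node_inj : injective node.
Proof.
move=> p p' E; have br : block p = block p' by apply: rad_inj; rewrite -!cmod_node E.
move: E; rewrite /node br => /mulfI; rewrite -cmod_eq0 cmodR normr_eq0 gt_eqF// => /(_ isT) E.
suff : (p - bsize (block p') = p' - bsize (block p'))%N.
  by have := bsize_le p; have := bsize_le p'; rewrite br; lia.
have := offset_lt p; have := offset_lt p'; rewrite br; set j := block p'.
move: E; set x := (p - _)%N; set y := (p' - _)%N => E yj xj.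
have z0 : zeta R j != 0 by rewrite -cmod_gt0 cmod_zeta.
have sym : forall x y : nat, zeta R j ^+ x = zeta R j ^+ y -> (x < 2 ^ j)%N -> (y < x)%N -> False.
  move=> {E yj xj} s t E sj ts; have := @zeta_neq1 R j (s - t); rewrite subn_gt0 ts (leq_ltn_trans (leq_subr _ _) sj).
  move=> /(_ isT)/negP; apply; apply/eqP.
  by apply: (mulIf (expf_neq0 t z0)); rewrite -exprD subnK ?(ltnW ts)// mul1r.
case: (ltngtP x y) => // [/(sym y x (esym E) yj)//|/(sym x y E xj)//].
Qed.

Definition node_norm p := fock_norm h (ker (node p)).

Lemma kcoef_node p n : cmod (kcoef v (node p) n) ^+ 2 * v n = rad (block p) ^+ (2 * n) / v n.
Proof. by rewrite kcoefE// cmod_node exprM. Qed.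

Lemma off_term n j : j != block n -> rad j ^+ (2 * n) / v n <= 2 ^- (2 * block n) * (2 ^- (j + 11) / q j).
Proof.
move=> jn; rewrite ler_pdivrMr// mulrA -invfM -exprD addnA -mulrA ler_pdivlMl ?exprn_gt0// ler_pdivlMl//.
apply: le_trans (off_block jn); apply: le_of_eq; ring.
Qed.

Lemma on_term n : 1 / (4 * q (block n)) <= rad (block n) ^+ (2 * n) / v n <= 4 / q (block n).
Proof.
have /andP[h1 h2] := on_block n; apply/andP; split.
  by rewrite ler_pdivrMr ?mulr_gt0// mulrAC ler_pdivlMr// mul1r mulrC.
by rewrite ler_pdivrMr// mulrAC ler_pdivlMr// -ler_pdivrMl// mulrA mulrC mulrA; move: h1; rewrite mulrC [_ / 4]mulrC mulrA.
Qed.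

(** The 2^j monomials of the own block contribute at most [4 / q j] each, all others together at
    most [2 ^+ j / q j]. *)
Lemma node_norm_le p : node_norm p ^+ 2 <= 5 * 2 ^+ block p / q (block p).
Proof.
set j := block p.
apply: (proj2 (f_bounded (B := 5 * 2 ^+ j / q j) (ker_powser (node p)) _)).
move=> N; under eq_bigr do rewrite kcoef_node.
rewrite (bigID (fun n : 'I_N => block n == j)) /=.
have h1 : \sum_(n < N | block n == j) rad j ^+ (2 * n) / v n <= 4 * 2 ^+ j / q j.
  apply: le_trans (_ : \sum_(n < N | block n == j) 1 * (4 / q j) <= _).
    by apply: ler_sum => n /eqP bn; rewrite mul1r; have /andP[_] := on_term n; rewrite bn.
  by rewrite -mulr_suml mulrA [4 * _]mulrC ler_pM2r ?invr_gt0// ler_pM2r// block_count.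
have h2 : \sum_(n < N | block n != j) rad j ^+ (2 * n) / v n <= 2 ^+ j / q j.
  apply: le_trans (_ : \sum_(n < N | block n != j) 2 ^- (2 * block n) * (2 ^- (j + 11) / q j) <= _).
    by apply: ler_sum => n bn; apply: off_term; rewrite eq_sym.
  apply: le_trans (_ : \sum_(n < N) 2 ^- (2 * block n) * (2 ^- (j + 11) / q j) <= _).
    rewrite [leRHS](bigID (fun n : 'I_N => block n != j)) /= lerDl; apply: sumr_ge0 => n _.
    by rewrite !mulr_ge0// ?invr_ge0 ?exprn_ge0// ltW.
  rewrite -mulr_suml; apply: le_trans (_ : 2 * (2 ^- (j + 11) / q j) <= _).
    by rewrite ler_wpM2r ?block_decay_sum// divr_ge0 ?invr_ge0 ?exprn_ge0// ltW.
  rewrite mulrA ler_pM2r ?invr_gt0// addnS exprS invfM mulrA mulfV// mul1r.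
  apply: le_trans (_ : 1 <= _); first by rewrite invf_le1 ?exprn_gt0// exprn_ege1// ler1n.
  by rewrite exprn_ege1// ler1n.
by apply: le_trans (lerD h1 h2) _; rewrite -mulrDl ler_pM2r ?invr_gt0//; lra.
Qed.

Lemma node_norm_ge p : 2 ^+ block p / (4 * q (block p)) <= node_norm p ^+ 2.
Proof.
set j := block p.
apply: le_trans (f_partial (bsize j.+1) (ker_powser (node p)) (ker_fock _)).
under eq_bigr do rewrite kcoef_node.
rewrite bsizeS big_split_ord /= -[leLHS]add0r; apply: lerD.
  by apply: sumr_ge0 => n _; rewrite divr_ge0 ?exprn_ge0// ltW.
apply: le_trans (_ : \sum_(k < 2 ^ j) 1 / (4 * q j) <= _).
  by rewrite sum_ord_cst natrX mul1r.
by apply: ler_sum => k _; have /andP[] := on_term (bsize j + k); rewrite block_bsize.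
Qed.

Definition basis_coef n p : R[i] := kcoef v (node p) n / (node_norm p)%:C.

Lemma node_norm_neq0 p : (node_norm p)%:C != 0 :> R[i].
Proof. by rewrite -cmod_eq0 cmodR normr_eq0 gt_eqF ?ker_norm_gt0. Qed.

Lemma cmod_coef n p : cmod (basis_coef n p) ^+ 2 * v n = rad (block p) ^+ (2 * n) / v n / node_norm p ^+ 2.
Proof.
rewrite -kcoef_node /basis_coef cmodM cmodV cmodR gtr0_norm ?ker_norm_gt0// exprMn exprVn.
by rewrite mulrAC.
Qed.

Lemma off_coef n p : block p != block n ->
  cmod (basis_coef n p) ^+ 2 * v n <= 2 ^- (2 * block n) * 2 ^- (2 * block p) * 2 ^- 9.
Proof.
set j := block p => jn; rewrite cmod_coef ler_pdivrMr ?exprn_gt0 ?ker_norm_gt0//.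
apply: le_trans (off_term jn) _.
rewrite -!mulrA ler_pM2l ?invr_gt0 ?exprn_gt0//.
apply: le_trans (_ : 2 ^- (2 * j) * (2 ^- 9 * (2 ^+ j / (4 * q j))) <= _); last first.
  by rewrite !ler_pM2l ?invr_gt0 ?exprn_gt0// node_norm_ge.
apply: le_of_eq.
rewrite mul2n -addnn !exprD (_ : 2 ^+ 11 = 4 * 2 ^+ 9 :> R); last by rewrite -!natrX -natrM.
by field; rewrite !expf_neq0// gt_eqF.
Qed.

Definition basis p z := ker (node p) z / (node_norm p)%:C.

Lemma basis_powser p : powser (basis p) (basis_coef ^~ p).
Proof.
have := powserZ ((node_norm p)%:C^-1) (ker_powser (node p)).
rewrite (_ : (fun z => _) = basis p); last by apply/funext => z; rewrite mulrC.
by rewrite (_ : (fun k => _) = (basis_coef ^~ p))//; apply/funext => z; rewrite mulrC.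
Qed.

Definition synth m A z := \sum_(p < bsize m) A p * basis p z.

(* On a block the Gram matrix is a discrete Fourier transform times diagonal
   matrices with bounded entries, by [on_block]; the remainder has a small
   Hilbert-Schmidt norm, by [off_block]. *)
Definition diag m A n := \sum_(p < bsize m | block p == block n) A p * basis_coef n p.
Definition offdiag m A n := \sum_(p < bsize m | block p != block n) A p * basis_coef n p.

Lemma synth_powser m A : powser (synth m A) (fun n => diag m A n + offdiag m A n).
Proof.
have H := @powser_sum R _ (index_enum 'I_(bsize m)) (fun p z => A p * basis p z) (fun p n => A p * basis_coef n p)
  (fun p => powserZ _ (basis_powser p)).
move: H; congr powser; apply/funext => n.
by rewrite /diag /offdiag [LHS](bigID (fun p : 'I_(bsize m) => block p == block n)).
Qed.

Definition ssum m A := \sum_(p < bsize m) cmod (A p) ^+ 2.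

Lemma ssum_ge0 m A : 0 <= ssum m A.
Proof. by apply: sumr_ge0 => p _; exact: sqr_ge0. Qed.

Lemma offdiag_sum m A N : \sum_(n < N) cmod (offdiag m A n) ^+ 2 * v n <= ssum m A / 128.
Proof.
have t n : cmod (offdiag m A n) ^+ 2 * v n <= ssum m A * (2 ^- 9 * 2) * 2 ^- (2 * block n).
  apply: le_trans (ler_wpM2r (ltW (v_gt0 n)) (cauchy_schwarzC _ _ _ _)) _.
  rewrite -!mulrA; apply: ler_pM.
  - by apply: sumr_ge0 => p _; exact: sqr_ge0.
  - by rewrite mulr_ge0 ?(ltW (v_gt0 n))//; apply: sumr_ge0 => p _; exact: sqr_ge0.
  - rewrite [leRHS](bigID (fun p : 'I_(bsize m) => block p != block n)) /= lerDl.
    by apply: sumr_ge0 => p _; exact: sqr_ge0.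
  rewrite mulr_suml; apply: le_trans (_ : \sum_(p < bsize m | block p != block n) 2 ^- (2 * block p) * (2 ^- (2 * block n) * 2 ^- 9) <= _).
    apply: ler_sum => p pn; apply: le_trans (off_coef pn) _.
    by apply: le_of_eq; ring.
  apply: le_trans (_ : \sum_(p < bsize m) 2 ^- (2 * block p) * (2 ^- (2 * block n) * 2 ^- 9) <= _).
    rewrite [leRHS](bigID (fun p : 'I_(bsize m) => block p != block n)) /= lerDl.
    by apply: sumr_ge0 => p _; rewrite !mulr_ge0 ?invr_ge0 ?exprn_ge0.
  rewrite -mulr_suml mulrA [2 ^- 9 * _]mulrC -!mulrA [_ * 2 ^- 9]mulrC.
  by rewrite ler_wpM2r ?block_decay_sum// mulr_ge0 ?invr_ge0 ?exprn_ge0.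
apply: le_trans (_ : \sum_(n < N) ssum m A * (2 ^- 9 * 2) * 2 ^- (2 * block n) <= _); first by apply: ler_sum.
rewrite -mulr_sumr -mulrA ler_wpM2l ?ssum_ge0//.
have e9 : 2 ^- 9 * 2 * 2 = 128^-1 :> R.
  rewrite (_ : 2 ^+ 9 = 512); last by rewrite -natrX.
  by field.
by rewrite -e9 ler_wpM2l ?block_decay_sum// mulr_ge0 ?invr_ge0 ?exprn_ge0.
Qed.

Lemma sum_block (V : nmodType) (F : nat -> V) m i : (i < m)%N ->
  \sum_(p < bsize m | block p == i) F p = \sum_(k < 2 ^ i) F (bsize i + k)%N.
Proof.
move=> im; rewrite big_mkcond (sum_blocks (fun p => if block p == i then F p else 0)).
rewrite (bigD1 (Ordinal im))//= [X in _ + X]big1 ?addr0.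
  by apply: eq_bigr => k _; rewrite block_bsize// eqxx.
move=> j; rewrite -val_eqE /= => ij; rewrite big1// => k _.
by rewrite block_bsize// (negbTE ij).
Qed.

Lemma conj_real (x : R) : conjc x%:C = x%:C.
Proof. by apply: complex_ext => //=; rewrite oppr0. Qed.

Lemma conj_mul z l : conjc (z * l) = conjc z * conjc l.
Proof. exact: (rmorphM (@conjc R)). Qed.

Lemma conj_sum N (F : nat -> R[i]) : conjc (\sum_(k < N) F k) = \sum_(k < N) conjc (F k).
Proof. exact: (rmorph_sum (@conjc R)). Qed.

Lemma diagE m A i t : (i < m)%N -> (t < 2 ^ i)%N ->
  diag m A (bsize i + t) = (rad i ^+ (bsize i + t) / v (bsize i + t))%:C *
    \sum_(k < 2 ^ i) A (bsize i + k)%N / (node_norm (bsize i + k))%:C * conjc (zeta R i ^+ (k * (bsize i + t))).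
Proof.
move=> im ti; rewrite /diag block_bsize// (sum_block (fun p => A p * basis_coef (bsize i + t) p))// mulr_sumr.
apply: eq_bigr => k _; rewrite /basis_coef /kcoef /node block_bsize// addKn.
rewrite conj_mul conj_real exprMn exprM (rmorphXn (@conjc R)) /=.
by rewrite (rmorphM (@real_complex R)) (rmorphXn (@real_complex R)) (rmorphXn (@conjc R)) (rmorphXn (@conjc R)) /=; ring.
Qed.

(** Conjugation turns the conjugate roots into roots. The factor [zeta R i ^+ (bsize i * k)], of
    modulus 1, is attached to the coefficients, which leaves the plain transform of
    [discrete_parseval]. *)
Lemma cmod_diagE m A i t : (i < m)%N -> (t < 2 ^ i)%N ->
  cmod (diag m A (bsize i + t)) ^+ 2 * v (bsize i + t) = rad i ^+ (2 * (bsize i + t)) / v (bsize i + t) *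
   cmod (\sum_(k < 2 ^ i) conjc (A (bsize i + k)%N / (node_norm (bsize i + k))%:C) * zeta R i ^+ (bsize i * k)
     * zeta R i ^+ (t * k)) ^+ 2.
Proof.
move=> im ti; rewrite diagE//; set n := (bsize i + t)%N.
rewrite cmodM cmodR exprMn real_normK ?num_real// -cmodJ.
have -> : conjc (\sum_(k < 2 ^ i) A (bsize i + k)%N / (node_norm (bsize i + k))%:C * conjc (zeta R i ^+ (k * n))) =
  \sum_(k < 2 ^ i) conjc (A (bsize i + k)%N / (node_norm (bsize i + k))%:C) * zeta R i ^+ (bsize i * k)
     * zeta R i ^+ (t * k).
  rewrite (@conj_sum (2 ^ i) (fun k => A (bsize i + k)%N / (node_norm (bsize i + k))%:C * conjc (zeta R i ^+ (k * n)))).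
  apply: eq_bigr => k _; rewrite [LHS]conj_mul conjcK -mulrA -exprD -mulnDl mulnC//.
by rewrite exprMn exprVn -exprM mulnC; field; rewrite gt_eqF.
Qed.

(** The factor [2 ^+ i] of the discrete Parseval formula cancels against the squared node norms,
    which lie between [2 ^+ i / (4 * q i)] and [5 * 2 ^+ i / q i]. The row factors lie between
    [1 / (4 * q i)] and [4 / q i]. Hence 20 = 4 * 5 and 16 = 4 * 4. *)
Lemma diag_block m A i : (i < m)%N ->
  (\sum_(k < 2 ^ i) cmod (A (bsize i + k)%N) ^+ 2) / 20 <=
  \sum_(t < 2 ^ i) cmod (diag m A (bsize i + t)) ^+ 2 * v (bsize i + t) <=
  16 * \sum_(k < 2 ^ i) cmod (A (bsize i + k)%N) ^+ 2.
Proof.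
move=> im.
pose b k := conjc (A (bsize i + k)%N / (node_norm (bsize i + k))%:C) * zeta R i ^+ (bsize i * k).
have bE (k : 'I_(2 ^ i)) : cmod (b k) ^+ 2 = cmod (A (bsize i + k)%N) ^+ 2 / node_norm (bsize i + k) ^+ 2.
  rewrite /b cmodM cmodJ cmodX cmod_zeta expr1n mulr1 cmodM cmodV cmodR exprMn exprVn.
  by rewrite real_normK ?num_real.
have bl (k : 'I_(2 ^ i)) : q i / 5 * cmod (A (bsize i + k)%N) ^+ 2 <= 2 ^+ i * cmod (b k) ^+ 2 <=
    4 * q i * cmod (A (bsize i + k)%N) ^+ 2.
  have := node_norm_le (bsize i + k); have := node_norm_ge (bsize i + k); rewrite block_bsize// => h1 h2.
  have n0 : 0 < node_norm (bsize i + k) ^+ 2 by rewrite exprn_gt0 ?ker_norm_gt0.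
  have p0 : 0 < 2 ^+ i :> R by rewrite exprn_gt0.
  have q0 := q_gt0 i; rewrite bE; set X := cmod _ ^+ 2; have X0 : 0 <= X := sqr_ge0 _.
  rewrite (_ : 2 ^+ i * (X / _) = (2 ^+ i / node_norm (bsize i + k) ^+ 2) * X); last by ring.
  apply/andP; split; apply: ler_wpM2r => //.
    rewrite ler_pdivlMr// -ler_pdivlMl ?divr_gt0//; apply: le_trans h2 _.
    by apply: le_of_eq; field; rewrite gt_eqF.
  by rewrite ler_pdivrMr// mulrC -ler_pdivrMr ?mulr_gt0.
have tl (t : 'I_(2 ^ i)) : 1 / (4 * q i) * cmod (\sum_(k < 2 ^ i) b k * zeta R i ^+ (t * k)) ^+ 2 <=
   cmod (diag m A (bsize i + t)) ^+ 2 * v (bsize i + t) <=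
   4 / q i * cmod (\sum_(k < 2 ^ i) b k * zeta R i ^+ (t * k)) ^+ 2.
  rewrite cmod_diagE//; have /andP[h1 h2] := on_term (bsize i + t).
  rewrite block_bsize// in h1 h2.
  by apply/andP; split; apply: ler_wpM2r; rewrite ?sqr_ge0.
have q0 := q_gt0 i; apply/andP; split.
  apply: le_trans (_ : \sum_(t < 2 ^ i) 1 / (4 * q i) * cmod (\sum_(k < 2 ^ i) b k * zeta R i ^+ (t * k)) ^+ 2 <= _).
    rewrite -mulr_sumr discrete_parseval//.
    rewrite -ler_pdivrMl ?divr_gt0 ?mulr_gt0// mulr_sumr.
    rewrite (_ : (1 / (4 * q i))^-1 * _ = \sum_(k < 2 ^ i) q i / 5 * cmod (A (bsize i + k)%N) ^+ 2).
      by apply: ler_sum => k _; have /andP[] := bl k.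
    by rewrite -mulr_sumr; field; rewrite gt_eqF.
  by apply: ler_sum => t _; have /andP[] := tl t.
apply: le_trans (_ : \sum_(t < 2 ^ i) 4 / q i * cmod (\sum_(k < 2 ^ i) b k * zeta R i ^+ (t * k)) ^+ 2 <= _).
  by apply: ler_sum => t _; have /andP[] := tl t.
rewrite -mulr_sumr discrete_parseval//.
rewrite -ler_pdivlMl ?divr_gt0// mulr_sumr.
rewrite (_ : _ * (16 * _) = \sum_(k < 2 ^ i) 4 * q i * cmod (A (bsize i + k)%N) ^+ 2).
  by apply: ler_sum => k _; have /andP[] := bl k.
by rewrite -mulr_sumr; field; rewrite gt_eqF.
Qed.

Lemma diag_sum m A : ssum m A / 20 <= \sum_(n < bsize m) cmod (diag m A n) ^+ 2 * v n <= 16 * ssum m A.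
Proof.
rewrite /ssum (sum_blocks (fun p => cmod (A p) ^+ 2)) (sum_blocks (fun n => cmod (diag m A n) ^+ 2 * v n)).
by apply/andP; split; rewrite ?mulr_suml ?mulr_sumr; apply: ler_sum => i _; have /andP[] := diag_block A (ltn_ord i).
Qed.

Lemma diag_out m A n : (bsize m <= n)%N -> diag m A n = 0.
Proof.
move=> mn; rewrite /diag big1// => p /eqP pn.
by have := ltn_ord p; rewrite -block_lt pn block_lt ltnNge mn.
Qed.

Lemma diag_sum_le m A N : \sum_(n < N) cmod (diag m A n) ^+ 2 * v n <= 16 * ssum m A.
Proof.
have /andP[_ H] := diag_sum m A.
have t0 n : 0 <= cmod (diag m A n) ^+ 2 * v n by rewrite mulr_ge0 ?sqr_ge0// ltW.
apply: le_trans (_ : \sum_(n < bsize m + N) cmod (diag m A n) ^+ 2 * v n <= _).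
  rewrite addnC big_split_ord /= lerDl; exact: sumr_ge0.
rewrite big_split_ord /= [X in _ + X]big1 ?addr0// => n _.
by rewrite diag_out ?leq_addr// cmod0 expr0n mul0r.
Qed.

(** By [cmod_sqD] and [cmod_sqD_ge] the off-diagonal part is a small perturbation: 2 * 16 + 2 / 128
    is below 33, and 1 / 40 - 1 / 128 is above 1 / 64. *)
Lemma synth_bounds m A : fock_space h (synth m A) /\
  ssum m A / 64 <= fock_norm h (synth m A) ^+ 2 <= 33 * ssum m A.
Proof.
have S0 := ssum_ge0 m A.
have [sf sup] : fock_space h (synth m A) /\ fock_norm h (synth m A) ^+ 2 <= 33 * ssum m A.
  apply: f_bounded (synth_powser m A) _ => N.
  apply: le_trans (_ : \sum_(n < N) (2 * (cmod (diag m A n) ^+ 2 * v n) + 2 * (cmod (offdiag m A n) ^+ 2 * v n)) <= _).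
    apply: ler_sum => n _; have := ler_wpM2r (ltW (v_gt0 n)) (cmod_sqD (diag m A n) (offdiag m A n)).
    by rewrite mulrDl !mulrA.
  rewrite big_split /= -!mulr_sumr; have := diag_sum_le m A N; have := offdiag_sum m A N; lra.
split => //; apply/andP; split => //.
apply: le_trans (f_partial (bsize m) (synth_powser m A) sf).
apply: le_trans (_ : \sum_(n < bsize m) ((cmod (diag m A n) ^+ 2 * v n) / 2 - (cmod (offdiag m A n) ^+ 2 * v n)) <= _); last first.
  apply: ler_sum => n _; have := ler_wpM2r (ltW (v_gt0 n)) (cmod_sqD_ge (diag m A n) (offdiag m A n)).
  by rewrite mulrBl [_ / 2 * _]mulrAC.
rewrite sumrB -mulr_suml; have /andP[+ _] := diag_sum m A; have := offdiag_sum m A (bsize m); lra.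
Qed.

(** The inverse discrete Fourier transform on each block: [g] undoes the row factor of [diagE] and
    [node_norm] the column factor. *)
Lemma diag_onto m (bt : nat -> R[i]) : exists A, forall n, (n < bsize m)%N -> diag m A n = bt n.
Proof.
pose g n := bt n * (v n / rad (block n) ^+ n)%:C.
exists (fun p => let i := block p in (node_norm p)%:C * (2 ^- i)%:C *
  \sum_(t < 2 ^ i) zeta R i ^+ ((p - bsize i) * (bsize i + t)) * g (bsize i + t)%N).
move=> n nm; have im : (block n < m)%N by rewrite block_lt.
rewrite -(subnKC (bsize_le n)); have := offset_lt n.
move: (n - bsize (block n))%N => t; move: (block n) im => i im ti; rewrite diagE//.
set n' := (bsize i + t)%N.
have -> : \sum_(k < 2 ^ i) ((let j := block (bsize i + k) in (node_norm (bsize i + k))%:C * (2 ^- j)%:C *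
  \sum_(t < 2 ^ j) zeta R j ^+ ((bsize i + k - bsize j) * (bsize j + t)) * g (bsize j + t)%N) / (node_norm (bsize i + k))%:C *
   conjc (zeta R i ^+ (k * n'))) = (2 ^- i)%:C * \sum_(l < 2 ^ i) (\sum_(k < 2 ^ i)
   (zeta R i ^+ l * conjc (zeta R i ^+ t)) ^+ k) * g (bsize i + l)%N.
  under [in RHS]eq_bigr do rewrite mulr_suml.
  rewrite exchange_big /= mulr_sumr; apply: eq_bigr => k _.
  rewrite block_bsize// addKn; set S1 := \sum_(_ < _) _.
  rewrite (_ : _ * _ / _ * _ = (2 ^- i)%:C * (conjc (zeta R i ^+ (k * n')) * S1)); last first.
    by move: (conjc _) S1 (_%:C) (node_norm_neq0 (bsize i + k)) => x y w; move: (_%:C) => u u0; field.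
  congr (_ * _); rewrite mulr_sumr; apply: eq_bigr => l _; rewrite mulrA; congr (_ * _).
  rewrite /n' !mulnDr !exprD (rmorphM (@conjc R)) /=.
  have e1 : zeta R i ^+ (k * bsize i) * conjc (zeta R i ^+ (k * bsize i)) = 1.
    by rewrite mulcJ cmodX cmod_zeta !expr1n.
  rewrite mulrACA [X in X * _ = _]mulrC e1 mul1r exprMn [(k * t)%N]mulnC [(k * l)%N]mulnC !exprM.
  by rewrite (rmorphXn (@conjc R)) mulrC.
rewrite (bigD1 (Ordinal ti))//= [X in _ + X]big1 ?addr0.
  rewrite zetaJ// eqxx /g /n' block_bsize//.
  rewrite mulrCA.
  rewrite (_ : (2 ^ i)%:R = (2 ^+ i)%:C :> R[i]); last by rewrite rmorphXn natrX rmorph_nat.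
  rewrite -/n' [LHS](_ : _ = bt n' * (2 ^- i * (rad i ^+ n' / v n') * 2 ^+ i * (v n' / rad i ^+ n'))%:C).
    rewrite (_ : 2 ^- i * (rad i ^+ n' / v n') * 2 ^+ i * (v n' / rad i ^+ n') = 1) ?mulr1//.
    by field; rewrite !expf_neq0// ?gt_eqF.
  by rewrite !(rmorphM (@real_complex R)) /=; ring.
move=> l; rewrite -val_eqE /= => lt; rewrite zetaJ// (negbTE lt) mul0r//.
Qed.

(* The error norm is only halved, but the step can be iterated. *)
Lemma approx_step f : fock_space h f -> exists m A, fock_space h (fun z => f z - synth m A z) /\
  fock_norm h (fun z => f z - synth m A z) ^+ 2 <= fock_norm h f ^+ 2 / 2.
Proof.
move=> ff; have [a fa] := f_powser ff; set X := fock_norm h f ^+ 2.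
have t0 n : 0 <= cmod (a n) ^+ 2 * v n by rewrite mulr_ge0 ?sqr_ge0// ltW.
have [m tail] : exists m, forall N, \sum_(n < N | (bsize m <= n)%N) cmod (a n) ^+ 2 * v n <= X / 16.
  have [X0|X0] := eqVneq X 0.
    exists 0%N => N; rewrite X0 mul0r -[leRHS]X0 (eq_bigl xpredT) ?f_partial//.
  have X1 : 0 < X by rewrite lt_def X0 /X sqr_ge0.
  have : \forall N \near \oo, X - X / 16 <= \sum_(n < N) cmod (a n) ^+ 2 * v n.
    apply: cvgr_ge (f_cvg fa ff) _ _; rewrite -/X; lra.
  case=> N0 _ HN; exists N0 => N; rewrite big_mkcond /=.
  have h1 : \sum_(n < N) (if (bsize N0 <= n)%N then cmod (a n) ^+ 2 * v n else 0) <=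
    \sum_(n < bsize N0 + N) (if (bsize N0 <= n)%N then cmod (a n) ^+ 2 * v n else 0).
    rewrite [in leRHS]addnC big_split_ord /= lerDl; apply: sumr_ge0 => n _; by case: ifP.
  apply: le_trans h1 _; rewrite big_split_ord /= big1 ?add0r; last by move=> n _; rewrite leqNgt ltn_ord.
  have := f_partial (bsize N0 + N) fa ff; rewrite big_split_ord /= -/X.
  have := HN (bsize N0) (bsize_ge N0).
  rewrite (eq_bigr (fun n : 'I_N => cmod (a (bsize N0 + n)%N) ^+ 2 * v (bsize N0 + n))); last by [].
  rewrite [X in _ -> _ -> X <= _](eq_bigr (fun n : 'I_N => cmod (a (bsize N0 + n)%N) ^+ 2 * v (bsize N0 + n))); last by move=> n _; rewrite leq_addr.
  by lra.
have [A AE] := diag_onto m a; exists m, A.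
have S1 : ssum m A <= 20 * X.
  have /andP[+ _] := diag_sum m A; rewrite (eq_bigr (fun n : 'I_(bsize m) => cmod (a n) ^+ 2 * v n)).
    by have := f_partial (bsize m) fa ff; rewrite -/X; lra.
  by move=> n _; rewrite AE.
apply: f_bounded.
  have := powserB fa (synth_powser m A); exact.
move=> N; apply: le_trans (_ : \sum_(n < N) (2 * (if (bsize m <= n)%N then cmod (a n) ^+ 2 * v n else 0) + 2 * (cmod (offdiag m A n) ^+ 2 * v n)) <= _).
  apply: ler_sum => n _; case: ifP => mn.
    rewrite diag_out// add0r; have := ler_wpM2r (ltW (v_gt0 n)) (cmod_sqD (a n) (- offdiag m A n)).
    by rewrite cmodN mulrDl !mulrA.
  rewrite AE; last by rewrite ltnNge mn.
  rewrite opprD addrA subrr add0r cmodN mulr0 add0r ler_peMl ?ler1n// mulr_ge0 ?sqr_ge0// ltW//.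
(* The tail and the off-diagonal part add up to [2 * X / 16 + 2 * (20 * X) / 128], which is 7/16 of
   [X]. *)
rewrite big_split /= -!mulr_sumr; have := offdiag_sum m A N; have := tail N; rewrite big_mkcond /=; have : 0 <= X by rewrite /X sqr_ge0.
by lra.
Qed.

Lemma synthD m A m' A' z : exists m2 A2, forall z, synth m A z + synth m' A' z = synth m2 A2 z.
Proof.
have ext n k B z' : (n <= k)%N -> synth n B z' = synth k (fun p => if (p < bsize n)%N then B p else 0) z'.
  move=> nk; rewrite /synth -(subnKC (bsize_mono nk)) big_split_ord /= [X in _ + X]big1 ?addr0.
    by apply: eq_bigr => p _; rewrite ltn_ord.
  by move=> p _; rewrite ltnNge leq_addr mul0r.
exists (m + m')%N; exists (fun p => (if (p < bsize m)%N then A p else 0) + (if (p < bsize m')%N then A' p else 0)) => z'.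
rewrite (ext m _ A _ (leq_addr m' m)) (ext m' _ A' _ (leq_addl m m')) /synth -big_split /=.
by apply: eq_bigr => p _; rewrite mulrDl.
Qed.

Lemma approx f k : fock_space h f -> exists m A, fock_space h (fun z => f z - synth m A z) /\
  fock_norm h (fun z => f z - synth m A z) ^+ 2 <= fock_norm h f ^+ 2 / 2 ^+ k.
Proof.
move=> ff; elim: k => [|k [m [A [IH1 IH2]]]].
  exists 0%N, (fun=> 0); rewrite (_ : (fun z => _) = f) ?divr1//.
  by apply/funext => z; rewrite /synth big_ord0 subr0.
have [m' [A' [H1 H2]]] := approx_step IH1; have [m2 [A2 E]] := synthD m A m' A' 0.
exists m2, A2; rewrite (_ : (fun z => f z - synth m2 A2 z) = (fun z => f z - synth m A z - synth m' A' z)).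
  split=> //; apply: le_trans H2 _; have := IH2; rewrite [in 2 ^+ k.+1]exprS invfM; lra.
by apply/funext => z; rewrite -E opprD addrA.
Qed.

Lemma sum_uniq_nat (V : nmodType) (F : nat -> V) (t : seq nat) P : uniq t ->
  {in t, forall p, (p < P)%N} -> \sum_(p <- t) F p = \sum_(p < P | (p : nat) \in t) F p.
Proof.
move=> ut tP; rewrite -(big_mkord (mem t) F) -[RHS]big_filter; apply: perm_big.
apply: uniq_perm => //; first by rewrite filter_uniq// iota_uniq.
by move=> p; rewrite mem_filter mem_index_iota /=; case: (boolP (p \in t)) => //= /tP.
Qed.

Let e l z := ker l z / (fock_norm h (ker l))%:C.

Lemma riesz_basis_nodes : riesz_basis h (range node) e.
Proof.
split=> [f ff eps eps0|].
  have [k hk] := half_to0 (fock_norm h f ^+ 2) (exprn_gt0 2 eps0).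
  have [m [A [_ H]]] := approx k ff.
  (* [lincomb] takes coefficients indexed by points, so the index of a node is recovered from its
     position in [s]. *)
  pose s := map node (index_iota 0 (bsize m)).
  exists s, (fun l => A (index l s)); split.
  - by rewrite map_inj_uniq ?iota_uniq//; exact: node_inj.
  - by move=> l /= /mapP[p _ ->]; exists p.
  have E : (fun z => f z - lincomb e s (fun l => A (index l s)) z) = (fun z => f z - synth m A z).
    apply/funext => z; congr (_ - _); rewrite /lincomb /synth big_map big_mkord; apply: eq_bigr => p _.
    rewrite (index_map node_inj) /index_iota subn0.
    by rewrite -{1}[nat_of_ord p]add0n -(nth_iota 0 0 (ltn_ord p)) index_uniq ?iota_uniq// size_iota.
  rewrite E -(@ltr_pXn2r _ 2)// ?nnegrE ?(ltW eps0) ?sqrtr_ge0//.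
  exact: le_lt_trans hk.
exists 64^-1, 33; split=> // s a us sL.
have [t st] : exists t, s = map node t.
  elim: s {us} sL => [|l s IH] sL; first by exists [::].
  have [|t ->] := IH; first by move=> l' ls; apply: sL; rewrite /= inE ls orbT.
  have [p _ <-] : range node l by apply: sL; rewrite /= mem_head.
  by exists (p :: t).
have ut : uniq t by move: us; rewrite st; exact: map_uniq.
(* As [m <= bsize m], this synthesis involves all the given nodes; missing ones receive the
   coefficient 0. *)
pose m := (\max_(p <- t) p).+1; pose A p := if p \in t then a (node p) else 0.
have tm : {in t, forall p, (p < bsize m)%N}.
  move=> p pt; apply: leq_trans (bsize_ge m); rewrite ltnS.
  by rewrite (big_rem p)//= leq_maxl.
have -> : \sum_(l <- s) cmod (a l) ^+ 2 = ssum m A.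
  rewrite st big_map (sum_uniq_nat (fun p => cmod (a (node p)) ^+ 2) ut tm) big_mkcond.
  by apply: eq_bigr => p _; rewrite /A; case: ifP => // _; rewrite cmod0 expr0n.
have -> : lincomb e s a = synth m A.
  apply/funext => z; rewrite /lincomb st big_map (sum_uniq_nat (fun p => a (node p) * e (node p) z) ut tm) big_mkcond.
  by apply: eq_bigr => p _; rewrite /A; case: ifP => // _; rewrite mul0r.
by have [_] := synth_bounds m A; rewrite [_ / 64]mulrC.
Qed.

End riesz.

Lemma sum_pred_le (R : realType) (F : nat -> R) n : (forall i, 0 <= F i) ->
  \sum_(i < n.-1) F i.+1 <= \sum_(i < n) F i.
Proof.
by case: n => [|n] F0; [rewrite !big_ord0|rewrite [leRHS]big_ord_recl lerDr].
Qed.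

Lemma sum_pick_le (R : realType) (x : R) N k : 0 <= x ->
  \sum_(n < N) (if n == k :> nat then x else 0) <= x.
Proof.
move=> x0; rewrite -(big_mkcond (fun n : 'I_N => n == k :> nat) (fun=> x)).
by rewrite (big_ord1_eq _ (fun=> x)); case: ifP.
Qed.

(** * Failure of the de Branges property *)

Section reflection.
Variable R : realType.
Implicit Types (z l : R[i]) (f g : R[i] -> R[i]) (a b A : nat -> R[i]).
Variables (h : R -> R) (v : nat -> R).
Hypothesis v_gt0 : forall n, 0 < v n.
Hypothesis f_bounded : forall f a (B : R), powser f a ->
  (forall N, \sum_(n < N) cmod (a n) ^+ 2 * v n <= B) ->
  fock_space h f /\ fock_norm h f ^+ 2 <= B.
Hypothesis f_partial : forall f a N, powser f a -> fock_space h f ->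
  \sum_(n < N) cmod (a n) ^+ 2 * v n <= fock_norm h f ^+ 2.

Variables (rad q : nat -> R).
Hypothesis rad_gt0 : forall j, 0 < rad j.
Hypothesis q_gt0 : forall j, 0 < q j.
Hypothesis on_block : forall n, q (block n) / 4 * rad (block n) ^+ (2 * n) <= v n <=
  4 * q (block n) * rad (block n) ^+ (2 * n).

Variable j : nat.
Let m := bsize j.
Hypothesis m_gt0 : (0 < m)%N.
Let w : R[i] := 'i * (rad j)%:C.

(** Let s be the quotient of z^m - w^m by z - w. Then [up] and [low] are the coefficients of z s and
    w s, and their difference telescopes. *)
Let up i : R[i] := if i is 0%N then 0 else if (i <= m)%N then w ^+ (m - i) else 0.
Let low i : R[i] := if (i < m)%N then w ^+ (m - i) else 0.

(* z^m (z^m - w^m) for eps = -1; its product with (z + w) / (z - w) for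
   eps = 1. Since w is imaginary the two have the same modulus on R. *)
Definition twin (eps : R[i]) z := z ^+ m * (z + eps * w) * \sum_(i < m) z ^+ i * w ^+ (m - i.+1).

Let tcoef eps n := if (n < m)%N then 0 else up (n - m) + eps * low (n - m).

Let twinE eps z : twin eps z = \sum_(n < m + m.+1) tcoef eps n * z ^+ n.
Proof.
rewrite big_split_ord /= big1 ?add0r; last by move=> n _; rewrite /tcoef ltn_ord mul0r.
rewrite (eq_bigr (fun i : 'I_m.+1 => z ^+ m * (up i * z ^+ i) + z ^+ m * (eps * (low i * z ^+ i)))); last first.
  by move=> i _; rewrite /tcoef ltnNge leq_addr addKn exprD /=; ring.
rewrite big_split /= -!mulr_sumr big_ord_recl big_ord_recr /= {2}/low ltnn !mul0r add0r addr0.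
rewrite /twin mulrDr mulrDl -[z ^+ m * z * _]mulrA -[z ^+ m * (eps * w) * _]mulrA -[eps * w * _]mulrA.
rewrite mulr_sumr; congr (_ + _); congr (_ * _).
  by apply: eq_bigr => i _; rewrite /bump /= add1n ltn_ord exprS; ring.
congr (_ * _); rewrite mulr_sumr; apply: eq_bigr => i _.
by rewrite /low ltn_ord -[(m - i)%N](@prednK (m - i)) ?subn_gt0// -subnS exprS; ring.
Qed.

Let tcoef_big eps n : (m + m.+1 <= n)%N -> tcoef eps n = 0.
Proof.
move=> mn; rewrite /tcoef /up /low; have -> : (n < m)%N = false by lia.
have -> : (n - m < m)%N = false by lia.
have -> : (n - m <= m)%N = false by lia.
by rewrite mulr0 addr0; case: (n - m)%N.
Qed.

Let twin_powser eps : powser (twin eps) (tcoef eps).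
Proof.
have := powser_poly (m + m.+1) (tcoef eps); congr powser; apply/funext => x; first by rewrite twinE.
by case: ltnP => // /tcoef_big ->.
Qed.

Let cmod_w k : cmod (w ^+ k) ^+ 2 = rad j ^+ (2 * k).
Proof. by rewrite cmodX cmodM cmodi mul1r cmodR gtr0_norm// -exprM mulnC. Qed.

Let Q := q j * rad j ^+ (2 * (m + m)).

(** The factor z^m of the twins moves the degrees to the range from m to 2 m, which is all of block
    [j]. There the powers of [w] balance the growth of [v], so all terms have the same size [Q] up
    to a factor 4. *)
Let v_block i : (i <= m)%N -> Q / 4 <= rad j ^+ (2 * (m - i)) * v (m + i) <= 4 * Q.
Proof.
move=> im; have bn : block (m + i) = j.
  by apply: block_bsize; move: im; rewrite /m /bsize; have := expn_gt0 2 j; lia.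
have /andP[h1 h2] := on_block (m + i); rewrite bn in h1 h2.
have E : rad j ^+ (2 * (m - i)) * rad j ^+ (2 * (m + i)) = rad j ^+ (2 * (m + m)).
  by rewrite -exprD; congr (_ ^+ _); lia.
have r0 : 0 < rad j ^+ (2 * (m - i)) by rewrite exprn_gt0.
by apply/andP; split; rewrite /Q -E; [apply: le_trans (ler_wpM2l (ltW r0) h1)|apply: le_trans (ler_wpM2l (ltW r0) h2) _];
  apply: le_of_eq; ring.
Qed.

(** After telescoping two coefficients remain, in degrees [m] and [m + m], each contributing at most
    [4 * Q]. *)
Let minus_bound : fock_space h (twin (-1)) /\ fock_norm h (twin (-1)) ^+ 2 <= 8 * Q.
Proof.
apply: f_bounded (twin_powser (-1)) _ => N.
have /andP[_ B0] := v_block (leq0n m); have /andP[_ B1] := v_block (leqnn m).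
rewrite subn0 addn0 in B0; rewrite subnn muln0 mul1r in B1.
have Q0 : 0 <= 4 * Q by rewrite !mulr_ge0 ?exprn_ge0// ltW.
apply: le_trans (_ : \sum_(n < N) ((if n == m :> nat then 4 * Q else 0) + (if n == (m + m)%N :> nat then 4 * Q else 0)) <= _).
  apply: ler_sum => n _; rewrite /tcoef /up /low; case: ltngtP => nm.
  - rewrite cmod0 expr0n mul0r; case: ifP => // _; rewrite addr_ge0//; case: ifP => //.
  - have [d nE d0] : exists2 d, nat_of_ord n = (m + d)%N & (0 < d)%N by exists (n - m)%N; lia.
    rewrite nE addKn add0r eqn_add2l; case: d nE d0 => // d nE _.
    case: (ltngtP d.+1 m) => dm.
    + by rewrite mulN1r subrr cmod0 expr0n mul0r.
    + by rewrite mulr0 addr0 cmod0 expr0n mul0r.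
    + by rewrite dm subnn expr0 mulr0 addr0 cmod1 expr1n mul1r.
  rewrite nm subnn m_gt0 subn0 add0r mulN1r cmodN cmod_w; apply: le_trans B0 _; rewrite lerDl; case: ifP => //.
rewrite big_split /=; have := sum_pick_le N m Q0; have := sum_pick_le N (m + m) Q0; lra.
Qed.

(** Here the inner [m.-1] coefficients double instead of cancelling; their squares gain a factor 4,
    which offsets the lower bound [Q / 4]. *)
Let plus_bound : fock_space h (twin 1) /\ (m.-1)%:R * Q <= fock_norm h (twin 1) ^+ 2.
Proof.
have ff : fock_space h (twin 1).
  apply: (proj1 (f_bounded (B := \sum_(n < m + m.+1) cmod (tcoef 1 n) ^+ 2 * v n) (twin_powser 1) _)) => N.
  have t0 n : 0 <= cmod (tcoef 1 n) ^+ 2 * v n by rewrite mulr_ge0 ?sqr_ge0// ltW.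
  apply: le_trans (_ : \sum_(n < m + m.+1 + N) cmod (tcoef 1 n) ^+ 2 * v n <= _).
    rewrite [in leRHS]addnC big_split_ord /= lerDl; exact: sumr_ge0.
  rewrite big_split_ord /= [X in _ + X]big1 ?addr0// => n _.
  by rewrite tcoef_big ?leq_addr// cmod0 expr0n mul0r.
split=> //; apply: le_trans (f_partial (m + m) (twin_powser 1) ff).
rewrite big_split_ord /= -[leLHS]add0r; apply: lerD.
  by apply: sumr_ge0 => n _; rewrite mulr_ge0 ?sqr_ge0// ltW.
apply: le_trans (@sum_pred_le _ (fun i => cmod (tcoef 1 (m + i)) ^+ 2 * v (m + i)) m _); last first.
  by move=> i; rewrite mulr_ge0 ?sqr_ge0// ltW.
rewrite -sum_ord_cst; apply: ler_sum => i _ /=.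
have im : (i.+1 < m)%N by have := ltn_ord i; lia.
have /andP[+ _] := v_block (ltnW im).
rewrite /tcoef /up /low ltnNge leq_addr addKn /= im (ltnW im) mul1r -mulr2n -[_ *+ 2]mulr_natl.
rewrite cmodM cmod_nat exprMn cmod_w -[2 ^+ 2 * _ * _]mulrA; move: (rad j ^+ (2 * (m - i.+1)) * v (m + i.+1)) Q => X Y.
by rewrite ler_pdivrMr// mulrC expr2 -natrM.
Qed.

Lemma twins : exists f g, [/\ fock_space h f, fock_space h g,
  forall x : R, cmod (f x%:C) = cmod (g x%:C) & 
  exists2 Q : R, 0 < Q & fock_norm h f ^+ 2 <= 8 * Q /\ ((bsize j).-1)%:R * Q <= fock_norm h g ^+ 2].
Proof.
have [f1 f2] := minus_bound; have [g1 g2] := plus_bound.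
exists (twin (-1)), (twin 1); split=> //.
  move=> x; rewrite /twin !cmodM; congr (_ * _ * _).
  (* For real [x] the factors x + w and x - w are conjugate, as [w] is imaginary. *)
  rewrite -[LHS]cmodJ; congr (cmod _); apply: complex_ext; rewrite /w !ReImE /=; ring.
by exists Q; rewrite // mulr_gt0 ?exprn_gt0.
Qed.

End reflection.

Section not_de_branges.
Variable R : realType.
Variables (h : R -> R).
Hypothesis twins : forall j, (0 < bsize j)%N -> exists f g, [/\ fock_space h f, fock_space h g,
  forall x : R, cmod (f x%:C) = cmod (g x%:C) & 
  exists2 Q : R, 0 < Q & fock_norm h f ^+ 2 <= 8 * Q /\ ((bsize j).-1)%:R * Q <= fock_norm h g ^+ 2].

Lemma not_de_branges : ~ fock_is_de_branges h.
Proof.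
move=> [E [_ _ [c [C [c0 C0 H]]]]].
(* As [j <= bsize j], the offset 2 makes [(bsize j).-1] exceed [8 * C ^+ 2 / c ^+ 2]. *)
pose j := (Num.bound (8 * C ^+ 2 / c ^+ 2)).+2.
have b0 : (0 < bsize j)%N by apply: leq_trans (bsize_ge j).
have [f [g [ff gg fgE [Q Q0 [h1 h2]]]]] := twins b0.
have E1 : de_branges_norm E f = de_branges_norm E g.
  congr (Num.sqrt (fine _)); apply: eq_integral => x _; by rewrite fgE.
have /andP[_ hf] := H f ff; have /andP[hg _] := H g gg.
have hfg : c * fock_norm h g <= C * fock_norm h f by apply: le_trans hg _; rewrite -E1.
have nf : 0 <= fock_norm h f := sqrtr_ge0 _; have ng : 0 <= fock_norm h g := sqrtr_ge0 _.
have : c ^+ 2 * (((bsize j).-1)%:R * Q) <= C ^+ 2 * (8 * Q).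
  apply: le_trans (ler_wpM2l (sqr_ge0 c) h2) _; apply: le_trans (ler_wpM2l (sqr_ge0 C) h1).
  by rewrite -!exprMn lerXn2r ?nnegrE ?mulr_ge0// ltW.
rewrite !mulrA ler_pM2r// mulrC [C ^+ 2 * 8]mulrC -ler_pdivlMr ?exprn_gt0// leNgt => /negP; apply.
have x0 : 0 <= 8 * C ^+ 2 / c ^+ 2 by apply: divr_ge0; rewrite ?sqr_ge0// pmulr_rge0 ?sqr_ge0.
apply: lt_le_trans (archi_boundP x0) _; rewrite ler_nat; have := bsize_ge j.
by rewrite {1}/j; case: (bsize j) => // b /ltnW.
Qed.

End not_de_branges.

(** * Moments of the lacunary weight *)

Section lacunary_weight.
Variable R : realType.
Variable K : nat -> nat.
Hypothesis K0 : K 0 = 0%N.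
Hypothesis Kgap : forall j, (K j + 4 * j.+1 + 13 <= K j.+1)%N.
Local Notation W := (fun z : R[i] => weight K0 Kgap (cmod z)).
Local Notation peak := (peak R K0 Kgap).
Local Notation kappa := (kappa R).

Definition hweight (r : R) : R := - ln (weight K0 Kgap r).

Lemma expR_hweight (z : R[i]) : expR (- hweight (cmod z)) = W z.
Proof. by rewrite /hweight opprK lnK// posrE weight_gt0. Qed.

Definition vmoment n : R := fine (moment W n).

Lemma vmomentE n : moment W n = (vmoment n)%:E.
Proof.
rewrite fineK// fin_numElt; have h1 := moment_ge R K0 Kgap n; have h2 := moment_le R K0 Kgap n.
by rewrite (lt_le_trans (ltNyr _) h1) (le_lt_trans h2 (ltry _)).
Qed.

Lemma vmoment_bounds n :
  peak (K (block n)) n * kappa / 2 ^+ (block n + 2) <= vmoment n <= 4 * peak (K (block n)) n * kappa / 2 ^+ block n.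
Proof.
have p0 : 0 < peak (K (block n)) n := peak_gt0 _ _ _ _ _; have k0 : 0 < kappa := kappa_gt0 _.
have /andP[b1 b2] := blockP n.
have := moment_ge R K0 Kgap n; have := moment_le R K0 Kgap n; rewrite vmomentE !lee_fin => h1 h2.
apply/andP; split.
  apply: le_trans h2; rewrite -mulrA ler_wpM2l ?(ltW p0)// ler_wpM2l ?(ltW k0)// lef_pV2 ?posrE ?exprn_gt0//.
    by rewrite -natrM -natrX ler_nat addn2 expnS leq_mul2l/= ltnW.
apply: le_trans h1 _; rewrite [leRHS](_ : _ = 4 * peak (K (block n)) n * (kappa / 2 ^+ block n)); last by ring.
apply: ler_wpM2l; first by rewrite mulr_ge0 ?(ltW p0).
apply: ler_wpM2l; first exact: ltW.
by rewrite lef_pV2 ?posrE ?exprn_gt0 ?ltr0n// -natrX ler_nat.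
Qed.

Lemma vmoment_gt0 n : 0 < vmoment n.
Proof.
have /andP[+ _] := vmoment_bounds n; apply: lt_le_trans.
by rewrite divr_gt0 ?exprn_gt0// mulr_gt0 ?peak_gt0 ?kappa_gt0.
Qed.

Definition radius j : R := 2 ^+ K j.
(** The part of [peak (K j) n * kappa / 2 ^+ j] that does not depend on [n]; replacing [n.+1] by the
    power of 2 that opens its block costs at most a factor 2. *)
Definition qweight j : R := kappa * wcoef R K0 Kgap (K j) * radius j ^+ 2 / 2 ^+ j.

Lemma radius_gt0 j : 0 < radius j. Proof. by rewrite exprn_gt0. Qed.

Lemma radius_inj : injective radius.
Proof.
move=> i j /eqP; rewrite /radius -!natrX eqr_nat eqn_exp2l// => /eqP.
exact: K_inj Kgap _ _.
Qed.

Lemma qweight_gt0 j : 0 < qweight j.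
Proof. by rewrite !mulr_gt0 ?kappa_gt0 ?wcoef_gt0 ?exprn_gt0 ?invr_gt0 ?exprn_gt0. Qed.

Lemma qweightE j n : qweight j * radius j ^+ (2 * n) = peak (K j) n * kappa / 2 ^+ j.
Proof.
rewrite /qweight peakE -/(radius j) mulnS exprD.
by ring.
Qed.

Lemma vmoment_on_block n : qweight (block n) / 4 * radius (block n) ^+ (2 * n) <= vmoment n <=
  4 * qweight (block n) * radius (block n) ^+ (2 * n).
Proof.
rewrite [X in X <= _]mulrAC -[X in _ <= _ <= X]mulrA !qweightE.
have /andP[h1 h2] := vmoment_bounds n; apply/andP; split.
  by apply: le_trans h1; rewrite exprD invfM mulrA (_ : 2 ^+ 2 = 4 :> R)// -natrX.
by apply: le_trans h2 _; rewrite !mulrA.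
Qed.

Lemma peak_far n j d : (K j + d = K (block n) \/ K j = K (block n) + d)%N ->
  2 ^+ d * peak (K j) n <= peak (K (block n)) n.
Proof. by case=> [/peak_far_up|->]; [exact|exact: peak_far_down]. Qed.

Lemma vmoment_off_block n j : j != block n ->
  qweight j * radius j ^+ (2 * n) * 2 ^+ (2 * block n + j + 11) <= vmoment n.
Proof.
set i := block n => ji; rewrite qweightE.
(* Of the exponent [2 * i + j + 11] the [j] cancels against [2 ^+ j] in [qweight j], and the lower
   bound for the moment adds [i + 2]; this makes [3 * i + 13], within the gap between the radii. *)
have [d [dE di]] : exists d, ((K j + d = K i \/ K j = K i + d) /\ 3 * i + 13 <= d)%N.
  case: (ltngtP j i) => [h|h|h]; last by rewrite h eqxx in ji.
    exists (K i - K j)%N; have := K_lt K0 Kgap h; lia.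
  exists (K j - K i)%N; have := K_lt K0 Kgap h; lia.
have p := peak_far dE; have pj : 0 < peak (K j) n := peak_gt0 _ _ _ _ _; have k0 : 0 < kappa := kappa_gt0 _.
have /andP[+ _] := vmoment_bounds n; apply: le_trans; rewrite -/i.
rewrite ler_pdivlMr ?exprn_gt0// -[(2 * i + j + 11)%N]addnA [(j + 11)%N]addnC addnA exprD.
have -> : peak (K j) n * kappa / 2 ^+ j * (2 ^+ (2 * i + 11) * 2 ^+ j) * 2 ^+ (i + 2) =
    2 ^+ (3 * i + 13) * peak (K j) n * kappa.
  have -> : (3 * i + 13 = (2 * i + 11) + (i + 2))%N by lia.
  rewrite (exprD 2 (2 * i + 11) (i + 2)); move: (peak (K j) n) kappa (2 ^+ (2 * i + 11)) (2 ^+ (i + 2)) => x y s t.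
  by field; rewrite expf_neq0.
rewrite ler_wpM2r ?(ltW k0)//; apply: le_trans p.
by rewrite ler_wpM2r ?(ltW pj)// ler_eXn2l ?ltr1n.
Qed.

(** A single fixed tent with [r < 2 ^+ k] bounds all moments from below, since [peak k n] never
    exceeds the maximal peak. Its exponent [2 * n.+1] has room for the loss [2 ^+ block n]. *)
Lemma vmoment_growth (r : R) : 0 < r -> exists2 M : R, 0 < M & forall n, r ^+ n <= M * vmoment n.
Proof.
move=> r0; pose k := (Num.bound r).+1; have k0 := kappa_gt0 R; have c0 := wcoef_gt0 R K0 Kgap k.
exists (4 / (kappa * wcoef R K0 Kgap k)); first by rewrite divr_gt0// mulr_gt0.
move=> n; rewrite mulrC mulrA ler_pdivlMr ?mulr_gt0//.
have /andP[+ _] := vmoment_bounds n; rewrite ler_pdivrMr ?exprn_gt0// => h.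
have := peak_max R K0 Kgap n k; rewrite peakE => h'.
have /andP[b1 _] := blockP n.
have rk : r ^+ n * 2 ^+ block n <= (2 ^+ k) ^+ (2 * n.+1).
  apply: le_trans (_ : (2 ^+ k) ^+ n * 2 ^+ n <= _).
    apply: ler_pM; rewrite ?exprn_ge0 ?(ltW r0)//.
      by rewrite lerXn2r ?nnegrE ?(ltW r0) ?exprn_ge0// ltW// upper_nthrootP.
    rewrite -!natrX ler_nat; apply: leq_trans b1 _; exact: ltn_expl.
  rewrite -!exprM -exprD ler_eXn2l ?ltr1n//; rewrite /k; nia.
have : r ^+ n * (kappa * wcoef R K0 Kgap k) * 2 ^+ block n <= vmoment n * 4 * 2 ^+ block n.
  rewrite exprD in h.
  apply: le_trans (_ : kappa * (wcoef R K0 Kgap k * (2 ^+ k) ^+ (2 * n.+1)) <= _).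
    rewrite (_ : _ * _ * _ = kappa * wcoef R K0 Kgap k * (r ^+ n * 2 ^+ block n)); last by ring.
    by rewrite [leRHS]mulrA ler_wpM2l// mulr_ge0 ?ltW.
  apply: le_trans (_ : kappa * peak (K (block n)) n <= _); first by rewrite ler_wpM2l// ltW.
  rewrite mulrC; apply: le_trans h _; apply: le_of_eq; ring.
by rewrite ler_pM2r ?exprn_gt0.
Qed.

Lemma hweight_riesz : has_riesz_basis_of_kernels hweight.
Proof.
have mW := @rmeas_weight R K K0 Kgap.
pose ker := kern vmoment_gt0 vmoment_growth.
exists (fun l z => ker l z / (fock_norm hweight (ker l))%:C), (range (node radius)); split.
- exact: (kern_normalized expR_hweight mW vmoment_gt0 vmomentE vmoment_growth).
- exact: card_image_le.
apply: (riesz_basis_nodes vmoment_gt0 _ _ _ _ _ _ _ radius_gt0 radius_inj qweight_gt0 vmoment_on_block vmoment_off_block).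
- exact: fock_powser.
- exact: (fock_bounded expR_hweight mW vmoment_gt0 vmomentE).
- exact: (fock_partial expR_hweight mW vmoment_gt0 vmomentE).
- exact: (fock_cvg expR_hweight mW vmoment_gt0 vmomentE).
- exact: kern_powser.
- exact: (kern_fock expR_hweight mW vmoment_gt0 vmomentE).
- exact: (kern_norm_gt0 expR_hweight mW vmoment_gt0 vmomentE).
Qed.

Lemma hweight_not_de_branges : ~ fock_is_de_branges hweight.
Proof.
have mW := @rmeas_weight R K K0 Kgap.
apply: not_de_branges => j; apply: (twins vmoment_gt0 _ _ radius_gt0 qweight_gt0 vmoment_on_block).
- exact: (fock_bounded expR_hweight mW vmoment_gt0 vmomentE).
- exact: (fock_partial expR_hweight mW vmoment_gt0 vmomentE).
Qed.

End lacunary_weight.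

Lemma superlinear_threshold (R : realType) (phi : R -> R) (c : R) :
  (forall x, 0 <= x -> 0 < phi x) -> (fun x => x) =o_+oo phi -> 0 <= c ->
  exists T : nat, forall t, T%:R <= t -> c * (2 * t + 3) <= phi t.
Proof.
move=> phi0 /eqoP phio c0.
(* For [t >= 1] one has [2 * t + 3 <= 5 * t]. *)
have C0 : 0 < 5 * c + 1 by lra.
have Ci : 0 < (5 * c + 1)^-1 by rewrite invr_gt0.
have [M [_ HM]] := phio _ Ci.
exists (Num.bound `|M|).+1 => t; rewrite -natr1 => Tt.
have Mb : `|M| < (Num.bound `|M|)%:R by apply: archi_boundP.
have t1 : 1 <= t by have := normr_ge0 M; lra.
have tM : M < t by have := ler_norm M; lra.
have pt : 0 < phi t by apply: phi0; lra.
have := HM t tM; rewrite !ger0_norm; [|lra|lra].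
rewrite mulrC ler_pdivlMr// => H; nra.
Qed.

(** * Choice of the radii *)

Section gaps.
Variable T : nat -> nat.

(* The gap 4 (j + 1) + 13 makes the off-diagonal part of the Gram matrix
   small, the remaining summand makes psi small compared with phi. *)
Fixpoint gaps j : nat := if j is i.+1 then (gaps i + 4 * i.+1 + 13 + (2 * T i.+2 + 2))%N else 0%N.

Lemma gaps_step j : (gaps j + 4 * j.+1 + 13 <= gaps j.+1)%N.
Proof. by rewrite /= leq_addr. Qed.

Lemma gaps_threshold j : (0 < j)%N -> (2 * T j.+1 + 2 <= gaps j)%N.
Proof. by case: j => // j _; rewrite /= leq_addl. Qed.

End gaps.

(** * Growth of the weight compared with [phi] *)

Lemma dyadic_bracket (R : realType) (x : R) : 1 <= x -> exists k, 2 ^+ k <= x < 2 ^+ k.+1.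
Proof.
move=> x1; have ex : exists k, x < 2 ^+ k by exists (Num.bound x); exact: upper_nthrootP.
case: (ex_minnP ex) => [[|k]] xk kmin; first by rewrite expr0 ltNge x1 in xk.
by exists k; rewrite xk andbT leNgt; apply/negP => /kmin; rewrite ltnn.
Qed.

Lemma expR1_ge2 (R : realType) : 2 <= expR 1 :> R.
Proof. by have := expR_ge1Dx (1 : R); lra. Qed.

(** With [expR1_ge2] this places [2 ^+ k] between the exponentials of [k / 2] and [k], a comparison
    coarse enough to avoid the logarithm of 2. *)
Lemma expR_half_le2 (R : realType) : expR 2^-1 <= 2 :> R.
Proof.
have := expR_ge1Dx (- 2^-1 : R); rewrite expRN => h.
have e0 : 0 < expR 2^-1 :> R := expR_gt0 _.
have : 2^-1 <= (expR 2^-1)^-1 :> R by lra.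
by rewrite lef_pV2 ?posrE.
Qed.

Lemma pow2_le_expR (R : realType) k : 2 ^+ k <= expR k%:R :> R.
Proof. by rewrite -[k%:R]mulr1 expRM_natl lerXn2r ?nnegrE ?expR_ge0// expR1_ge2. Qed.

Lemma expR_le_pow2 (R : realType) k : expR (k%:R / 2) <= 2 ^+ k :> R.
Proof. by rewrite expRM_natl lerXn2r ?nnegrE ?expR_ge0// expR_half_le2. Qed.

Section growth.
Variable R : realType.
Variable K : nat -> nat.
Hypothesis K0 : K 0 = 0%N.
Hypothesis Kgap : forall j, (K j + 4 * j.+1 + 13 <= K j.+1)%N.
Local Notation weight := (weight K0 Kgap).
Local Notation h := (@hweight R K K0 Kgap).
Local Notation level := (level K0 Kgap).

Lemma hweight_continuous : continuous h.
Proof.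
move=> r; rewrite /hweight; apply: cvgN; apply: (@continuous_comp _ _ _ weight (@ln R)).
  exact: weight_continuous.
by apply: continuous_ln; exact: weight_gt0.
Qed.

Lemma hweight_increasing (s t : R) : s < t -> h (expR s) < h (expR t).
Proof.
move=> st; rewrite /hweight ltrN2 ltr_ln ?posrE ?weight_gt0//.
by apply: weight_decreasing; rewrite ?expR_ge0// ltr_expR.
Qed.

Lemma hweight_cvg : h (expR t) @[t --> +oo] --> +oo.
Proof.
apply/cvgryPge => M; have [m hm] := half_to0 2 (expR_gt0 (- M)).
near=> t; rewrite /hweight lerNr -ler_expR lnK ?posrE ?weight_gt0//.
apply: le_trans (ltW hm); apply: weight_le; rewrite ger0_norm ?expR_ge0//.
apply: le_trans (pow2_le_expR R m) _; rewrite ler_expR.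
by near: t; exact: nbhs_pinfty_ge.
Unshelve. all: by end_near. Qed.

Lemma level_mono k l : (k <= l)%N -> (level k <= level l)%N.
Proof. by move=> kl; rewrite levelE; apply: leq_ltn_trans kl _; rewrite -(levelE K0 Kgap). Qed.

Lemma dexp_le k : (dexp K0 Kgap k <= k * 2 ^ (level k).+1)%N.
Proof.
rewrite /dexp; apply: leq_trans (_ : \sum_(i < k) 2 ^ (level k).+1 <= _)%N; last first.
  by rewrite sum_nat_const card_ord.
apply: leq_sum => i _; rewrite /slope; apply: leq_trans (leq_pred _) _.
by rewrite leq_exp2l// ltnS level_mono// ltnW.
Qed.

(** Here [2 ^+ k <= expR t < 2 ^+ k.+1], so [weight_ge] bounds [h] by [dexp] at [k.+2] plus 1. Up to
    that index no slope exceeds [2 ^ (level k.+2).+1], and [k.+2] is at most [2 * t + 2]. *)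
Lemma hweight_le (t : R) : 0 <= t -> exists k, [/\ k%:R <= 2 * t, t <= k.+1%:R &
  h (expR t) <= 2 ^+ (level k.+2).+1 * (2 * t + 3)].
Proof.
move=> t0; have e1 : 1 <= expR t by have := expR_ge1Dx t; lra.
have [k /andP[k1 k2]] := dyadic_bracket e1; exists k.
have kt : k%:R <= 2 * t.
  have := le_trans (expR_le_pow2 R k) k1; rewrite ler_expR; lra.
split=> //.
  have := lt_le_trans k2 (pow2_le_expR R k.+1); rewrite ltr_expR => /ltW//.
have wg := @weight_ge R K K0 Kgap (expR t) k.+1; rewrite ger0_norm ?expR_ge0// in wg.
have {}wg := wg (ltW k2).
apply: le_trans (_ : (dexp K0 Kgap k.+2).+1%:R <= _).
  rewrite /hweight lerNl -ler_expR lnK ?posrE ?weight_gt0//; apply: le_trans wg.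
  rewrite expRN /wcoef -invfM -exprSr lef_pV2 ?posrE ?expR_gt0 ?exprn_gt0//.
  exact: pow2_le_expR.
rewrite -natr1; set J := level _.
have d : (dexp K0 Kgap k.+2)%:R <= k.+2%:R * 2 ^+ J.+1 :> R by rewrite -natrX -natrM ler_nat; exact: dexp_le.
have J1 : 1 <= 2 ^+ J.+1 :> R by rewrite exprn_ege1// ler1n.
have k2E : k.+2%:R = k%:R + 2 :> R by rewrite -addn2 natrD.
rewrite k2E in d; have := normr_ge0 (k%:R : R); nra.
Qed.

(** Let [J] be the level that occurs in [hweight_le]. Once [T J <= t], the first hypothesis for
    [j := J] bounds [J%:R * h (expR t)] by [phi t], and [J] tends to infinity with [t]. *)
Lemma hweight_littleo (phi : R -> R) (T : nat -> nat) :
  (forall j t, (T j)%:R <= t -> j%:R * 2 ^+ j.+1 * (2 * t + 3) <= phi t) ->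
  (forall j, (0 < j)%N -> (2 * T j.+1 + 2 <= K j)%N) ->
  (fun t => h (expR t)) =o_+oo phi.
Proof.
move=> HT KT; apply/eqoP => eps eps0.
have [N N1 hN] : exists2 N, (0 < N)%N & eps^-1 <= N%:R.
  exists (Num.bound eps^-1).+1 => //; have ie : 0 <= eps^-1 by rewrite invr_ge0 ltW.
  by apply: le_trans (ltW (archi_boundP ie)) _; rewrite ler_nat.
near=> t.
have t0 : 0 <= t by near: t; exact: nbhs_pinfty_ge.
have tK : (K N)%:R <= t by near: t; apply: nbhs_pinfty_ge; exact: num_real.
have h0 : 0 <= h (expR t) by near: t; move/cvgryPge : hweight_cvg => /(_ 0).
have [k [k1 k2 hk]] := hweight_le t0; rewrite ger0_norm//.
have := levelE K0 Kgap k.+2; move: (level k.+2) hk => J hk lev.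
have KNk : (K N <= k.+1)%N by rewrite -(ler_nat R); exact: le_trans k2.
have NJ : (N < J)%N by rewrite ltnNge lev -leqNgt; lia.
(* The circle [J.-1] has already been passed, while [T J] was built into its radius. Hence
   [2 * T J <= k], and [T J <= t] follows from [k <= 2 * t]. *)
have KJ : (K J.-1 <= k.+2)%N by rewrite leqNgt -lev -ltnNge; lia.
have TJ : (2 * T J + 2 <= K J.-1)%N by have := KT J.-1; rewrite prednK; [apply|]; lia.
have Tt : (T J)%:R <= t.
  have : (2 * T J)%:R <= k%:R :> R by rewrite ler_nat; lia.
  by rewrite natrM; lra.
have Hphi := HT _ _ Tt.
have J0 : 0 < J%:R :> R by rewrite ltr0n; lia.
have eJ : 1 <= eps * J%:R.
  rewrite -ler_pdivrMl// mulr1; apply: le_trans hN _; rewrite ler_nat; lia.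
apply: le_trans (_ : eps * phi t <= _); last by rewrite ler_wpM2l ?(ltW eps0)// ler_norm.
apply: le_trans (ler_wpM2l (ltW eps0) Hphi).
have B0 : 0 <= 2 ^+ J.+1 * (2 * t + 3) by rewrite mulr_ge0 ?exprn_ge0//; lra.
rewrite -(mulrA J%:R); apply: le_trans hk _; move: (2 ^+ J.+1 * _) B0 => B B0.
by rewrite mulrA; exact: ler_peMl.
Unshelve. all: by end_near. Qed.

End growth.

Theorem theorem1p3 (R : realType) (phi : R -> R)
    (phi_gt0 : forall x, 0 <= x -> 0 < phi x)
    (phi_convex : convex_function (E := R^o) `[0, +oo[ phi)
    (phi_superlinear : (fun x => x) =o_+oo phi) :
  exists h : R -> R,
    [/\ {within `[0, +oo[, continuous h},
        {in `[0, +oo[ &, {homo (fun t => h (expR t)) : s t / s < t}},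
        h (expR t) @[t --> +oo] --> +oo,
        (fun t => h (expR t)) =o_+oo phi &
        has_riesz_basis_of_kernels h /\ ~ fock_is_de_branges h].
Proof.
have [T HT] : exists T : nat -> nat, forall j t, (T j)%:R <= t ->
    j%:R * 2 ^+ j.+1 * (2 * t + 3) <= phi t.
  have H j := @superlinear_threshold R phi (j%:R * 2 ^+ j.+1) phi_gt0 phi_superlinear
    (mulr_ge0 (ler0n _ _) (exprn_ge0 _ (ler0n _ _))).
  by exists (fun j => projT1 (cid (H j))) => j; case: cid.
pose K0 : gaps T 0 = 0%N := erefl.
exists (@hweight R _ K0 (gaps_step T)); split.
- exact/continuous_subspaceT/hweight_continuous.
- by move=> s t _ _; exact: hweight_increasing.
- exact: hweight_cvg.
- exact: hweight_littleo HT (gaps_threshold T).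
- by split; [exact: hweight_riesz|exact: hweight_not_de_branges].
Qed.
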